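(* Let $\tau$ be an irreducible $W$-representation and let $c$ be a real-valued $W$-invariant parameter in $U(\tau)$ (so that the standard module $M_c(\tau)$ is unitary) such that $\tfrac r2-N_c(\tau)\notin\mathbb{Z}_{\le 0}$ and $N_c(\tau)-N_c(\sigma)\notin\mathbb{Z}_{\ge 0}$ for all $\sigma\in\widehat W\setminus\{\tau\}$. Then, as an $(\mathcal{R}_c,\mathfrak{g})$-module, $K_c(\tau)=M_c(\tau)\otimes\wedge\mathfrak{h}^*$ decomposes as $$K_c(\tau)=\bigoplus_{\sigma\in\widehat W}\ \bigoplus_{(m,l)\in B(r)}\mathcal{M}_c(\tau,\sigma)_m^l\boxtimes L_{\mathfrak{spo}(2|2,\mathbb{C})}\big(m+r/2-N_c(\tau),\ l-r/2+N_c(\sigma)\big),$$ where $\mathcal{M}_c(\tau,\sigma)_m^l$ is the $\sigma$-isotypic component of the space of lowest weight vectors at the bidegree $(m,l)$. Each $\mathcal{M}_c(\tau,\sigma)_m^l$ is a finite-dimensional unitary $\mathcal{R}_c$-module.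
   Context: Let $E=\mathbb{R}^r$ be a Euclidean space with inner product $(\cdot,\cdot)$, identified with $E^*$ by means of it. Let $R\subseteq E^*$ be a finite root system (not necessarily crystallographic), $R_+$ a set of positive roots (write $\alpha>0$ for $\alpha\in R_+$), $W$ the finite real reflection group generated by the reflections $s_\alpha$, and $\alpha^\vee=2\alpha/(\alpha,\alpha)$ viewed in $E$. Let $c:R\to\mathbb{R}$, $\alpha\mapsto c_\alpha$, be $W$-invariant; $\mathscr{C}$ denotes the real vector space of all such $c$. Put $\mathfrak{h}=E\otimes_{\mathbb{R}}\mathbb{C}$ and let $\langle\cdot,\cdot\rangle:\mathfrak{h}^*\times\mathfrak{h}\to\mathbb{C}$ be the natural pairing. The rational Cherednik algebra $\mathsf{H}_c$ is the quotient of $T(\mathfrak{h}\oplus\mathfrak{h}^* )\#W$ by the relations $[y,y']=0=[x,x']$ and $[y,x]=\langle x,y\rangle-\sum_{\alpha>0}c_\alpha\langle\alpha,y\rangle\langle x,\alpha^\vee\rangle s_\alpha$ for $y,y'\in\mathfrak{h}$, $x,x'\in\mathfrak{h}^*$. Fix an orthonormal basis $\{y_i\}$ of $E\subseteq\mathfrak{h}$ with dual basis $\{x_i\}\subseteq E^*\subseteq\mathfrak{h}^*$. $\widehat W$ is the set of irreducible $\mathbb{C}W$-modules up to isomorphism; $V(\tau)$ is the space of $\tau$. The standard module is $M_c(\tau)=\mathsf{H}_c\otimes_{W\#\mathbb{C}[\mathfrak{h}^*]}V(\tau)$, where $\mathfrak{h}$ acts on $V(\tau)$ by $0$; as a vector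 space $M_c(\tau)\cong\mathbb{C}[\mathfrak{h}]\otimes V(\tau)$. $N_c(\tau)$ is the scalar by which $\sum_{\alpha>0}c_\alpha s_\alpha\in\mathbb{C}W$ acts on $V(\tau)$. The anti-linear anti-involution $*$ of $\mathsf{H}_c$ is given by $y_i^*=x_i$, $x_i^*=y_i$, $s_\alpha^*=s_\alpha$. Fix a $W$-invariant positive-definite Hermitian form on $V(\tau)$; $\beta_{c,\tau}$ is the unique $W$-invariant Hermitian form on $M_c(\tau)$ agreeing with it in degree $0$ and with $\beta_{c,\tau}(yz,z')=\beta_{c,\tau}(z,y^*z')$ for $y\in\mathfrak{h}$. $U(\tau)$ is a fixed open neighbourhood of $0\in\mathscr{C}$ such that for all $c\in U(\tau)$, $M_c(\tau)$ is irreducible and unitary (i.e. $\beta_{c,\tau}$ is positive definite). $\mathcal{C}$ is the complex Clifford algebra generated by $\mathfrak{h}\oplus\mathfrak{h}^*$ with relations $vv'+v'v=B(v,v')$, where $B$ is symmetric, extends $\langle\cdot,\cdot\rangle$, and vanishes on $\mathfrak{h}\times\mathfrak{h}$ and $\mathfrak{h}^*\times\mathfrak{h}^*$; it is $\mathbb{Z}$-graded with $\mathfrak{h}^*$ in degree $1$ and $\mathfrak{h}$ in degree $-1$, and the parity on $\mathsf{H}_c\otimes\mathcal{C}$ is the $\mathcal{C}$-degree mod $2$. $\mathcal{C}$ acts on $\wedge\mathfrak{h}^*$ with $x\in\mathfrak{h}^*$ acting by $x\wedge\cdot$ and $y\in\mathfrak{h}$ by contraction. $\wedge\mathfrak{h}^*$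 carries the natural positive-definite Hermitian (determinant) form, which is $*$-contravariant for the anti-linear anti-involution $y_i^*=x_i$ of $\mathcal{C}$; $K_c(\tau)$ carries the product form, and unitarity is with respect to $*$ on $\mathsf{H}_c\otimes\mathcal{C}$. Set $\tau_\alpha=1-\alpha\alpha^\vee\in\mathcal{C}$ and $\Omega_c=\sum_{\alpha>0}c_\alpha s_\alpha\otimes\tau_\alpha$; $W$ acts on $K_c(\tau)$ diagonally, $s_\alpha$ acting by $s_\alpha\otimes\tau_\alpha$. $\mathfrak{g}\cong\mathfrak{spo}(2|2,\mathbb{C})$ is the span in $\mathsf{H}_c\otimes\mathcal{C}$ of $H=\sum_i\tfrac12(x_iy_i+y_ix_i)\otimes1$, $Z=\sum_i1\otimes\tfrac12(x_iy_i-y_ix_i)+\Omega_c$, $E_1^+=-\sum_i\tfrac12x_i^2\otimes1$, $E_1^-=\sum_i\tfrac12y_i^2\otimes1$, $E_2^+=\sum_iy_i\otimes x_i$, $E_2^-=\sum_ix_i\otimes y_i$, $E_3^+=-\sum_ix_i\otimes x_i$, $E_3^-=-\sum_iy_i\otimes y_i$; $\mathfrak{n}^-$ is the span of $E_1^-,E_2^-,E_3^-$. $\mathcal{R}_c$ is the (super)centraliser of $\mathfrak{g}$ in $\mathsf{H}_c\otimes\mathcal{C}$. $K_c(\tau)$ has bidegree $(m,l)$ component $\mathbb{C}[\mathfrak{h}]_m\otimes V(\tau)\otimes\wedge^l\mathfrak{h}^*$, and $\mathcal{M}_c(\tau,\sigma)_m^l$ is the set of vectors in its $\sigma$-isotypic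 component (for the diagonal $W$) killed by $\mathfrak{n}^-$. $L_{\mathfrak{spo}(2|2,\mathbb{C})}(\mu,\nu)$ is the irreducible lowest weight $\mathfrak{g}$-module generated by a vector killed by $\mathfrak{n}^-$ on which $H$ acts by $\mu$ and $Z$ by $\nu$. $B(r)=\{(0,0),(1,r-1)\}\cup\{(m,l)\mid m\ge1,\ 0\le l\le r-2\}\subseteq\mathbb{Z}_{\ge0}\times\mathbb{Z}_{\ge0}$. $\boxtimes$ is the external tensor product.
   Formalization: R_c need not preserve a single M_c(τ,σ)_m^l when weights coincide (W={±1}², c1=c2, τ trivial), so the R_c-module structure, equivariance and unitarity are stated for the sum of those of equal weight, and for each one only if no other nonzero one has the same weight. *)

(* Defs.v *)
From HB Require Import structures.
From mathcomp Require Import all_boot all_order all_algebra all_fingroup all_character.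
From mathcomp Require Import complex.
From mathcomp Require Import boolp classical_sets reals topology.

Set Implicit Arguments.
Unset Strict Implicit.
Unset Printing Implicit Defensive.

Import Order.TTheory GRing.Theory Num.Theory.
Import numFieldTopology.Exports.
Local Open Scope ring_scope.
Local Open Scope complex_scope.

(* Subspaces of the possibly infinite-dimensional spaces below are predicates  *)
(* [V -> Prop]. Algebras given by generators and relations, tensor products of *)
(* algebras and induced modules are characterised by their universal           *)
(* properties, hence determined up to unique isomorphism.                      *)
Section LinearAlgebra.

Variable F : fieldType.

Definition pairing n (u v : 'cV[F]_n) : F := \sum_i u i 0 * v i 0.

Definition basis_vec n (i : 'I_n) : 'cV[F]_n := delta_mx i 0.

Variables V W : lmodType F.

Definition lin_span (P : V -> Prop) (z : V) : Prop :=
  exists (n : nat) (a : 'I_n -> F) (u : 'I_n -> V),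
    (forall k, P (u k)) /\ z = \sum_k a k *: u k.

Definition linear_subspace (P : V -> Prop) : Prop :=
  P 0 /\ forall a u v, P u -> P v -> P (a *: u + v).

Definition finite_dimensional (P : V -> Prop) : Prop :=
  exists (n : nat) (u : 'I_n -> V),
    forall z, P z -> exists a : 'I_n -> F, z = \sum_k a k *: u k.

Definition lin_independent n (u : 'I_n -> V) : Prop :=
  forall a : 'I_n -> F, \sum_k a k *: u k = 0 -> forall k, a k = 0.

Definition direct_sum_over (I : eqType) (B : pred I) (T : I -> V -> Prop)
    (S : V -> Prop) : Prop :=
  [/\ forall i z, B i -> T i z -> S z,
      forall z, S z -> lin_span (fun u => exists2 i, B i & T i u) z
    & forall (s : seq I) (z : I -> V), uniq s -> all B s ->
        (forall i, i \in s -> T i (z i)) ->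
        \sum_(i <- s) z i = 0 -> forall i, i \in s -> z i = 0].

Definition bilinear_on (P : V -> Prop) (X : lmodType F) (t : V -> W -> X)
    : Prop :=
  (forall a u u' v, P u -> P u' -> t (a *: u + u') v = a *: t u v + t u' v) /\
  (forall a u v v', P u -> t u (a *: v + v') = a *: t u v + t u v').

(* For [t] bilinear, the induced linear map P (x) W -> X is injective.         *)
Definition tensor_injective (P : V -> Prop) (X : lmodType F) (t : V -> W -> X)
    : Prop :=
  forall n (u : 'I_n -> V) (v : 'I_n -> W),
    (forall k, P (u k)) -> lin_independent u ->
    \sum_k t (u k) (v k) = 0 -> forall k, v k = 0.

(* Image of the induced linear map P (x) W -> X.                               *)
Definition tensor_image (P : V -> Prop) (X : lmodType F) (t : V -> W -> X)
    : X -> Prop :=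
  fun x => exists (n : nat) (u : 'I_n -> V) (v : 'I_n -> W),
    (forall k, P (u k)) /\ x = \sum_k t (u k) (v k).

End LinearAlgebra.

Definition module_action (F : fieldType) (A : algType F) (M : lmodType F)
    (act : A -> M -> M) : Prop :=
  [/\ forall h a z z', act h (a *: z + z') = a *: act h z + act h z',
      forall a h h' z, act (a *: h + h') z = a *: act h z + act h' z,
      forall z, act 1 z = z
    & forall h h' z, act (h * h') z = act h (act h' z)].

Definition irreducible_module (F : fieldType) (A : algType F) (M : lmodType F)
    (act : A -> M -> M) : Prop :=
  (exists z : M, z != 0) /\
  forall P : M -> Prop, linear_subspace P ->
    (forall h z, P z -> P (act h z)) ->
    (exists2 z, z != 0 & P z) -> forall z, P z.

(* Sesquilinear forms are linear in the first argument.                        *)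
Definition hermitian_form (R : realType) (V : lmodType R[i])
    (b : V -> V -> R[i]) : Prop :=
  (forall a u u' v, b (a *: u + u') v = a * b u v + b u' v) /\
  (forall u v, b v u = (b u v)^*%R).

Definition positive_definite_on (R : realType) (V : lmodType R[i])
    (P : V -> Prop) (b : V -> V -> R[i]) : Prop :=
  forall z, P z -> z != 0 -> 0 < b z z.

Section TensorAlgebra.

Variables (F : fieldType) (A1 A2 : algType F).

Record tensor_algebra := TensorAlgebra {
  ta_alg :> algType F;
  ta_inl : {lrmorphism A1 -> ta_alg};
  ta_inr : {lrmorphism A2 -> ta_alg};
  ta_comm : forall a b, ta_inl a * ta_inr b = ta_inr b * ta_inl a;
  ta_univ : forall (D : algType F) (f : {lrmorphism A1 -> D})
      (g : {lrmorphism A2 -> D}),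
    (forall a b, f a * g b = g b * f a) ->
    exists h : {lrmorphism ta_alg -> D},
      [/\ forall a, h (ta_inl a) = f a,
          forall b, h (ta_inr b) = g b
        & forall h' : {lrmorphism ta_alg -> D},
            (forall a, h' (ta_inl a) = f a) ->
            (forall b, h' (ta_inr b) = g b) -> h' =1 h]
}.

Definition tens (A : tensor_algebra) (a : A1) (b : A2) : A :=
  ta_inl A a * ta_inr A b.

End TensorAlgebra.

Section RootSystems.

Variables (R : realType) (r : nat).

Definition coroot (a : 'cV[R]_r) : 'cV[R]_r := (2 / pairing a a) *: a.

Definition reflection (a v : 'cV[R]_r) : 'cV[R]_r := v - pairing a v *: coroot a.

(* The roots need not span R^r.                                                *)
Record root_system := RootSystem {
  nroots : nat;
  root : 'I_nroots -> 'cV[R]_r;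
  root_inj : injective root;
  root_neq0 : forall i, root i != 0;
  root_reflection : forall i j, exists k, root k = reflection (root i) (root j);
  root_reduced : forall i j a, root j = a *: root i -> a = 1 \/ a = - 1;
  is_pos : pred 'I_nroots;
  is_posP : exists v : 'cV[R]_r,
    (forall i, pairing (root i) v != 0) /\
    (forall i, is_pos i = (0 < pairing (root i) v))
}.

Record reflection_group (Phi : root_system) (gT : finGroupType) :=
  ReflectionGroup {
  rg_group :> {group gT};
  rg_repr : mx_representation R rg_group r;
  rg_faithful : mx_faithful rg_repr;
  rg_s : 'I_(nroots Phi) -> gT;
  rg_s_in : forall i, rg_s i \in rg_group;
  rg_sE : forall i v, rg_repr (rg_s i) *m v = reflection (root i) v;
  rg_gen : rg_group = <<[set rg_s i | i : 'I_(nroots Phi)]>>%g :> {set gT}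
}.

Definition complexify n (v : 'cV[R]_n) : 'cV[R[i]]_n :=
  map_mx (fun a : R => a%:C) v.

End RootSystems.

Arguments root {R r} _ _.
Arguments is_pos {R r} _ _.
Arguments nroots {R r} _.

Section Clifford.

Variables (F : fieldType) (r : nat).

(* An element of h (+) h^* is a pair (y, x).                                   *)
Definition Bform (v v' : 'cV[F]_r * 'cV[F]_r) : F :=
  pairing v.2 v'.1 + pairing v'.2 v.1.

Record clifford := Clifford {
  cl_alg :> algType F;
  cl_in : {linear ('cV[F]_r * 'cV[F]_r)%type -> cl_alg};
  cl_rel : forall v v', cl_in v * cl_in v' + cl_in v' * cl_in v = (Bform v v')%:A;
  cl_univ : forall (D : algType F)
      (f : {linear ('cV[F]_r * 'cV[F]_r)%type -> D}),
    (forall v v', f v * f v' + f v' * f v = (Bform v v')%:A) ->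
    exists h : {lrmorphism cl_alg -> D},
      (forall v, h (cl_in v) = f v) /\
      (forall h' : {lrmorphism cl_alg -> D},
        (forall v, h' (cl_in v) = f v) -> h' =1 h)
}.

Definition cl_y (Cl : clifford) (u : 'cV[F]_r) : Cl := cl_in Cl (u, 0).
Definition cl_x (Cl : clifford) (u : 'cV[F]_r) : Cl := cl_in Cl (0, u).

(* M (x) /\h^* is {ffun {set 'I_r} -> M}: k stands for the sum over subsets    *)
(* S = {i1 < ... < il} of k(S) (x) x_i1 /\ ... /\ x_il.                        *)
Variable M : lmodType F.

Definition ext_sign (i : 'I_r) (S : {set 'I_r}) : F :=
  (-1) ^+ #|[set j in S | (j < i)%N]|.

Definition wedge (i : 'I_r) (k : {ffun {set 'I_r} -> M}) :
    {ffun {set 'I_r} -> M} :=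
  [ffun S : {set 'I_r} => if i \in S then ext_sign i S *: k (S :\ i) else 0].

Definition contract (i : 'I_r) (k : {ffun {set 'I_r} -> M}) :
    {ffun {set 'I_r} -> M} :=
  [ffun S : {set 'I_r} => if i \in S then 0 else ext_sign i S *: k (i |: S)].

End Clifford.

Section Cherednik.

Variables (R : realType) (r : nat) (Phi : root_system R r).
Variables (gT : finGroupType) (W : reflection_group Phi gT).

Local Notation C := (R[i]).
Local Notation h := ('cV[C]_r).

Definition croot i : h := complexify (root Phi i).
Definition ccoroot i : h := complexify (coroot (root Phi i)).

Definition W_invariant (c : 'rV[R]_(nroots Phi)) : Prop :=
  forall g i j, g \in W -> root Phi j = rg_repr W g *m root Phi i ->
    c 0 i = c 0 j.

(* h^* is identified with h through the inner product, so W acts on both by    *)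
(* the same orthogonal matrices.                                               *)
Definition hact (g : gT) (v : h) : h := map_mx (fun a : R => a%:C) (rg_repr W g) *m v.

Section FixedParameter.

Variable c : 'rV[R]_(nroots Phi).

Record cherednik_relations (A : algType C) (x y : {linear h -> A})
    (w : gT -> A) : Prop := CherednikRelations {
  cr_w1 : w 1%g = 1;
  cr_wM : {in W &, {morph w : g g' / (g * g')%g >-> g * g'}};
  cr_wx : forall g u, g \in W -> w g * x u = x (hact g u) * w g;
  cr_wy : forall g v, g \in W -> w g * y v = y (hact g v) * w g;
  cr_xx : forall u u', x u * x u' = x u' * x u;
  cr_yy : forall v v', y v * y v' = y v' * y v;
  cr_yx : forall v u, y v * x u - x u * y v =
    (pairing u v)%:A -
    \sum_(i | is_pos Phi i)
      ((c 0 i)%:C * pairing (croot i) v * pairing u (ccoroot i)) *: w (rg_s W i)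
}.

Record cherednik := Cherednik {
  ch_alg :> algType C;
  ch_x : {linear h -> ch_alg};
  ch_y : {linear h -> ch_alg};
  ch_w : gT -> ch_alg;
  ch_rel : cherednik_relations ch_x ch_y ch_w;
  ch_univ : forall (D : algType C) (x y : {linear h -> D}) (w : gT -> D),
    cherednik_relations x y w ->
    exists f : {lrmorphism ch_alg -> D},
      [/\ forall u, f (ch_x u) = x u,
          forall v, f (ch_y v) = y v,
          forall g, g \in W -> f (ch_w g) = w g
        & forall f' : {lrmorphism ch_alg -> D},
            (forall u, f' (ch_x u) = x u) -> (forall v, f' (ch_y v) = y v) ->
            (forall g, g \in W -> f' (ch_w g) = w g) -> f' =1 f]
}.

(* A complex W-module is a matrix representation acting on column vectors.     *)
Record standard_module (H : cherednik) d (tau : mx_representation C W d) :=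
  StandardModule {
  sm_mod :> lmodType C;
  sm_act : H -> sm_mod -> sm_mod;
  sm_actP : module_action sm_act;
  sm_in : {linear 'cV[C]_d -> sm_mod};
  sm_inW : forall g v, g \in W -> sm_act (ch_w H g) (sm_in v) = sm_in (tau g *m v);
  sm_iny : forall u v, sm_act (ch_y H u) (sm_in v) = 0;
  sm_univ : forall (N : lmodType C) (actN : H -> N -> N)
      (f : {linear 'cV[C]_d -> N}),
    module_action actN ->
    (forall g v, g \in W -> actN (ch_w H g) (f v) = f (tau g *m v)) ->
    (forall u v, actN (ch_y H u) (f v) = 0) ->
    exists F : {linear sm_mod -> N},
      [/\ forall a z, F (sm_act a z) = actN a (F z),
          forall v, F (sm_in v) = f v
        & forall F' : {linear sm_mod -> N},
            (forall a z, F' (sm_act a z) = actN a (F' z)) ->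
            (forall v, F' (sm_in v) = f v) -> F' =1 F]
}.

(* For y = sum_i u_i y_i in h one has y^* = sum_i (u_i)^* x_i.                 *)
Record contravariant_form (H : cherednik) d (tau : mx_representation C W d)
    (b0 : 'cV[C]_d -> 'cV[C]_d -> C) (M : standard_module H tau)
    (beta : M -> M -> C) : Prop := ContravariantForm {
  cf_herm : hermitian_form beta;
  cf_W : forall g z z', g \in W ->
    beta (sm_act (ch_w H g) z) (sm_act (ch_w H g) z') = beta z z';
  cf_deg0 : forall v v', beta (sm_in M v) (sm_in M v') = b0 v v';
  cf_y : forall u z z',
    beta (sm_act (ch_y H u) z) z' = beta z (sm_act (ch_x H (map_mx Num.conj u)) z')
}.

End FixedParameter.

Definition invariant_form d (tau : mx_representation C W d)
    (b0 : 'cV[C]_d -> 'cV[C]_d -> C) : Prop :=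
  [/\ hermitian_form b0, positive_definite_on (fun _ => True) b0
    & forall g v v', g \in W -> b0 (tau g *m v) (tau g *m v') = b0 v v'].

Definition irreducible_and_unitary d (tau : mx_representation C W d)
    (b0 : 'cV[C]_d -> 'cV[C]_d -> C) (c : 'rV[R]_(nroots Phi)) : Prop :=
  forall (H : cherednik c) (M : standard_module H tau),
    irreducible_module (@sm_act c H d tau M) /\
    forall beta : M -> M -> C, contravariant_form b0 beta ->
      positive_definite_on (fun _ => True) beta.

Definition unitary_neighbourhood d (tau : mx_representation C W d)
    (b0 : 'cV[C]_d -> 'cV[C]_d -> C) (U : set 'rV[R]_(nroots Phi)) : Prop :=
  [/\ exists O : set 'rV[R]_(nroots Phi),
        open O /\ U = (O `&` [set c | W_invariant c])%classic,
      U 0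
    & forall c, U c -> irreducible_and_unitary tau b0 c].

Definition is_N_scalar (c : 'rV[R]_(nroots Phi)) d
    (tau : mx_representation C W d) (N : C) : Prop :=
  \sum_(i | is_pos Phi i) (c 0 i)%:C *: tau (rg_s W i) = N%:M.

Section CliffordCherednik.

Variables (c : 'rV[R]_(nroots Phi)) (H : cherednik c) (Cl : clifford C r).
Variable A : tensor_algebra H Cl.

Local Notation "a (x) b" := (tens A a b) (at level 40, left associativity).
Local Notation x i := (ch_x H (basis_vec C i)).
Local Notation y i := (ch_y H (basis_vec C i)).
Local Notation xc i := (cl_x Cl (basis_vec C i)).
Local Notation yc i := (cl_y Cl (basis_vec C i)).

Definition tau_root i : Cl := 1 - cl_x Cl (croot i) * cl_y Cl (ccoroot i).

Definition s_diag i : A := ch_w H (rg_s W i) (x) tau_root i.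

Definition Omega : A := \sum_(i | is_pos Phi i) (c 0 i)%:C *: s_diag i.

Definition gH : A := \sum_(i < r) (2^-1 *: (x i * y i + y i * x i)) (x) 1.
Definition gZ : A :=
  \sum_(i < r) 1 (x) (2^-1 *: (xc i * yc i - yc i * xc i)) + Omega.
Definition gE1p : A := - \sum_(i < r) (2^-1 *: x i ^+ 2) (x) 1.
Definition gE1m : A := \sum_(i < r) (2^-1 *: y i ^+ 2) (x) 1.
Definition gE2p : A := \sum_(i < r) y i (x) xc i.
Definition gE2m : A := \sum_(i < r) x i (x) yc i.
Definition gE3p : A := - \sum_(i < r) x i (x) xc i.
Definition gE3m : A := - \sum_(i < r) y i (x) yc i.

(* The parity is [true] on the odd part.                                       *)
Definition in_g (p : bool) : A -> Prop :=
  lin_span (fun X => X \in (if p then [:: gE2p; gE2m; gE3p; gE3m]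
                                 else [:: gH; gZ; gE1p; gE1m])).

Definition superbracket (p q : bool) (X Y : A) : A :=
  X * Y - (-1) ^+ (p && q) *: (Y * X).

Definition parity_part (p : bool) : A -> Prop :=
  lin_span (fun X => exists (a : H) (n : nat) (v : 'I_n -> h * h),
    odd n = p /\ X = a (x) \prod_(k < n) cl_in Cl (v k)).

Definition supercentraliser (rho : A) : Prop :=
  exists2 rho_ : bool -> A, rho = rho_ false + rho_ true &
    forall q, parity_part q (rho_ q) /\
      forall p X, in_g p X -> superbracket q p (rho_ q) X = 0.

Record antilinear_involution (star : A -> A) : Prop := AntilinearInvolution {
  st_lin : forall a X Y, star (a *: X + Y) = a^*%R *: star X + star Y;
  st_anti : forall X Y, star (X * Y) = star Y * star X;
  st_inv : involutive star;
  st_x : forall i, star (x i (x) 1) = y i (x) 1;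
  st_y : forall i, star (y i (x) 1) = x i (x) 1;
  st_s : forall i, star (ch_w H (rg_s W i) (x) 1) = ch_w H (rg_s W i) (x) 1;
  st_xc : forall i, star (1 (x) xc i) = 1 (x) yc i;
  st_yc : forall i, star (1 (x) yc i) = 1 (x) xc i
}.

(* [g_act X] is only meaningful for X in g. No Z/2-grading is recorded on the  *)
(* module: odd elements of g shift the eigenvalue of Z by +-1 and even ones    *)
(* preserve it, so all submodules of a lowest weight module are graded.        *)
Record g_module := GModule {
  g_mod :> lmodType C;
  g_act : A -> g_mod -> g_mod;
  g_actr : forall p X a u v, in_g p X ->
    g_act X (a *: u + v) = a *: g_act X u + g_act X v;
  g_actl : forall p X Y a v, in_g p X -> in_g p Y ->
    g_act (a *: X + Y) v = a *: g_act X v + g_act Y v;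
  g_act_bracket : forall p q X Y v, in_g p X -> in_g q Y ->
    g_act (superbracket p q X Y) v =
      g_act X (g_act Y v) - (-1) ^+ (p && q) *: g_act Y (g_act X v)
}.

Definition g_submodule (L : g_module) (P : L -> Prop) : Prop :=
  linear_subspace P /\ forall p X v, in_g p X -> P v -> P (g_act X v).

Definition irreducible_lowest_weight (mu nu : C) (L : g_module) : Prop :=
  (exists v : L,
    [/\ v != 0,
        [/\ g_act gE1m v = 0, g_act gE2m v = 0 & g_act gE3m v = 0],
        g_act gH v = mu *: v,
        g_act gZ v = nu *: v
      & forall P : L -> Prop, g_submodule P -> P v -> forall u, P u]) /\
  (forall P : L -> Prop, g_submodule P ->
    (exists2 v, v != 0 & P v) -> forall u, P u).

Section Kmodule.

Variables (d : nat) (tau : mx_representation C W d) (M : standard_module H tau).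

Local Notation K := {ffun {set 'I_r} -> M}.

Record K_action (act : A -> K -> K) : Prop := KAction {
  ka_mod : module_action act;
  ka_H : forall (a : H) (k : K) S, act (a (x) 1) k S = sm_act a (k S);
  ka_x : forall i k, act (1 (x) xc i) k = wedge i k;
  ka_y : forall i k, act (1 (x) yc i) k = contract i k
}.

(* The monomials x_i1 /\ ... /\ x_il are orthonormal for the determinant form. *)
Definition K_form (beta : M -> M -> C) (k k' : K) : C :=
  \sum_(S : {set 'I_r}) beta (k S) (k' S).

(* The image of C[h]_m (x) V(tau) in M.                                        *)
Definition degree_part (m : nat) : M -> Prop :=
  lin_span (fun z => exists (i : 'I_m -> 'I_r) (v : 'cV[C]_d),
    z = sm_act (\prod_(k < m) x (i k)) (sm_in M v)).

Definition bidegree_part (m l : nat) (k : K) : Prop :=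
  forall S : {set 'I_r}, if #|S| == l then degree_part m (k S) else k S = 0.

Variable act : A -> K -> K.

Definition isotypic e (sigma : mx_representation C W e) : K -> Prop :=
  lin_span (fun k => exists (f : {linear 'cV[C]_e -> K}) (v : 'cV[C]_e),
    k = f v /\ forall i u, f (sigma (rg_s W i) *m u) = act (s_diag i) (f u)).

Definition killed_by_nminus (k : K) : Prop :=
  [/\ act gE1m k = 0, act gE2m k = 0 & act gE3m k = 0].

(* M_c(tau, sigma)_m^l *)
Definition lowest_weight_vectors e (sigma : mx_representation C W e)
    (m l : nat) (k : K) : Prop :=
  [/\ bidegree_part m l k, isotypic sigma k & killed_by_nminus k].

(* The lowest weight vectors of weight (mu, nu). The supercentraliser acts on  *)
(* this space, whereas it may mix the M_c(tau, sigma)_m^l of equal weights:    *)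
(* for W = (Z/2)^2 in R^2, c1 = c2 = c <> 0 small and tau trivial, an element  *)
(* of the supercentraliser sends x_2 in M_c(tau, (+-))_1^0 to (1 - 2c) x_1 in  *)
(* M_c(tau, (-+))_1^0.                                                         *)
Definition weight_space (mu nu : C) (k : K) : Prop :=
  [/\ act gH k = mu *: k, act gZ k = nu *: k & killed_by_nminus k].

Definition unitary_Rc_module (beta : M -> M -> C) (star : A -> A)
    (P : K -> Prop) : Prop :=
  [/\ linear_subspace P,
      forall rho k, supercentraliser rho -> P k -> P (act rho k),
      positive_definite_on P (K_form beta)
    & forall rho, supercentraliser rho -> supercentraliser (star rho) /\
        forall k k', P k -> P k' ->
          K_form beta (act rho k) k' = K_form beta k (act (star rho) k')].

End Kmodule.

End CliffordCherednik.

End Cherednik.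

Definition Bset (r : nat) (ml : nat * nat) : bool :=
  [|| (ml.1 == 0%N) && (ml.2 == 0%N),
      (ml.1 == 1%N) && (ml.2.+1 == r)
    | (1 <= ml.1)%N && (ml.2.+2 <= r)%N].

(* Main.v *)
From HB Require Import structures.
Require Import Defs.
From mathcomp Require Import all_boot all_order all_algebra all_fingroup all_solvable all_character.
From mathcomp Require Import complex ring.
From mathcomp Require Import boolp classical_sets reals topology.

Import Order.TTheory GRing.Theory Num.Theory.
Import numFieldTopology.Exports.
Local Open Scope ring_scope.
Local Open Scope complex_scope.

Set Implicit Arguments.
Unset Strict Implicit.
Unset Printing Implicit Defensive.
Local Notation root := Defs.root.

(** The module [K = M (x) /\h^*] carries the positive definite form built from
    [beta] and the determinant form, and [star] exchanges the raising operators
    [E_a^+] of g with the lowering operators [E_a^-] up to sign.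

    Spanning. In each bidegree the orthogonal complement of the image of the
    raising operators consists of lowest weight vectors, so by induction [K] is
    spanned by words in the raising operators applied to lowest weight vectors
    ([raising_span]). Every bidegree is moreover the sum of its isotypic
    components, cut out by the character projections of the diagonal action of
    [W] ([diagonal_action], [sum_isotypic_proj]), and these commute with g.

    The simple modules. Let [u] be a lowest weight vector of the weight of a simple
    lowest weight module [L] with generator [v0]. The submodule of [L x K]
    generated by [(v0, u)] is the graph of a homomorphism [L -> K]
    ([word_relations]): its intersection with [0 x K] is stable under the lowering
    operators and orthogonal to [u], hence orthogonal to all words on [u]. The
    orthogonality to [u] holds because [v0] has the least eigenvalue of [H + 2Z]
    in [L], an operator whose eigenvalue all raising operators increase. These
    homomorphisms, corrected by a parity operator to account for the Koszul sign,
    are the maps [u (x) v |-> tensor_map u v]; their joint injectivity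
    ([tensor_map_injective]) uses the same eigenvalue argument and simplicity.

    The bidegrees. On a lowest weight vector of bidegree [(m, l)] and type [sigma],
    [{E_2^-, E_2^+} = H + Z] is the scalar [m + l - N tau + N sigma]. By the
    hypothesis on [N] it vanishes only when [m = l = 0] and [sigma = tau], so
    [E_2^+] cannot kill other lowest weight vectors. This leaves the
    bidegrees of [B(r)] ([lowest_weight_bidegree]).

    Directness. Isotypic projections separate different [sigma]; different
    bidegrees of lowest weight vectors are orthogonal since [H] and the exterior
    degree are self-adjoint, and then so are the submodules they generate
    ([gword_orthogonal]).

    The supercentraliser is stable under [star], which maps g to itself and
    preserves parity, so the spaces of lowest weight vectors of a given weight are
    unitary modules over it ([weight_space_unitary]). *)

(** * Induction on the rational Cherednik algebra *)

Definition linear_map (F : fieldType) (U V : lmodType F) (f : U -> V)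
    (lin_f : linear f) : {linear U -> V} :=
  HB.pack_for {linear U -> V} f (GRing.isLinear.Build F U V _ f lin_f).

Lemma linear_zero (F : fieldType) (U V : lmodType F) (f : U -> V) :
  linear f -> f 0 = 0.
Proof. by move=> lin_f; exact: linear0 (linear_map lin_f). Qed.

Section SubAlgebra.

Variables (F : fieldType) (A : algType F) (P : {pred A}).
Hypothesis algP : subalg_closed P.

Definition subalgebra := {x : A | x \in P}.
HB.instance Definition _ := Choice.on subalgebra.
HB.instance Definition _ := SubChoice.on subalgebra.
HB.instance Definition _ := GRing.SubChoice_isSubAlgebra.Build F A P subalgebra
  (GRing.subalg_closed_semi algP).

Definition subalgebra_incl (x : subalgebra) : A := \val x.

Fact subalgebra_incl_linear : linear subalgebra_incl. Proof. by []. Qed.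
Fact subalgebra_incl_monoid : monoid_morphism subalgebra_incl.
Proof. by []. Qed.
HB.instance Definition _ := GRing.isLinear.Build F subalgebra A _
  subalgebra_incl subalgebra_incl_linear.
HB.instance Definition _ := GRing.isMonoidMorphism.Build subalgebra A
  subalgebra_incl subalgebra_incl_monoid.

Lemma subalgebra_inclusion :
  exists (B : algType F) (f : {lrmorphism B -> A}) (g : A -> B),
    [/\ injective f, forall b, f b \in P & {in P, cancel g f}].
Proof.
exists subalgebra, subalgebra_incl, (insubd 0); split.
- exact: val_inj.
- by move=> b; exact: valP.
- by move=> x Px; exact: insubdK.
Qed.

End SubAlgebra.

Section CherednikGeneration.

Variables (R : realType) (r : nat) (Phi : root_system R r).
Variables (gT : finGroupType) (W : reflection_group Phi gT).
Variables (c : 'rV[R]_(nroots Phi)) (H : cherednik W c).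

(** The elements with [P] form a subalgebra in which the defining relations hold,
    so by the universal property the identity of [H] factors through it. *)
Lemma cherednik_ind (P : H -> Prop) :
  P 1 -> (forall a u v, P u -> P v -> P (a *: u + v)) ->
  (forall u v, P u -> P v -> P (u * v)) ->
  (forall u, P (ch_x H u)) -> (forall v, P (ch_y H v)) ->
  (forall g, g \in W -> P (ch_w H g)) -> forall a, P a.
Proof.
move=> P1 Plin PM Px Py Pw.
pose Q : {pred H} := fun a => `[< P a >].
have QP a : (a \in Q) = `[< P a >] by [].
have algQ : subalg_closed Q.
  split=> [|a u v|u v]; rewrite !QP.
  - exact/asboolP.
  - by move=> /asboolP Pu /asboolP Pv; apply/asboolP/Plin.
  - by move=> /asboolP Pu /asboolP Pv; apply/asboolP/PM.
have [B [f [g [injf Qf gK]]]] := subalgebra_inclusion algQ.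
have Qx u : ch_x H u \in Q by apply/asboolP/Px.
have Qy u : ch_y H u \in Q by apply/asboolP/Py.
have Qw k : k \in W -> ch_w H k \in Q by move=> Wk; apply/asboolP/Pw.
have linx : linear (g \o ch_x H).
  by move=> a u v; apply: injf; rewrite /comp gK // !linearD !linearZ /= !gK.
have liny : linear (g \o ch_y H).
  by move=> a u v; apply: injf; rewrite /comp gK // !linearD !linearZ /= !gK.
have rel : cherednik_relations W c (linear_map linx) (linear_map liny)
             (g \o ch_w H).
  have [w1 wM wx wy xx yy yx] := ch_rel H.
  split=> [|k l Wk Wl|k u Wk|k v Wk|u v|u v|v u] /=; apply: injf.
  - by rewrite rmorph1 gK ?w1 // -w1; exact: Qw.
  - by rewrite rmorphM /= !gK ?wM ?Qw // -wM // Qw ?groupM.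
  - by rewrite !rmorphM /= !gK ?Qw // wx.
  - by rewrite !rmorphM /= !gK ?Qw // wy.
  - by rewrite !rmorphM /= !gK // xx.
  - by rewrite !rmorphM /= !gK // yy.
  rewrite !rmorphB !rmorphM /= !gK // yx rmorph_alg; congr (_ - _).
  rewrite linear_sum; apply: eq_bigr => i _.
  rewrite linearZ /= gK //; apply: Qw; exact: rg_s_in.
have [h [hx hy hw _]] := ch_univ H rel.
have [h' [_ _ _ huniq]] := ch_univ H (ch_rel H).
move=> a; apply/asboolP; rewrite -QP.
pose fh : {lrmorphism H -> H} := (f \o h).
pose idH : {lrmorphism H -> H} := idfun.
have -> : a = fh a.
  rewrite [RHS]huniq; first exact: (huniq idH).
  + by move=> u; rewrite /= hx /= gK.
  + by move=> u; rewrite /= hy /= gK.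
  + by move=> k Wk; rewrite /= hw //= gK // Qw.
exact: Qf.
Qed.

End CherednikGeneration.

(** * Subspaces, separation of eigenvectors, Hermitian forms *)

Section Spans.

Variables (F : fieldType) (V : lmodType F).
Implicit Types (P Q S : V -> Prop).

Lemma subspaceZ S a u : linear_subspace S -> S u -> S (a *: u).
Proof. by case=> S0 Slin Su; rewrite -[_ *: _]addr0; apply: Slin. Qed.

Lemma subspaceD S u v : linear_subspace S -> S u -> S v -> S (u + v).
Proof. by case=> S0 Slin Su Sv; rewrite -[u]scale1r; apply: Slin. Qed.

Lemma subspaceN S u : linear_subspace S -> S u -> S (- u).
Proof. by move=> linS Su; rewrite -scaleN1r; apply: subspaceZ. Qed.

Lemma subspace_sum S (I : Type) (s : seq I) (p : pred I) (u : I -> V) :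
  linear_subspace S -> (forall i, p i -> S (u i)) ->
  S (\sum_(i <- s | p i) u i).
Proof.
move=> linS Su; elim/big_rec: _ => [|i v pi Sv]; first by case: linS.
by apply: subspaceD => //; apply: Su.
Qed.

Lemma lin_span_incl P u : P u -> lin_span P u.
Proof.
by move=> Pu; exists 1, (fun=> 1), (fun=> u); split=> //; rewrite big_ord1 scale1r.
Qed.

Lemma lin_span_linear P : linear_subspace (lin_span P).
Proof.
split=> [|c z z' [n [a [u [Pu ->]]]] [m [b [v [Pv ->]]]]].
  by exists 0, (fun=> 0), (fun=> 0); split=> [[]|] //; rewrite big_ord0.
exists (n + m)%N.
exists (fun k => match split k with inl i => c * a i | inr j => b j end).
exists (fun k => match split k with inl i => u i | inr j => v j end).
split=> [k|]; first by case: (split k).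
rewrite big_split_ord scaler_sumr; congr (_ + _); apply: eq_bigr => k _.
  by rewrite -/(unsplit (inl k)) unsplitK scalerA.
by rewrite -/(unsplit (inr k)) unsplitK.
Qed.

Lemma lin_span0 P : lin_span P 0.
Proof. by case: (lin_span_linear P). Qed.

Lemma lin_span_min P S z :
  linear_subspace S -> (forall u, P u -> S u) -> lin_span P z -> S z.
Proof.
move=> linS PS [n [a [u [Pu ->]]]]; apply: subspace_sum => // k _.
by apply: subspaceZ => //; apply: PS.
Qed.

Lemma lin_span_sub P Q z :
  (forall u, P u -> lin_span Q u) -> lin_span P z -> lin_span Q z.
Proof. by apply: lin_span_min; apply: lin_span_linear. Qed.

Lemma finite_dimensional_span P (I : finType) (u : I -> V) :
  (forall z, P z -> lin_span (fun v => exists i, v = u i) z) ->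
  finite_dimensional P.
Proof.
move=> Pu; exists #|I|, (fun k => u (enum_val k)) => z /Pu.
pose S z := exists a : I -> F, z = \sum_i a i *: u i.
have SP : S z -> exists a : 'I_#|I| -> F, z = \sum_k a k *: u (enum_val k).
  case=> a ->; exists (fun k => a (enum_val k)).
  by rewrite (reindex (@enum_val I I)) //=; apply: onW_bij; apply: enum_val_bij.
move=> uz; apply: SP; apply: lin_span_min uz.
  split=> [|c v w [a ->] [b ->]].
    by exists (fun=> 0); rewrite big1 // => i _; rewrite scale0r.
  exists (fun i => c * a i + b i); rewrite scaler_sumr -big_split /=.
  by apply: eq_bigr => i _; rewrite scalerA scalerDl.
move=> _ [i ->]; exists (fun j => (j == i)%:R).
rewrite (bigD1 i) //= eqxx scale1r big1 ?addr0 // => j /negbTE ->.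
by rewrite scale0r.
Qed.

End Spans.

#[local] Hint Resolve lin_span_linear : core.

Lemma lin_span_map (F : fieldType) (V V' : lmodType F) (f : V -> V')
    (P : V -> Prop) (Q : V' -> Prop) z :
  linear f -> (forall u, P u -> lin_span Q (f u)) -> lin_span P z ->
  lin_span Q (f z).
Proof.
move=> linf PQ; have [Q0 Qlin] := lin_span_linear Q.
apply: (lin_span_min (S := fun z => lin_span Q (f z))) => //.
split=> [|a u v Qu Qv]; last by rewrite linf; apply: Qlin.
by rewrite (linear_zero linf).
Qed.

(** Applying [T o - e i o] for an operator [o] that separates [z i] from [z0]
    removes the term [z i] and only rescales the others. *)
Lemma separated_eigenvectors (F : fieldType) (V : lmodType F) (O : Type)
    (T : O -> {linear V -> V}) (n : nat) (z : 'I_n -> V) (z0 : V)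
    (e : 'I_n -> O -> F) (e0 : O -> F) :
  (forall o, T o z0 = e0 o *: z0) ->
  (forall i, z i != 0 -> forall o, T o (z i) = e i o *: z i) ->
  (forall i, z i != 0 -> exists o, e i o != e0 o) ->
  z0 = \sum_i z i -> z0 = 0.
Proof.
move=> Tz0; elim: n z e => [|n IHn] z e Tz sep z0E.
  by rewrite z0E big_ord0.
have [zn0|znn0] := eqVneq (z ord_max) 0.
  apply: (IHn (fun i => z (widen_ord (leqnSn n) i)) (fun i => e (widen_ord (leqnSn n) i))).
  - by move=> i; apply: Tz.
  - by move=> i; apply: sep.
  - by rewrite {1}z0E big_ord_recr /= zn0 addr0.
have [o eo] := sep _ znn0; pose a := e0 o - e ord_max o.
have a0 : a != 0 by rewrite subr_eq0 eq_sym.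
pose b (i : 'I_n.+1) := a^-1 * (e i o - e ord_max o).
apply: (IHn (fun i => b (widen_ord (leqnSn n) i) *: z (widen_ord (leqnSn n) i))
            (fun i => e (widen_ord (leqnSn n) i))).
- move=> i; rewrite scaler_eq0 negb_or => /andP[_ zi0] o'.
  by rewrite linearZ /= Tz // !scalerA mulrC.
- by move=> i; rewrite scaler_eq0 negb_or => /andP[_ zi0]; apply: sep.
have Tsub : a *: z0 = \sum_i (e i o - e ord_max o) *: z i.
  rewrite scalerBl -Tz0 {2}z0E {1}z0E linear_sum scaler_sumr -sumrB.
  apply: eq_bigr => i _; have [->|zi0] := eqVneq (z i) 0.
    by rewrite linear0 !scaler0 subr0.
  by rewrite Tz // scalerBl.
rewrite -[z0 in LHS](scalerK a0) Tsub scaler_sumr big_ord_recr /=.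
rewrite subrr scale0r scaler0 addr0.
by apply: eq_bigr => i _; rewrite scalerA.
Qed.

Section Hermitian.

Variables (R : realType) (V : lmodType R[i]) (b : V -> V -> R[i]).
Hypotheses (herm_b : hermitian_form b)
  (pos_b : positive_definite_on (fun _ => True) b).

Lemma herm0l v : b 0 v = 0.
Proof.
by have [lin _] := herm_b; have := lin (-1) 0 0 v; rewrite addr0 scaler0 mulN1r addNr.
Qed.

Lemma hermDl u u' v : b (u + u') v = b u v + b u' v.
Proof. by have [lin _] := herm_b; rewrite -[u]scale1r lin mul1r scale1r. Qed.

Lemma hermZl a u v : b (a *: u) v = a * b u v.
Proof. by have [lin _] := herm_b; rewrite -[_ *: _]addr0 lin herm0l addr0. Qed.

Lemma hermDr u v v' : b u (v + v') = b u v + b u v'.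
Proof. by have [_ sym] := herm_b; rewrite (sym (v + v') u) (sym v u) (sym v' u) hermDl rmorphD. Qed.

Lemma hermZr a u v : b u (a *: v) = a^*%R * b u v.
Proof. by have [_ sym] := herm_b; rewrite (sym (a *: v) u) (sym v u) hermZl rmorphM. Qed.

Lemma herm0r v : b v 0 = 0.
Proof. by have [_ sym] := herm_b; rewrite sym herm0l rmorph0. Qed.

Lemma hermNl u v : b (- u) v = - b u v.
Proof. by rewrite -scaleN1r hermZl mulN1r. Qed.

Lemma herm_suml (I : Type) (s : seq I) (p : pred I) (u : I -> V) v :
  b (\sum_(i <- s | p i) u i) v = \sum_(i <- s | p i) b (u i) v.
Proof. exact: (big_morph (b^~ v) (fun x y => hermDl x y v) (herm0l v)). Qed.

Lemma herm_sumr (I : Type) (s : seq I) (p : pred I) (u : I -> V) v :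
  b v (\sum_(i <- s | p i) u i) = \sum_(i <- s | p i) b v (u i).
Proof. exact: (big_morph (b v) (hermDr v) (herm0r v)). Qed.

Lemma herm_eq0_sym u v : b u v = 0 -> b v u = 0.
Proof. by have [_ sym] := herm_b; rewrite (sym u v) => ->; rewrite rmorph0. Qed.

Lemma herm_definite u : b u u = 0 -> u = 0.
Proof.
move=> buu; apply/eqP/negP => /negP u0.
by have := pos_b I u0; rewrite buu ltxx.
Qed.

(** Gram-Schmidt for a finite family that need not be independent; a vector [w] with
    [b w w = 0] vanishes, and division by zero then gives the right coefficient. *)
Lemma orthogonal_projection n (u : 'I_n -> V) (k : V) :
  exists2 s, lin_span (fun v => exists i, v = u i) s
           & forall j, b (k - s) (u j) = 0.
Proof.
elim: n u k => [|n IHn] u k.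
  by exists 0; [exact: lin_span0 | case].
pose S := lin_span (fun v => exists i, v = u i).
have linS : linear_subspace S by apply: lin_span_linear.
have Su i : S (u i) by apply: lin_span_incl; exists i.
pose u' i := u (widen_ord (leqnSn n) i).
have u'S s : lin_span (fun v => exists i, v = u' i) s -> S s.
  by apply: lin_span_min => // v [i ->]; apply: Su.
have [s1 /u'S Ss1 s1P] := IHn u' k; have [s2 u's2 s2P] := IHn u' (u ord_max).
pose w := u ord_max - s2; pose q := b (k - s1) w / b w w.
have wP j : b (k - s1 - q *: w) (u' j) = 0.
  by rewrite hermDl hermNl hermZl s1P s2P mulr0 subr0.
have ws2 : b (k - s1 - q *: w) s2 = 0.
  have [m [a [v [vP ->]]]] := u's2; rewrite herm_sumr big1 // => i _.
  by have [j ->] := vP i; rewrite hermZr wP mulr0.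
have ww : b (k - s1 - q *: w) w = 0.
  rewrite hermDl hermNl hermZl /q; have [bw0|bw0] := eqVneq (b w w) 0.
    by rewrite (herm_definite bw0) !herm0r mulr0 subr0.
  by rewrite divfK // subrr.
exists (s1 + q *: w).
  apply: (subspaceD linS Ss1); apply: (subspaceZ _ linS).
  by apply: (subspaceD linS (Su _)); apply: (subspaceN linS); apply: u'S.
move=> j; rewrite opprD addrA; case: (unliftP ord_max j) => [i ->|->].
  have -> : lift ord_max i = widen_ord (leqnSn n) i.
    by apply: val_inj; rewrite /= /bump leqNgt ltn_ord.
  exact: wP.
have -> : u ord_max = w + s2 by rewrite subrK.
by rewrite hermDr ww ws2 addr0.
Qed.

End Hermitian.

(** * Reflections *)

Section Coordinates.

Variables (F : fieldType) (n : nat).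
Implicit Types u v w : 'cV[F]_n.

Lemma pairing_basisl i v : pairing (basis_vec F i) v = v i 0.
Proof.
rewrite /pairing (bigD1 i) //= big1 => [|j /negbTE ji].
  by rewrite addr0 mxE !eqxx mul1r.
by rewrite mxE ji mul0r.
Qed.

Lemma pairingC u v : pairing u v = pairing v u.
Proof. by apply: eq_bigr => i _; rewrite mulrC. Qed.

Lemma pairing_basisr i v : pairing v (basis_vec F i) = v i 0.
Proof. by rewrite pairingC pairing_basisl. Qed.

Lemma pairingZl a u v : pairing (a *: u) v = a * pairing u v.
Proof. by rewrite /pairing mulr_sumr; apply: eq_bigr => i _; rewrite mxE mulrA. Qed.

Lemma pairingZr a u v : pairing u (a *: v) = a * pairing u v.
Proof. by rewrite pairingC pairingZl pairingC. Qed.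

Lemma pairingDl u u' v : pairing (u + u') v = pairing u v + pairing u' v.
Proof.
by rewrite /pairing -big_split; apply: eq_bigr => i _ /=; rewrite mxE mulrDl.
Qed.

Lemma pairingDr u v v' : pairing u (v + v') = pairing u v + pairing u v'.
Proof. by rewrite !(pairingC u) pairingDl. Qed.

Lemma pairing0l v : pairing 0 v = 0.
Proof. by rewrite /pairing big1 // => i _; rewrite mxE mul0r. Qed.

Lemma pairing0r v : pairing v 0 = 0.
Proof. by rewrite pairingC pairing0l. Qed.

Lemma basis_expansion v : v = \sum_i v i 0 *: basis_vec F i.
Proof.
apply/colP => i; rewrite summxE (bigD1 i) //= big1 => [|j /negbTE ji].
  by rewrite addr0 !mxE !eqxx mulr1.
by rewrite !mxE eq_sym ji mulr0.
Qed.

Lemma linear_basis (V : lmodType F) (f : {linear 'cV[F]_n -> V}) v :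
  f v = \sum_i v i 0 *: f (basis_vec F i).
Proof.
by rewrite {1}[v]basis_expansion linear_sum; apply: eq_bigr => i _; rewrite linearZ.
Qed.

End Coordinates.

Section Reflections.

Variables (R : realType) (r : nat) (Phi : root_system R r).
Variables (gT : finGroupType) (W : reflection_group Phi gT).

Local Notation C := R[i].
Local Notation h := ('cV[C]_r).

Lemma pairing_root_neq0 i : pairing (root Phi i) (root Phi i) != 0.
Proof.
rewrite psumr_eq0 => [|j _]; last by rewrite -expr2 sqr_ge0.
apply/negP => /allP v0; case/eqP: (root_neq0 i); apply/colP => j.
by have := v0 j (mem_index_enum _); rewrite mxE mulf_eq0 orbb => /eqP.
Qed.

Lemma pairing_complexify (u v : 'cV[R]_r) :
  pairing (complexify u) (complexify v) = (pairing u v)%:C.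
Proof.
rewrite /pairing rmorph_sum; apply: eq_bigr => i _.
by rewrite !mxE rmorphM.
Qed.

Lemma ccorootE (i : 'I_(nroots Phi)) :
  ccoroot i = (2 / pairing (root Phi i) (root Phi i))%:C *: croot i.
Proof. by apply/colP => j; rewrite !mxE rmorphM. Qed.

Lemma pairing_root_coroot (i : 'I_(nroots Phi)) : pairing (croot i) (ccoroot i) = 2.
Proof.
rewrite ccorootE pairingZr pairing_complexify -rmorphM divfK.
  by rewrite rmorph_nat.
exact: pairing_root_neq0.
Qed.

Lemma root_corootC (i : 'I_(nroots Phi)) u v :
  pairing (croot i) v * pairing u (ccoroot i) =
  pairing (croot i) u * pairing v (ccoroot i).
Proof. by rewrite !ccorootE !pairingZr mulrCA [RHS]mulrCA !(pairingC (croot _)) (mulrC (pairing v _)). Qed.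

Lemma hact_reflection k (u : h) :
  hact W (rg_s W k) u = u - pairing (croot k) u *: ccoroot k.
Proof.
have E i j : rg_repr W (rg_s W k) i j =
    (i == j)%:R - root Phi k j 0 * coroot (root Phi k) i 0.
  have := congr1 (fun v : 'cV_r => v i 0) (rg_sE W k (basis_vec R j)).
  rewrite /reflection pairing_basisr !mxE eqxx andbT => <-.
  rewrite (bigD1 j) //= big1 => [|l /negbTE lj].
    by rewrite addr0 !mxE !eqxx mulr1.
  by rewrite !mxE lj mulr0.
apply/colP => i; rewrite !mxE.
transitivity (\sum_j ((i == j)%:R * u j 0 -
   croot k j 0 * u j 0 * ccoroot k i 0)).
  apply: eq_bigr => j _; rewrite mxE E rmorphB rmorphM rmorph_nat mulrBl.
  by rewrite /croot /ccoroot !mxE mulrAC.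
rewrite sumrB -mulr_suml; congr (_ - _).
  rewrite (bigD1 i) //= eqxx mul1r big1 ?addr0 // => j /negbTE ji.
  by rewrite eq_sym ji mul0r.
by rewrite /pairing /ccoroot !mxE.
Qed.

Lemma hact_reflection_root k (u : h) :
  hact W (rg_s W k) u = u - pairing u (ccoroot k) *: croot k.
Proof.
rewrite hact_reflection !ccorootE pairingZr scalerA (pairingC u).
by rewrite [in RHS]mulrC.
Qed.

Lemma reflection_group_ind (P : gT -> Prop) : P 1%g ->
  (forall k g, g \in W -> P g -> P (rg_s W k * g)%g) -> forall g, g \in W -> P g.
Proof.
move=> P1 PM g; rewrite (rg_gen W).
case/gen_prodgP => n [s sW ->].
elim: n s sW => [|n IHn] s sW; first by rewrite big_ord0.
rewrite big_ord_recl; have /imsetP[k _ ->] := sW ord0.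
apply: PM; last by apply: IHn => i; apply: sW.
apply: group_prod => i _; have /imsetP[k' _ ->] := sW (lift ord0 i).
exact: rg_s_in.
Qed.

Lemma hact_coroot k : hact W (rg_s W k) (ccoroot k) = - ccoroot k.
Proof.
by rewrite hact_reflection pairing_root_coroot scaler_nat mulr2n opprD addrA subrr add0r.
Qed.

Lemma hact_root k : hact W (rg_s W k) (croot k) = - croot k.
Proof.
rewrite hact_reflection ccorootE scalerA.
have := pairing_root_coroot k; rewrite ccorootE pairingZr mulrC => ->.
by rewrite scaler_nat mulr2n opprD addrA subrr add0r.
Qed.

Lemma hactM g g' (u : h) : g \in W -> g' \in W ->
  hact W (g * g')%g u = hact W g (hact W g' u).
Proof. by move=> Wg Wg'; rewrite /hact repr_mxM // map_mxM mulmxA. Qed.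

Lemma hact1 (u : h) : hact W 1%g u = u.
Proof. by rewrite /hact repr_mx1 map_mx1 mul1mx. Qed.

Lemma reflection_involutive k : (rg_s W k * rg_s W k = 1)%g.
Proof.
have s_in := rg_s_in W k.
apply: (mx_faithful_inj (rg_faithful W)); rewrite ?groupM ?group1 //.
rewrite repr_mxM // repr_mx1; apply/matrixP => i j.
suff : rg_repr W (rg_s W k) *m (rg_repr W (rg_s W k) *m basis_vec R j) = basis_vec R j.
  rewrite mulmxA; move: (rg_repr W _ *m rg_repr W _) => Q.
  move=> /(congr1 (fun v : 'cV_r => v i 0)).
  rewrite !mxE eqxx andbT => <-; rewrite (bigD1 j) //= big1 => [|l /negbTE lj].
    by rewrite addr0 mxE !eqxx mulr1.
  by rewrite mxE lj mulr0.
rewrite !rg_sE /reflection; set v := basis_vec R j; set a := root Phi k.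
rewrite pairingDr -!scaleNr pairingZr.
have -> : pairing a (coroot a) = 2.
  by rewrite /coroot pairingZr divfK //; apply: pairing_root_neq0.
rewrite -[in RHS](addr0 v) -addrA -scalerDl; congr (_ + _).
by apply/eqP; rewrite scaler_eq0; apply/orP; left; apply/eqP; ring.
Qed.

Lemma linear_reflection (V : lmodType C) (p : {linear h -> V}) k u :
  p (hact W (rg_s W k) u) = p u - pairing (croot k) u *: p (ccoroot k).
Proof. by rewrite hact_reflection linearB linearZ. Qed.

(** Reflections are orthogonal, so a sum over an orthonormal basis of [h] of tensors
    [y_i (x) y_i] is invariant; the [E_a^+] and [E_a^-] are of this form. *)
Lemma reflection_commutes_casimir (A : algType C) (p q : {linear h -> A}) (G : A) k :
  (forall u, G * p u = p (hact W (rg_s W k) u) * G) ->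
  (forall u, G * q u = q (hact W (rg_s W k) u) * G) ->
  let Q := \sum_i p (basis_vec C i) * q (basis_vec C i) in G * Q = Q * G.
Proof.
move=> Gp Gq Q; pose a := croot k; pose a' := ccoroot k.
have -> : G * Q = \sum_i p (hact W (rg_s W k) (basis_vec C i)) *
      q (hact W (rg_s W k) (basis_vec C i)) * G.
  by rewrite mulr_sumr; apply: eq_bigr => i _; rewrite mulrA Gp -mulrA Gq mulrA.
rewrite -mulr_suml; congr (_ * _).
transitivity (\sum_i (p (basis_vec C i) * q (basis_vec C i)
   - (a i 0 *: (p (basis_vec C i) * q a')) - (a i 0 *: (p a' * q (basis_vec C i)))
   + (a i 0 * a i 0) *: (p a' * q a'))).
  apply: eq_bigr => i _; rewrite !linear_reflection pairing_basisr.
  by rewrite mulrBl !mulrBr -!scalerAl -!scalerAr scalerA opprB !addrA addrAC.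
have aE : a' = (2 / pairing a a) *: a.
  by rewrite /a' ccorootE /a pairing_complexify fmorph_div rmorph_nat.
have pa : p a' = (2 / pairing a a) *: p a by rewrite aE linearZ.
have qa : q a' = (2 / pairing a a) *: q a by rewrite aE linearZ.
have aa : pairing a a != 0.
  by rewrite pairing_complexify fmorph_eq0 pairing_root_neq0.
rewrite big_split !sumrB /= -scaler_suml.
have -> : \sum_i a i 0 *: (p (basis_vec C i) * q a') = p a * q a'.
  by rewrite (linear_basis p a) mulr_suml; apply: eq_bigr => i _; rewrite scalerAl.
have -> : \sum_i a i 0 *: (p a' * q (basis_vec C i)) = p a' * q a.
  by rewrite (linear_basis q a) mulr_sumr; apply: eq_bigr => i _; rewrite scalerAr.
rewrite -/a' pa qa -!scalerAl -!scalerAr !scalerA -/(pairing a a).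
rewrite -!addrA -[RHS]addr0; congr (_ + _).
have : pairing a a * (2 / pairing a a) = 2 by rewrite mulrC divfK.
move: (2 / pairing a a) => k2 ->.
by rewrite mulr_natl mulr2n scalerDl addKr addNr.
Qed.

End Reflections.

(** * Brackets of quadratic elements *)

Section Commutators.

Variable A : pzRingType.
Implicit Types u v w : A.

Definition commutator u v := u * v - v * u.
Definition anticommutator u v := u * v + v * u.

Lemma commutatorMr u v w :
  commutator u (v * w) = commutator u v * w + v * commutator u w.
Proof. by rewrite /commutator mulrBl mulrBr !mulrA addrA subrK. Qed.

Lemma commutatorMl u v w :
  commutator (u * v) w = u * commutator v w + commutator u w * v.
Proof. by rewrite /commutator mulrBl mulrBr !mulrA addrA subrK. Qed.

Lemma commutatorDl u v w :
  commutator (u + v) w = commutator u w + commutator v w.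
Proof. by rewrite /commutator mulrDl mulrDr opprD addrACA. Qed.

Lemma commutatorC u v : commutator v u = - commutator u v.
Proof. by rewrite /commutator opprB. Qed.

Lemma commutatorNr u v : commutator u (- v) = - commutator u v.
Proof. by rewrite /commutator mulrN mulNr opprD opprK. Qed.

Lemma commutatorNl u v : commutator (- u) v = - commutator u v.
Proof. by rewrite /commutator mulrN mulNr opprD opprK. Qed.

Lemma commutator_sumr (I : Type) (s : seq I) u (f : I -> A) :
  commutator u (\sum_(i <- s) f i) = \sum_(i <- s) commutator u (f i).
Proof. by rewrite /commutator mulr_sumr mulr_suml sumrB. Qed.

Lemma commutator_suml (I : Type) (s : seq I) u (f : I -> A) :
  commutator (\sum_(i <- s) f i) u = \sum_(i <- s) commutator (f i) u.
Proof. by rewrite /commutator mulr_sumr mulr_suml sumrB. Qed.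

Lemma commutator_eq0 u v : u * v = v * u -> commutator u v = 0.
Proof. by rewrite /commutator => ->; rewrite subrr. Qed.

Lemma commutator_anticommutator u v w : commutator v w = 0 ->
  commutator (anticommutator u v) w = anticommutator (commutator u w) v.
Proof.
move=> vw; rewrite commutatorDl !commutatorMl vw mulr0 mul0r add0r addr0.
by rewrite /anticommutator.
Qed.

Lemma commutator_anticommutator_sqr u v : v * v = 0 ->
  commutator (anticommutator u v) v = 0.
Proof.
move=> vv; rewrite /commutator /anticommutator mulrDl mulrDr -mulrA vv mulr0.
by rewrite add0r [v * (v * u)]mulrA vv mul0r addr0 mulrA subrr.
Qed.

End Commutators.

Section Superalgebra.

Variables (F : fieldType) (two_neq0 : 2 != 0 :> F).
Variables (A : algType F) (r : nat) (X Y xi eta : 'I_r -> A).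

Local Notation kappa i j := (commutator (Y i) (X j)).

(** [X], [Y] stand for the generators of the Cherednik algebra and [xi], [eta] for
    those of the Clifford algebra. The brackets of g depend on the reflections in
    [Y i, X j] only through its symmetry in [i], [j] and the two summed relations
    [YX2] and [Y2X]. *)
Hypotheses
  (XX : forall i j, X i * X j = X j * X i)
  (YY : forall i j, Y i * Y j = Y j * Y i)
  (xiX : forall i j, xi i * X j = X j * xi i)
  (xiY : forall i j, xi i * Y j = Y j * xi i)
  (etaX : forall i j, eta i * X j = X j * eta i)
  (etaY : forall i j, eta i * Y j = Y j * eta i)
  (xixi : forall i j, xi j * xi i = - (xi i * xi j))
  (etaeta : forall i j, eta j * eta i = - (eta i * eta j))
  (etaxi : forall i j, eta i * xi j = (i == j)%:R%:A - xi j * eta i)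
  (kappaC : forall i j, kappa i j = kappa j i)
  (YX2 : forall i, \sum_j (kappa i j * X j + X j * kappa i j) = 2 *: X i)
  (Y2X : forall i, \sum_j (kappa j i * Y j + Y j * kappa j i) = 2 *: Y i).

Definition raise1 := - \sum_i 2^-1 *: X i ^+ 2.
Definition lower1 := \sum_i 2^-1 *: Y i ^+ 2.
Definition raise2 := \sum_i Y i * xi i.
Definition lower2 := \sum_i X i * eta i.
Definition raise3 := - \sum_i X i * xi i.
Definition lower3 := - \sum_i Y i * eta i.
Definition degH := \sum_i 2^-1 *: (X i * Y i + Y i * X i).
(** The element [Z], with [Omega] absorbed into the commutators [kappa]. *)
Definition degZ :=
  \sum_i \sum_j kappa i j * (xi j * eta i) - \sum_i 2^-1 *: kappa i i.

Lemma half_double (V : lmodType F) (v : V) : 2^-1 *: (2 *: v) = v.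
Proof. by rewrite scalerA mulVf // scale1r. Qed.

Lemma commutatorZl a (u v : A) : commutator (a *: u) v = a *: commutator u v.
Proof. by rewrite /commutator -scalerAl -scalerAr scalerBr. Qed.

Lemma commutatorZr a (u v : A) : commutator u (a *: v) = a *: commutator u v.
Proof. by rewrite /commutator -scalerAl -scalerAr scalerBr. Qed.

Lemma commutator_degH_X j : commutator degH (X j) = X j.
Proof.
rewrite commutator_suml -[RHS]half_double -YX2 scaler_sumr.
apply: eq_bigr => i _.
rewrite commutatorZl commutatorDl !commutatorMl [commutator (X i) (X j)]commutator_eq0 1?XX //.
by rewrite mul0r mulr0 addr0 add0r addrC kappaC.
Qed.

Lemma commutator_degH_Y j : commutator degH (Y j) = - Y j.
Proof.
rewrite commutator_suml -[Y j in RHS]half_double -Y2X scaler_sumr -sumrN.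
apply: eq_bigr => i _.
rewrite commutatorZl commutatorDl !commutatorMl [commutator (Y i) (Y j)]commutator_eq0 1?YY //.
by rewrite mul0r mulr0 addr0 add0r addrC [commutator (X i) _]commutatorC kappaC mulrN mulNr -opprD scalerN addrC.
Qed.

Lemma commute_degH u : (forall i, u * X i = X i * u) -> (forall i, u * Y i = Y i * u) ->
  degH * u = u * degH.
Proof.
move=> uX uY; rewrite mulr_suml mulr_sumr; apply: eq_bigr => i _.
rewrite -scalerAl -scalerAr mulrDl mulrDr; congr (_ *: (_ + _)).
  by rewrite mulrA uX -!mulrA uY.
by rewrite mulrA uY -!mulrA uX.
Qed.

Lemma commutator_Y_X2 i : commutator (Y i) (\sum_j X j ^+ 2) = 2 *: X i.
Proof. by rewrite commutator_sumr -YX2; apply: eq_bigr => j _; rewrite commutatorMr. Qed.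

Lemma commutator_Y2_X i : commutator (\sum_j Y j ^+ 2) (X i) = 2 *: Y i.
Proof.
by rewrite commutator_suml -Y2X; apply: eq_bigr => j _; rewrite commutatorMl addrC.
Qed.

Lemma commutator_Y_raise1 i : commutator (Y i) raise1 = - X i.
Proof. by rewrite commutatorNr -scaler_sumr commutatorZr commutator_Y_X2 half_double. Qed.

Lemma commutator_lower1_X i : commutator lower1 (X i) = Y i.
Proof. by rewrite /lower1 -scaler_sumr commutatorZl commutator_Y2_X half_double. Qed.

Lemma commutator_X_raise1 i : commutator (X i) raise1 = 0.
Proof.
rewrite commutatorNr commutator_sumr big1 ?oppr0 // => j _.
by rewrite commutatorZr commutatorMr commutator_eq0 1?XX // mul0r mulr0 addr0 scaler0.
Qed.

Lemma commutator_lower1_Y i : commutator lower1 (Y i) = 0.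
Proof.
rewrite commutator_suml big1 // => j _.
by rewrite commutatorZl commutatorMl commutator_eq0 1?YY // mul0r mulr0 addr0 scaler0.
Qed.

Lemma commutator_exterior_raise1 u : (forall i, u * X i = X i * u) -> commutator u raise1 = 0.
Proof.
move=> uX; rewrite commutatorNr commutator_sumr big1 ?oppr0 // => j _.
by rewrite commutatorZr commutatorMr commutator_eq0 ?uX // mul0r mulr0 addr0 scaler0.
Qed.

Lemma commutator_exterior_lower1 u : (forall i, u * Y i = Y i * u) -> commutator lower1 u = 0.
Proof.
move=> uY; rewrite commutator_suml big1 // => j _.
by rewrite commutatorZl commutatorMl commutator_eq0 ?uY // mul0r mulr0 addr0 scaler0.
Qed.

Lemma lower1_raise1 : commutator lower1 raise1 = - degH.
Proof.
rewrite commutatorNr commutator_sumr; congr (- _); apply: eq_bigr => i _.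
by rewrite commutatorZr commutatorMr commutator_lower1_X addrC.
Qed.

Lemma lower2_raise1 : commutator lower2 raise1 = 0.
Proof.
rewrite commutator_suml big1 // => i _; rewrite commutatorMl.
by rewrite commutator_X_raise1 commutator_exterior_raise1 // mul0r mulr0 addr0.
Qed.

Lemma lower3_raise1 : commutator lower3 raise1 = lower2.
Proof.
rewrite commutatorNl commutator_suml -sumrN; apply: eq_bigr => i _.
rewrite commutatorMl commutator_exterior_raise1 // mulr0 add0r.
by rewrite commutator_Y_raise1 mulNr opprK.
Qed.

Lemma raise2_raise1 : commutator raise2 raise1 = raise3.
Proof.
rewrite commutator_suml /raise3 -sumrN; apply: eq_bigr => i _.
rewrite commutatorMl commutator_exterior_raise1 // mulr0 add0r.
by rewrite commutator_Y_raise1 mulNr.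
Qed.

Lemma raise3_raise1 : commutator raise3 raise1 = 0.
Proof.
rewrite commutatorNl commutator_suml big1 ?oppr0 // => i _; rewrite commutatorMl.
by rewrite commutator_X_raise1 commutator_exterior_raise1 // mul0r mulr0 addr0.
Qed.

Lemma lower1_raise2 : commutator lower1 raise2 = 0.
Proof.
rewrite commutator_sumr big1 // => i _; rewrite commutatorMr.
by rewrite commutator_lower1_Y commutator_exterior_lower1 // mul0r mulr0 addr0.
Qed.

Lemma lower1_raise3 : commutator lower1 raise3 = - raise2.
Proof.
rewrite commutatorNr commutator_sumr; congr (- _); apply: eq_bigr => i _.
by rewrite commutatorMr commutator_lower1_X commutator_exterior_lower1 // mulr0 addr0.
Qed.

Lemma degH_raise1 : commutator degH raise1 = 2 *: raise1.
Proof.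
rewrite commutatorNr commutator_sumr scalerN scaler_sumr; congr (- _).
apply: eq_bigr => i _; rewrite commutatorZr commutatorMr commutator_degH_X.
by rewrite scalerA mulrC -scalerA scaler_nat mulr2n.
Qed.

Lemma degH_raise2 : commutator degH raise2 = - raise2.
Proof.
rewrite commutator_sumr -sumrN; apply: eq_bigr => i _.
rewrite commutatorMr commutator_degH_Y [commutator degH (xi i)]commutator_eq0.
  by rewrite mulr0 addr0 mulNr.
exact: commute_degH.
Qed.

Lemma degH_raise3 : commutator degH raise3 = raise3.
Proof.
rewrite commutatorNr commutator_sumr; congr (- _); apply: eq_bigr => i _.
rewrite commutatorMr commutator_degH_X [commutator degH (xi i)]commutator_eq0.
  by rewrite mulr0 addr0.
exact: commute_degH.
Qed.

Lemma mixed_mul (a b al be : 'I_r -> A) :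
  (forall i j, al i * b j = b j * al i) ->
  (\sum_i a i * al i) * (\sum_j b j * be j) =
    \sum_i \sum_j (a i * b j) * (al i * be j).
Proof.
move=> ab; rewrite mulr_suml; apply: eq_bigr => i _; rewrite mulr_sumr.
by apply: eq_bigr => j _; rewrite !mulrA -(mulrA (a i)) ab !mulrA.
Qed.

Lemma mixed_anticommutator (a b al be : 'I_r -> A) :
  (forall i j, al i * b j = b j * al i) -> (forall i j, be i * a j = a j * be i) ->
  anticommutator (\sum_i a i * al i) (\sum_j b j * be j) =
    \sum_i \sum_j ((a i * b j) * (al i * be j) + (b j * a i) * (be j * al i)).
Proof.
move=> ab ba; rewrite /anticommutator !mixed_mul // [X in _ + X]exchange_big.
by rewrite -big_split; apply: eq_bigr => i _; rewrite -big_split.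
Qed.

Lemma symmetric_antisymmetric (a b : 'I_r -> 'I_r -> A) :
  (forall i j, a i j = a j i) -> (forall i j, b i j = - b j i) ->
  \sum_i \sum_j a i j * b i j = 0.
Proof.
move=> aC bC; set S := (X in X = 0).
have : S = - S.
  rewrite {1}/S exchange_big -sumrN; apply: eq_bigr => i _.
  by rewrite -sumrN; apply: eq_bigr => j _; rewrite aC bC mulrN.
move/eqP; rewrite -addr_eq0 -mulr2n -scaler_nat scaler_eq0 (negbTE two_neq0).
by move/eqP.
Qed.

Lemma contract_wedge_sum (a : 'I_r -> 'I_r -> A) :
  \sum_i \sum_j a i j * (eta i * xi j + xi j * eta i) = \sum_i a i i.
Proof.
apply: eq_bigr => i _; rewrite (bigD1 i) //= etaxi subrK eqxx scale1r mulr1.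
rewrite big1 ?addr0 // => j ji.
by rewrite etaxi subrK eq_sym (negbTE ji) scale0r mulr0.
Qed.

Lemma raise2_sqr : raise2 * raise2 = 0.
Proof. by rewrite mixed_mul // symmetric_antisymmetric. Qed.

Lemma raise3_sqr : raise3 * raise3 = 0.
Proof. by rewrite mulrNN mixed_mul // symmetric_antisymmetric. Qed.

Lemma anticommutatorNl (u v : A) : anticommutator (- u) v = - anticommutator u v.
Proof. by rewrite /anticommutator mulrN mulNr -opprD. Qed.

Lemma anticommutatorNr (u v : A) : anticommutator u (- v) = - anticommutator u v.
Proof. by rewrite /anticommutator mulrN mulNr -opprD. Qed.

Lemma anticommutatorC (u v : A) : anticommutator u v = anticommutator v u.
Proof. exact: addrC. Qed.

Lemma raise3_raise2 : anticommutator raise3 raise2 = 0.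
Proof.
rewrite anticommutatorNl mixed_anticommutator //.
rewrite -[RHS]oppr0 -[in RHS](@symmetric_antisymmetric
  (fun i j => kappa j i) (fun i j => xi j * xi i)) //.
congr (- _); apply: eq_bigr => i _; apply: eq_bigr => j _.
by rewrite /commutator mulrBl addrC [xi j * xi i]xixi !mulrN opprK.
Qed.

Lemma lower3_raise2 : anticommutator lower3 raise2 = - (2 *: lower1).
Proof.
rewrite anticommutatorNl mixed_anticommutator //.
transitivity (- \sum_i \sum_j Y i * Y j * (eta i * xi j + xi j * eta i)).
  by congr (- _); apply: eq_bigr => i _; apply: eq_bigr => j _; rewrite YY -mulrDr.
rewrite contract_wedge_sum scaler_sumr; congr (- _); apply: eq_bigr => i _.
by rewrite scalerA mulfV // scale1r.
Qed.

Lemma lower2_raise3 : anticommutator lower2 raise3 = 2 *: raise1.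
Proof.
rewrite anticommutatorNr mixed_anticommutator //.
transitivity (- \sum_i \sum_j X i * X j * (eta i * xi j + xi j * eta i)).
  by congr (- _); apply: eq_bigr => i _; apply: eq_bigr => j _; rewrite XX -mulrDr.
rewrite contract_wedge_sum scalerN scaler_sumr; congr (- _); apply: eq_bigr => i _.
by rewrite scalerA mulfV // scale1r.
Qed.

Lemma degHE : degH = \sum_i X i * Y i + \sum_i 2^-1 *: kappa i i.
Proof.
rewrite -big_split; apply: eq_bigr => i _ /=.
rewrite -[X i * Y i in RHS]half_double -scalerDr; congr (_ *: _).
by rewrite /commutator scaler_nat mulr2n -!addrA addrC [_ + (Y i * _ - _)]addrC subrK addrC.
Qed.

Lemma lower2_raise2 : anticommutator lower2 raise2 = degH + degZ.
Proof.
rewrite mixed_anticommutator //.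
transitivity (\sum_i X i * Y i + \sum_i \sum_j kappa i j * (xi j * eta i)).
  rewrite -(contract_wedge_sum (fun i j => X i * Y j)) -big_split.
  apply: eq_bigr => i _; rewrite -big_split; apply: eq_bigr => j _ /=.
  by rewrite kappaC mulrDr -!addrA; congr (_ + _); rewrite -mulrDl addrC subrK.
rewrite degHE /degZ; set a := \sum_i X i * Y i; set s := \sum_i 2^-1 *: _.
by rewrite addrA addrAC addrK.
Qed.

Lemma lower3_raise3 : anticommutator lower3 raise3 = degH - degZ.
Proof.
rewrite anticommutatorNl anticommutatorNr opprK mixed_anticommutator //.
transitivity (\sum_i Y i * X i - \sum_i \sum_j kappa i j * (xi j * eta i)).
  rewrite -(contract_wedge_sum (fun i j => Y i * X j)) -sumrB.
  apply: eq_bigr => i _; rewrite -sumrB; apply: eq_bigr => j _ /=.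
  by rewrite mulrDr -!addrA; congr (_ + _); rewrite -mulrBl /commutator opprB addrC subrK.
rewrite degHE /degZ opprB addrA -[_ + _ + \sum_i _]addrA -big_split /=; congr (_ - _).
rewrite -big_split; apply: eq_bigr => i _ /=.
by rewrite -scalerDr -mulr2n -scaler_nat half_double /commutator addrC subrK.
Qed.

(** By the Jacobi identity, since [Z] is [{E_2^-, E_2^+} - H] and also
    [H - {E_3^-, E_3^+}], no reflection in [Z] has to be moved past a generator. *)
Lemma degZ_raise1 : commutator degZ raise1 = 0.
Proof.
have -> : degZ = degH - anticommutator lower3 raise3 by rewrite lower3_raise3 subKr.
rewrite commutatorDl commutatorNl commutator_anticommutator ?raise3_raise1 //.
by rewrite lower3_raise1 lower2_raise3 degH_raise1 subrr.
Qed.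

Lemma degZ_raise2 : commutator degZ raise2 = raise2.
Proof.
have -> : degZ = anticommutator lower2 raise2 - degH by rewrite lower2_raise2 addrC addKr.
rewrite commutatorDl commutatorNl commutator_anticommutator_sqr ?raise2_sqr //.
by rewrite degH_raise2 opprK add0r.
Qed.

Lemma degZ_raise3 : commutator degZ raise3 = raise3.
Proof.
have -> : degZ = degH - anticommutator lower3 raise3 by rewrite lower3_raise3 subKr.
rewrite commutatorDl commutatorNl commutator_anticommutator_sqr ?raise3_sqr //.
by rewrite degH_raise3 subr0.
Qed.

End Superalgebra.

(** * The elements of g in the tensor product *)

Section CliffordRelations.

Variables (F : fieldType) (r : nat) (Cl : clifford F r).
Implicit Types u v : 'cV[F]_r.

Lemma cl_xx u v : cl_x Cl v * cl_x Cl u = - (cl_x Cl u * cl_x Cl v).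
Proof.
apply/eqP; rewrite -addr_eq0 cl_rel /Bform !pairing0r add0r.
by rewrite scale0r.
Qed.

Lemma cl_yy u v : cl_y Cl v * cl_y Cl u = - (cl_y Cl u * cl_y Cl v).
Proof.
apply/eqP; rewrite -addr_eq0 cl_rel /Bform !pairing0l add0r.
by rewrite scale0r.
Qed.

Lemma cl_yx u v : cl_y Cl v * cl_x Cl u = (pairing u v)%:A - cl_x Cl u * cl_y Cl v.
Proof.
apply: (canRL (addrK _)); rewrite cl_rel /Bform pairing0l add0r.
by [].
Qed.

Lemma cl_x_linear : linear (cl_x Cl).
Proof.
move=> a u v; rewrite /cl_x -linearP; congr (cl_in _ _).
by congr (_, _); rewrite /= scaler0 addr0.
Qed.
HB.instance Definition _ :=
  GRing.isLinear.Build F 'cV[F]_r Cl _ (cl_x Cl) cl_x_linear.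

Lemma cl_y_linear : linear (cl_y Cl).
Proof.
move=> a u v; rewrite /cl_y -linearP; congr (cl_in _ _).
by congr (_, _); rewrite /= scaler0 addr0.
Qed.
HB.instance Definition _ :=
  GRing.isLinear.Build F 'cV[F]_r Cl _ (cl_y Cl) cl_y_linear.

Lemma cl_in_split (v : 'cV[F]_r * 'cV[F]_r) : cl_in Cl v = cl_y Cl v.1 + cl_x Cl v.2.
Proof.
rewrite /cl_x /cl_y -linearD; congr (cl_in _ _); case: v => v1 v2.
by congr (_, _); rewrite /= ?addr0 ?add0r.
Qed.

End CliffordRelations.

Section Halving.

Variables (F : fieldType) (two_neq0 : 2 != 0 :> F).

Lemma half_subr_double (V : lmodType F) (u v : V) :
  2^-1 *: (u - 2 *: v) = 2^-1 *: u - v.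
Proof. by rewrite scalerBr (half_double two_neq0). Qed.

Lemma half_sum (V : lmodType F) (v : V) : 2^-1 *: (v + v) = v.
Proof. by rewrite -mulr2n -(scaler_nat 2) (half_double two_neq0). Qed.

Lemma half_wedge_contract (A : algType F) (u : A) :
  2^-1 *: (u - (1 - u)) = u - (2^-1)%:A.
Proof.
by rewrite opprB addrA scalerBr half_sum.
Qed.

End Halving.

Section TensorMorphisms.

Variables (F : fieldType) (A1 A2 : algType F) (A : tensor_algebra A1 A2).

Lemma ta_inlZ a (u : A1) : ta_inl A (a *: u) = a *: ta_inl A u.
Proof. exact: linearZ. Qed.

Lemma ta_inlB (u v : A1) : ta_inl A (u - v) = ta_inl A u - ta_inl A v.
Proof. exact: rmorphB. Qed.

Lemma ta_inlD (u v : A1) : ta_inl A (u + v) = ta_inl A u + ta_inl A v.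
Proof. exact: rmorphD. Qed.

Lemma ta_inlM (u v : A1) : ta_inl A (u * v) = ta_inl A u * ta_inl A v.
Proof. exact: rmorphM. Qed.

Lemma ta_inl1 : ta_inl A 1 = 1.
Proof. exact: rmorph1. Qed.

Lemma ta_inl_sum (I : Type) (s : seq I) (p : pred I) (f : I -> A1) :
  ta_inl A (\sum_(i <- s | p i) f i) = \sum_(i <- s | p i) ta_inl A (f i).
Proof. exact: rmorph_sum. Qed.

Lemma ta_inrZ a (u : A2) : ta_inr A (a *: u) = a *: ta_inr A u.
Proof. exact: linearZ. Qed.

Lemma ta_inrB (u v : A2) : ta_inr A (u - v) = ta_inr A u - ta_inr A v.
Proof. exact: rmorphB. Qed.

Lemma ta_inrD (u v : A2) : ta_inr A (u + v) = ta_inr A u + ta_inr A v.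
Proof. exact: rmorphD. Qed.

Lemma ta_inrN (u : A2) : ta_inr A (- u) = - ta_inr A u.
Proof. exact: rmorphN. Qed.

Lemma ta_inrM (u v : A2) : ta_inr A (u * v) = ta_inr A u * ta_inr A v.
Proof. exact: rmorphM. Qed.

Lemma ta_inr1 : ta_inr A 1 = 1.
Proof. exact: rmorph1. Qed.

End TensorMorphisms.

Section SuperalgebraInTensor.

Variables (R : realType) (r : nat) (Phi : root_system R r).
Variables (gT : finGroupType) (W : reflection_group Phi gT).
Variables (c : 'rV[R]_(nroots Phi)) (H : cherednik W c) (Cl : clifford R[i] r).
Variable A : tensor_algebra H Cl.

Local Notation C := R[i].
Local Notation h := ('cV[C]_r).

Definition tx : h -> A := ta_inl A \o ch_x H.
Definition ty : h -> A := ta_inl A \o ch_y H.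
Definition tw (g : gT) : A := ta_inl A (ch_w H g).
Definition txi : h -> A := ta_inr A \o cl_x Cl.
Definition teta : h -> A := ta_inr A \o cl_y Cl.
HB.instance Definition _ := GRing.Linear.on tx.
HB.instance Definition _ := GRing.Linear.on ty.
HB.instance Definition _ := GRing.Linear.on txi.
HB.instance Definition _ := GRing.Linear.on teta.

Local Notation X i := (tx (basis_vec C i)).
Local Notation Y i := (ty (basis_vec C i)).
Local Notation xi i := (txi (basis_vec C i)).
Local Notation eta i := (teta (basis_vec C i)).

Lemma txx u v : tx u * tx v = tx v * tx u.
Proof. by rewrite /tx /ty /tw /= -!ta_inlM (cr_xx (ch_rel H)). Qed.

Lemma tyy u v : ty u * ty v = ty v * ty u.
Proof. by rewrite /tx /ty /tw /= -!ta_inlM (cr_yy (ch_rel H)). Qed.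

Lemma txi_tx u v : txi u * tx v = tx v * txi u.
Proof. by rewrite ta_comm. Qed.

Lemma txi_ty u v : txi u * ty v = ty v * txi u.
Proof. by rewrite ta_comm. Qed.

Lemma teta_tx u v : teta u * tx v = tx v * teta u.
Proof. by rewrite ta_comm. Qed.

Lemma teta_ty u v : teta u * ty v = ty v * teta u.
Proof. by rewrite ta_comm. Qed.

Lemma txixi u v : txi v * txi u = - (txi u * txi v).
Proof. by rewrite /txi /= -!ta_inrM cl_xx ta_inrN. Qed.

Lemma tetaeta u v : teta v * teta u = - (teta u * teta v).
Proof. by rewrite /teta /= -!ta_inrM cl_yy ta_inrN. Qed.

Lemma tetaxi u v : teta v * txi u = (pairing u v)%:A - txi u * teta v.
Proof. by rewrite /teta /txi /= -!ta_inrM cl_yx ta_inrB ta_inrZ ta_inr1. Qed.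

Lemma twx g u : g \in W -> tw g * tx u = tx (hact W g u) * tw g.
Proof. by move=> Wg; rewrite /tx /ty /tw /= -!ta_inlM (cr_wx (ch_rel H)). Qed.

Lemma twy g u : g \in W -> tw g * ty u = ty (hact W g u) * tw g.
Proof. by move=> Wg; rewrite /tx /ty /tw /= -!ta_inlM (cr_wy (ch_rel H)). Qed.

Lemma tw1 : tw 1%g = 1.
Proof. by rewrite /tw (cr_w1 (ch_rel H)) ta_inl1. Qed.

Lemma twM g g' : g \in W -> g' \in W -> tw (g * g')%g = tw g * tw g'.
Proof. by move=> Wg Wg'; rewrite /tw (cr_wM (ch_rel H)) // ta_inlM. Qed.

Lemma tyx u v : commutator (ty v) (tx u) = (pairing u v)%:A -
  \sum_(k | is_pos Phi k) ((c 0 k)%:C * pairing (croot k) v * pairing u (ccoroot k))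
     *: tw (rg_s W k).
Proof.
rewrite /commutator /tx /ty /= -!ta_inlM -ta_inlB (cr_yx (ch_rel H)).
rewrite ta_inlB ta_inlZ ta_inl1 ta_inl_sum; congr (_ - _).
by apply: eq_bigr => k _; rewrite ta_inlZ.
Qed.

Lemma pairing_basis (i j : 'I_r) : pairing (basis_vec C i) (basis_vec C j) = (i == j)%:R.
Proof. by rewrite pairing_basisl !mxE eqxx andbT. Qed.

Lemma tetaxi_basis i j : eta i * xi j = (i == j)%:R%:A - xi j * eta i.
Proof. by rewrite tetaxi pairing_basis eq_sym. Qed.

Lemma tyxC i j : commutator (Y i) (X j) = commutator (Y j) (X i).
Proof.
rewrite !tyx !pairing_basis eq_sym; congr (_ - _); apply: eq_bigr => k _.
by rewrite -!mulrA root_corootC.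
Qed.

(** Only the scalar term of [y, x] survives the summation, because a
    reflection [s_a] anticommutes with the generator attached to [a]. *)
Lemma reflection_terms_cancel (p : {linear h -> A}) (i : 'I_r) (K : 'I_r -> A)
    (a v : 'I_(nroots Phi) -> h) :
  (forall k u, tw (rg_s W k) * p u = p (hact W (rg_s W k) u) * tw (rg_s W k)) ->
  (forall k, hact W (rg_s W k) (v k) = - v k) ->
  (forall j, K j = (i == j)%:R%:A - \sum_(k | is_pos Phi k)
     ((c 0 k)%:C * a k i 0 * v k j 0) *: tw (rg_s W k)) ->
  \sum_j (K j * p (basis_vec C j) + p (basis_vec C j) * K j) = 2 *: p (basis_vec C i).
Proof.
move=> sp sv KE; pose b k j := (c 0 k)%:C * a k i 0 * v k j 0.
transitivity (\sum_j ((i == j)%:R *: (2 *: p (basis_vec C j))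
    - \sum_(k | is_pos Phi k) b k j *:
       (tw (rg_s W k) * p (basis_vec C j) + p (basis_vec C j) * tw (rg_s W k)))).
  apply: eq_bigr => j _; rewrite KE mulrBl mulrBr addrACA.
  rewrite -scalerAl -scalerAr mul1r mulr1 -scalerDr -mulr2n -(scaler_nat 2).
  congr (_ + _); rewrite -opprD; congr (- _).
  rewrite mulr_suml mulr_sumr -big_split; apply: eq_bigr => k _ /=.
  by rewrite -scalerAl -scalerAr scalerDr.
rewrite sumrB exchange_big /= [E in _ - E]big1 => [|k _].
  rewrite subr0 (bigD1 i) //= eqxx scale1r big1 ?addr0 // => j /negbTE.
  by rewrite eq_sym => ->; rewrite scale0r.
transitivity (((c 0 k)%:C * a k i 0) *:
   (tw (rg_s W k) * p (v k) + p (v k) * tw (rg_s W k))).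
  rewrite [p (v k)]linear_basis mulr_suml mulr_sumr -big_split scaler_sumr.
  apply: eq_bigr => j _; rewrite [RHS]/= -[in RHS]scalerAl -[in RHS]scalerAr.
  by rewrite -[in RHS]scalerDr scalerA.
by rewrite sp sv linearN mulNr addNr scaler0.
Qed.

Lemma tyx_sum_x i :
  \sum_j (commutator (Y i) (X j) * X j + X j * commutator (Y i) (X j)) = 2 *: X i.
Proof.
apply: (reflection_terms_cancel (a := croot (Phi := Phi)) (v := ccoroot (Phi := Phi)))
  => [k u|k|j]; first by rewrite twx ?rg_s_in.
- exact: hact_coroot.
rewrite tyx pairing_basis eq_sym; congr (_ - _); apply: eq_bigr => k _.
by rewrite pairing_basisl pairing_basisr.
Qed.

Lemma tyx_sum_y i :
  \sum_j (commutator (Y j) (X i) * Y j + Y j * commutator (Y j) (X i)) = 2 *: Y i.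
Proof.
apply: (reflection_terms_cancel (a := ccoroot (Phi := Phi)) (v := croot (Phi := Phi)))
  => [k u|k|j]; first by rewrite twy ?rg_s_in.
- exact: hact_root.
rewrite tyx pairing_basis; congr (_ - _); apply: eq_bigr => k _.
by rewrite pairing_basisl pairing_basisr mulrAC.
Qed.

Local Notation tX := (fun i => X i).
Local Notation tY := (fun i => Y i).
Local Notation tXi := (fun i => xi i).
Local Notation tEta := (fun i => eta i).

Lemma gE1pE : gE1p A = raise1 tX.
Proof.
rewrite /gE1p /raise1; congr (- _); apply: eq_bigr => i _.
by rewrite /tens ta_inr1 mulr1 ta_inlZ expr2 ta_inlM.
Qed.

Lemma gE1mE : gE1m A = lower1 tY.
Proof. by apply: eq_bigr => i _; rewrite /tens ta_inr1 mulr1 ta_inlZ expr2 ta_inlM. Qed.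

Lemma gE2pE : gE2p A = raise2 tY tXi. Proof. by []. Qed.
Lemma gE2mE : gE2m A = lower2 tX tEta. Proof. by []. Qed.
Lemma gE3pE : gE3p A = raise3 tX tXi. Proof. by []. Qed.
Lemma gE3mE : gE3m A = lower3 tY tEta. Proof. by []. Qed.

Lemma gHE : gH A = degH tX tY.
Proof.
by apply: eq_bigr => i _; rewrite /tens ta_inr1 mulr1 ta_inlZ ta_inlD !ta_inlM.
Qed.

Lemma two_neq0 : 2 != 0 :> C. Proof. by rewrite pnatr_eq0. Qed.

Definition exterior_degree : A := \sum_i xi i * eta i.

Lemma gZ_exterior_degree : gZ A = exterior_degree - (r%:R / 2)%:A + Omega A.
Proof.
congr (_ + _).
have -> : (r%:R / 2)%:A = \sum_(i < r) (2^-1)%:A :> A.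
  by rewrite sumr_const card_ord scalerMnl mulr_natl.
rewrite -sumrB; apply: eq_bigr => i _.
rewrite /tens ta_inl1 mul1r ta_inrZ ta_inrB !ta_inrM -/(xi i) -/(eta i).
by rewrite tetaxi_basis eqxx scale1r (half_wedge_contract two_neq0).
Qed.

(** On vectors killed by all [Y i] only the constant and the reflections survive:
    this is where the lowest weight [r/2 - N] comes from. *)
Lemma gH_euler : gH A = \sum_i X i * Y i + (r%:R / 2)%:A -
  \sum_(k | is_pos Phi k) (c 0 k)%:C *: tw (rg_s W k).
Proof.
rewrite gHE degHE ?two_neq0 // -addrA; congr (_ + _).
rewrite -scaler_sumr.
transitivity (2^-1 *: (r%:R%:A - 2 *: \sum_(k | is_pos Phi k) (c 0 k)%:C *: tw (rg_s W k) : A)).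
  congr (_ *: _).
  have -> : r%:R%:A = \sum_(i < r) 1 :> A.
    by rewrite sumr_const card_ord scaler_nat.
  transitivity (\sum_(i < r) (1 - \sum_(k | is_pos Phi k)
      ((c 0 k)%:C * croot k i 0 * ccoroot k i 0) *: tw (rg_s W k) : A)).
    apply: eq_bigr => i _; rewrite tyx pairing_basis eqxx scale1r; congr (_ - _).
    by apply: eq_bigr => k _; rewrite pairing_basisl pairing_basisr.
  rewrite sumrB exchange_big /= scaler_sumr; congr (_ - _); apply: eq_bigr => k _.
  rewrite -scaler_suml scalerA; congr (_ *: _).
  rewrite -(pairing_root_coroot k) /pairing mulr_suml; apply: eq_bigr => i _.
  by rewrite -mulrA mulrC.
by rewrite (half_subr_double two_neq0) scalerA mulrC.
Qed.

(** The scalar parts of [degZ] and of [Z] agree, and the reflections of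
    [Y i, X j] paired with [xi j * eta i] give the second term of
    [tau_a = 1 - a a^vee] in [Omega]. *)
Lemma gZE : gZ A = degZ tX tY tXi tEta.
Proof.
have half_kappa : \sum_i 2^-1 *: commutator (Y i) (X i) =
    (r%:R / 2)%:A - \sum_(k | is_pos Phi k) (c 0 k)%:C *: tw (rg_s W k).
  have := gH_euler; rewrite gHE degHE ?two_neq0 // -addrA => /addrI.
  by [].
rewrite gZ_exterior_degree /degZ half_kappa opprB addrA [LHS]addrAC; congr (_ - _).
transitivity (exterior_degree - \sum_(k | is_pos Phi k) (c 0 k)%:C *:
     (tw (rg_s W k) * (txi (croot k) * teta (ccoroot k)))
     + \sum_(k | is_pos Phi k) (c 0 k)%:C *: tw (rg_s W k)).
  rewrite -addrA; congr (_ + _); rewrite -sumrN -big_split; apply: eq_bigr => k _ /=.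
  rewrite /s_diag /tens /tau_root ta_inrB ta_inr1 ta_inrM mulrBr mulr1 scalerBr.
  by rewrite addrC.
congr (_ + _).
transitivity (\sum_i \sum_j ((i == j)%:R *: (xi j * eta i) -
   \sum_(k | is_pos Phi k) ((c 0 k)%:C * croot k i 0 * ccoroot k j 0) *:
      (tw (rg_s W k) * (xi j * eta i)))); last first.
  apply: eq_bigr => i _; apply: eq_bigr => j _.
  rewrite tyx pairing_basis eq_sym mulrBl -scalerAl mul1r mulr_suml; congr (_ - _).
  by apply: eq_bigr => k _; rewrite pairing_basisl pairing_basisr scalerAl.
under [RHS]eq_bigr => i _ do rewrite sumrB (bigD1 i) //= eqxx scale1r.
rewrite [RHS]sumrB big_split /=.
rewrite [E in _ + E - _]big1 => [|i _]; last first.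
  by rewrite big1 // => j /negbTE ji; rewrite eq_sym ji scale0r.
rewrite addr0; congr (_ - _).
under [RHS]eq_bigr => i _ do rewrite exchange_big.
rewrite exchange_big; apply: eq_bigr => k _.
rewrite [txi _]linear_basis [teta _]linear_basis.
rewrite mulr_suml mulr_sumr scaler_sumr.
transitivity (\sum_j \sum_i (c 0 k)%:C *: (tw (rg_s W k) *
   ((croot k j 0 *: xi j) * (ccoroot k i 0 *: eta i)))).
  by apply: eq_bigr => j _; rewrite !mulr_sumr scaler_sumr.
rewrite exchange_big; apply: eq_bigr => i _; apply: eq_bigr => j _ /=.
rewrite -scalerAl -!scalerAr !scalerA; congr (_ *: _).
have := root_corootC k (basis_vec C i) (basis_vec C j).
rewrite !pairing_basisr !pairing_basisl -!mulrA => E.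
by rewrite E.
Qed.

End SuperalgebraInTensor.

(** * Brackets with the raising operators *)

Section BracketTable.

Variables (R : realType) (r : nat) (Phi : root_system R r).
Variables (gT : finGroupType) (W : reflection_group Phi gT).
Variables (c : 'rV[R]_(nroots Phi)) (H : cherednik W c) (Cl : clifford R[i] r).
Variable A : tensor_algebra H Cl.

Ltac superalgebra_relation :=
  first [ exact: two_neq0 | exact: txx | exact: tyy | exact: txi_tx
        | exact: txi_ty | exact: teta_tx | exact: teta_ty | exact: txixi
        | exact: tetaeta | exact: tetaxi_basis | exact: tyxC
        | exact: tyx_sum_x | exact: tyx_sum_y ].

Lemma gH_X j : commutator (gH A) (tx A (basis_vec _ j)) = tx A (basis_vec _ j).
Proof.
by rewrite gHE (commutator_degH_X (two_neq0 R)) // => *; superalgebra_relation.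
Qed.

Lemma gH_gE1p : commutator (gH A) (gE1p A) = 2 *: gE1p A.
Proof. by rewrite gHE gE1pE degH_raise1 // => *; superalgebra_relation. Qed.

Lemma gH_gE2p : commutator (gH A) (gE2p A) = - gE2p A.
Proof. by rewrite gHE gE2pE degH_raise2 // => *; superalgebra_relation. Qed.

Lemma gH_gE3p : commutator (gH A) (gE3p A) = gE3p A.
Proof. by rewrite gHE gE3pE degH_raise3 // => *; superalgebra_relation. Qed.

Lemma gZ_gE1p : commutator (gZ A) (gE1p A) = 0.
Proof. by rewrite gZE gE1pE degZ_raise1 // => *; superalgebra_relation. Qed.

Lemma gZ_gE2p : commutator (gZ A) (gE2p A) = gE2p A.
Proof. by rewrite gZE gE2pE degZ_raise2 // => *; superalgebra_relation. Qed.

Lemma gZ_gE3p : commutator (gZ A) (gE3p A) = gE3p A.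
Proof. by rewrite gZE gE3pE degZ_raise3 // => *; superalgebra_relation. Qed.

Lemma gE1m_gE1p : commutator (gE1m A) (gE1p A) = - gH A.
Proof. by rewrite gHE gE1mE gE1pE lower1_raise1 // => *; superalgebra_relation. Qed.

Lemma gE1m_gE2p : commutator (gE1m A) (gE2p A) = 0.
Proof. by rewrite gE1mE gE2pE lower1_raise2 // => *; superalgebra_relation. Qed.

Lemma gE1m_gE3p : commutator (gE1m A) (gE3p A) = - gE2p A.
Proof. by rewrite gE1mE gE3pE gE2pE lower1_raise3 // => *; superalgebra_relation. Qed.

Lemma gE2m_gE1p : commutator (gE2m A) (gE1p A) = 0.
Proof. by rewrite gE2mE gE1pE lower2_raise1 // => *; superalgebra_relation. Qed.

Lemma gE2m_gE2p : anticommutator (gE2m A) (gE2p A) = gH A + gZ A.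
Proof. by rewrite gE2mE gE2pE gHE gZE lower2_raise2 // => *; superalgebra_relation. Qed.

Lemma gE2m_gE3p : anticommutator (gE2m A) (gE3p A) = 2 *: gE1p A.
Proof. by rewrite gE2mE gE3pE gE1pE lower2_raise3 // => *; superalgebra_relation. Qed.

Lemma gE3m_gE1p : commutator (gE3m A) (gE1p A) = gE2m A.
Proof. by rewrite gE3mE gE1pE gE2mE lower3_raise1 // => *; superalgebra_relation. Qed.

Lemma gE3m_gE2p : anticommutator (gE3m A) (gE2p A) = - (2 *: gE1m A).
Proof. by rewrite gE3mE gE2pE gE1mE lower3_raise2 // => *; superalgebra_relation. Qed.

Lemma gE3m_gE3p : anticommutator (gE3m A) (gE3p A) = gH A - gZ A.
Proof. by rewrite gE3mE gE3pE gHE gZE lower3_raise3 // => *; superalgebra_relation. Qed.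

Lemma gE2p_gE1p : commutator (gE2p A) (gE1p A) = gE3p A.
Proof. by rewrite gE2pE gE1pE gE3pE raise2_raise1 // => *; superalgebra_relation. Qed.

Lemma gE3p_gE1p : commutator (gE3p A) (gE1p A) = 0.
Proof. by rewrite gE3pE gE1pE raise3_raise1 // => *; superalgebra_relation. Qed.

Lemma gE2p_gE2p : anticommutator (gE2p A) (gE2p A) = 0.
Proof.
by rewrite gE2pE /anticommutator raise2_sqr ?addr0 // => *; superalgebra_relation.
Qed.

Lemma gE3p_gE3p : anticommutator (gE3p A) (gE3p A) = 0.
Proof.
by rewrite gE3pE /anticommutator raise3_sqr ?addr0 // => *; superalgebra_relation.
Qed.

Lemma gE3p_gE2p : anticommutator (gE3p A) (gE2p A) = 0.
Proof. by rewrite gE3pE gE2pE raise3_raise2 // => *; superalgebra_relation. Qed.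

(** The positive root vectors E_1^+, E_2^+, E_3^+ are indexed by [None],
    [Some false], [Some true]; the odd ones are the [Some _]. *)
Definition gEp (a : option bool) : A :=
  match a with None => gE1p A | Some false => gE2p A | Some true => gE3p A end.

Lemma gEp_in a : in_g (isSome a) (gEp a).
Proof. by apply: lin_span_incl; case: a => [[]|]; rewrite !inE eqxx ?orbT. Qed.

Lemma in_g_linear p : linear_subspace (@in_g R r Phi gT W c H Cl A p).
Proof. exact: lin_span_linear. Qed.

Lemma superbracket_even p q (u v : A) : ~~ (p && q) ->
  superbracket p q u v = commutator u v.
Proof. by rewrite /superbracket => /negbTE ->; rewrite scale1r. Qed.

Lemma superbracket_odd (u v : A) : superbracket true true u v = anticommutator u v.
Proof. by rewrite /superbracket scaleN1r opprK. Qed.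

Lemma superbracket_gEp p X a :
  X \in (if p then [:: gE2p A; gE2m A; gE3p A; gE3m A]
         else [:: gH A; gZ A; gE1p A; gE1m A]) ->
  in_g (p (+) isSome a) (superbracket p (isSome a) X (gEp a)).
Proof.
have inH : in_g false (gH A) by apply: lin_span_incl; rewrite !inE eqxx.
have inZ : in_g false (gZ A) by apply: lin_span_incl; rewrite !inE eqxx orbT.
have in1m : in_g false (gE1m A) by apply: lin_span_incl; rewrite !inE eqxx !orbT.
have in2m : in_g true (gE2m A) by apply: lin_span_incl; rewrite !inE eqxx !orbT.
have in1p : in_g false (gE1p A) := gEp_in None.
have in2p : in_g true (gE2p A) := gEp_in (Some false).
have in3p : in_g true (gE3p A) := gEp_in (Some true).
have linS p' := in_g_linear p'.
have in0 p' : in_g p' (0 : A) by case: (linS p').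
have inN p' (u : A) : in_g p' u -> in_g p' (- u) by apply: subspaceN.
have inD p' (u v : A) : in_g p' u -> in_g p' v -> in_g p' (u + v) by apply: subspaceD.
have inZ' p' k (u : A) : in_g p' u -> in_g p' (k *: u) by apply: subspaceZ.
case: p; rewrite !inE => /or4P[] /eqP ->; case: a => [[]|];
  rewrite ?superbracket_odd ?superbracket_even // /gEp;
  rewrite ?[anticommutator (gE2p _) (gE3p _)]anticommutatorC
    ?[commutator (gE1p _) (gE2p _)]commutatorC
    ?[commutator (gE1p _) (gE3p _)]commutatorC ?[commutator (gE1p _) (gE1p _)]subrr
    ?(gH_gE1p, gH_gE2p, gH_gE3p, gZ_gE1p, gZ_gE2p, gZ_gE3p)
    ?(gE1m_gE1p, gE1m_gE2p, gE1m_gE3p, gE2m_gE1p, gE2m_gE2p, gE2m_gE3p)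
    ?(gE3m_gE1p, gE3m_gE2p, gE3m_gE3p, gE2p_gE1p, gE3p_gE1p)
    ?(gE2p_gE2p, gE3p_gE3p, gE3p_gE2p); auto.
Qed.

End BracketTable.

(** * Words of raising operators *)

Section LowestWeightModules.

Variables (R : realType) (r : nat) (Phi : root_system R r).
Variables (gT : finGroupType) (W : reflection_group Phi gT).
Variables (c : 'rV[R]_(nroots Phi)) (H : cherednik W c) (Cl : clifford R[i] r).
Variable A : tensor_algebra H Cl.

Local Notation C := R[i].
Local Notation inG p := (@in_g R r Phi gT W c H Cl A p).

Definition lowest_weight_vector (G : g_module A) (mu nu : C) (v : G) : Prop :=
  [/\ [/\ g_act (gE1m A) v = 0, g_act (gE2m A) v = 0 & g_act (gE3m A) v = 0],
      g_act (gH A) v = mu *: v & g_act (gZ A) v = nu *: v].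

Fixpoint gword (G : g_module A) (w : seq (option bool)) (v : G) : G :=
  if w is a :: w' then g_act (gEp A a) (gword w' v) else v.

Definition gword_span (G : g_module A) (v : G) : G -> Prop :=
  lin_span (fun z => exists w, z = gword w v).

Definition in_nplus (G : g_module A) : G -> Prop :=
  lin_span (fun z => exists a k, z = g_act (gEp A a) k).

Section OneModule.

Variable G : g_module A.
Implicit Types (v k : G) (mu nu : C).

Lemma g_act_linear p X : inG p X -> linear (@g_act R r Phi gT W c H Cl A G X).
Proof. by move=> inX a u v; apply: g_actr inX. Qed.

Lemma g_act0l v : g_act 0 v = 0.
Proof.
have [in0 _] := in_g_linear A false.
have := g_actl (-1) v in0 in0.
by rewrite scaler0 addr0 scaleN1r addNr.
Qed.

Lemma g_actZl p X a v : inG p X -> g_act (a *: X) v = a *: g_act X v.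
Proof.
move=> inX; have [in0 _] := in_g_linear A p.
by rewrite -[a *: X]addr0 (g_actl a v inX in0) g_act0l addr0.
Qed.

Lemma g_act0r p X : inG p X -> g_act X (0 : G) = 0.
Proof.
by move=> /g_act_linear/linear_zero.
Qed.

Lemma g_actZr p X a v : inG p X -> g_act X (a *: v) = a *: g_act X v.
Proof.
by move=> inX; rewrite -[a *: v]addr0 (g_actr _ _ _ inX) (g_act0r inX) addr0.
Qed.

Lemma g_act_generators (S : G -> Prop) p X v : linear_subspace S ->
  (forall X', X' \in (if p then [:: gE2p A; gE2m A; gE3p A; gE3m A]
                      else [:: gH A; gZ A; gE1p A; gE1m A]) -> S (g_act X' v)) ->
  inG p X -> S (g_act X v).
Proof.
move=> linS Sgen inX.
suff [] : inG p X /\ S (g_act X v) by [].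
have [in0 inlin] := in_g_linear A p.
apply: (lin_span_min (S := fun X => inG p X /\ S (g_act X v))) inX.
  split=> [|a X1 X2 [in1 S1] [in2 S2]].
    by split=> //; rewrite g_act0l; case: linS.
  split; first exact: inlin.
  by rewrite (g_actl _ _ in1 in2); case: linS => _; apply.
by move=> X' genX'; split; [exact: lin_span_incl | exact: Sgen].
Qed.

(** Moving an element of g through the first letter of a word leaves a bracket,
    which is again an element of g acting on a shorter word. *)
Lemma gword_span_submodule mu nu v :
  lowest_weight_vector mu nu v -> g_submodule (gword_span v).
Proof.
move=> [[v1 v2 v3] vH vZ]; pose S := gword_span v.
have linS : linear_subspace S by apply: lin_span_linear.
have Sw w : S (gword w v) by apply: lin_span_incl; exists w.
have SD k k' : S k -> S k' -> S (k + k') by apply: subspaceD.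
have SZ a k : S k -> S (a *: k) by apply: subspaceZ.
have SE a k : S k -> S (g_act (gEp A a) k).
  apply: lin_span_map; first exact: g_act_linear (gEp_in A a).
  by move=> _ [w ->]; apply: (Sw (a :: w)).
suff Sgen w p X' : X' \in (if p then [:: gE2p A; gE2m A; gE3p A; gE3m A]
    else [:: gH A; gZ A; gE1p A; gE1m A]) -> S (g_act X' (gword w v)).
  split=> // p X k inX; apply: (lin_span_min (S := fun k => S (g_act X k))).
    split=> [|a k1 k2 S1 S2]; first by rewrite (g_act0r inX); case: linS.
    by rewrite (g_actr _ _ _ inX); case: linS => _; apply.
  by move=> _ [w ->]; apply: (g_act_generators linS _ inX) => X'; apply: Sgen.
elim: w p X' => [|a w IHw] p X' genX'.
  have Sv (e : C) : S (e *: v) by apply: SZ; apply: (Sw [::]).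
  have S0 : S 0 by case: linS.
  case: p genX'; rewrite !inE => /or4P[] /eqP -> /=; rewrite ?v1 ?v2 ?v3 ?vH ?vZ //.
  - exact: (SE (Some false) _ (Sw [::])).
  - exact: (SE (Some true) _ (Sw [::])).
  - exact: (SE None _ (Sw [::])).
have inX' : inG p X' by apply: lin_span_incl.
have -> : g_act X' (gword (a :: w) v) =
    g_act (superbracket p (isSome a) X' (gEp A a)) (gword w v)
    + (-1) ^+ (p && isSome a) *: g_act (gEp A a) (g_act X' (gword w v)).
  by rewrite (g_act_bracket _ inX' (gEp_in A a)) subrK.
apply: SD.
  by apply: (g_act_generators linS _ (superbracket_gEp a genX')) => X2; apply: IHw.
by apply: SZ; apply: SE; apply: IHw genX'.
Qed.

Lemma in_nplus_act a k : in_nplus (g_act (gEp A a) k).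
Proof. by apply: lin_span_incl; exists a, k. Qed.

Lemma gword_span_head v z : gword_span v z ->
  exists a z', in_nplus z' /\ z = a *: v + z'.
Proof.
have linN := lin_span_linear (fun z : G => exists a k, z = g_act (gEp A a) k).
apply: (lin_span_min (S := fun z => exists a z', in_nplus z' /\ z = a *: v + z')).
  split=> [|b z1 z2 [a1 [z1' [N1 ->]]] [a2 [z2' [N2 ->]]]].
    by exists 0, 0; rewrite scale0r addr0; split=> //; case: linN.
  exists (b * a1 + a2), (b *: z1' + z2'); split; first by case: linN => _; apply.
  by rewrite scalerDr scalerDl scalerA addrACA.
move=> _ [[|a w] ->].
  by exists 1, 0; rewrite scale1r addr0; split=> //; case: linN.
by exists 0, (gword (a :: w) v); rewrite scale0r add0r; split=> //; apply: in_nplus_act.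
Qed.

(** [E_2^+] lowers [H]; the combination [H + 2Z] is raised by all three raising
    operators. *)
Definition height_op (k : G) : G := g_act (gH A) k + 2 *: g_act (gZ A) k.

Lemma gH_in : inG false (gH A).
Proof. by apply: lin_span_incl; rewrite !inE eqxx. Qed.

Lemma gZ_in : inG false (gZ A).
Proof. by apply: lin_span_incl; rewrite !inE eqxx orbT. Qed.

Lemma height_op_linear : linear height_op.
Proof.
move=> a u v; rewrite /height_op (g_actr _ _ _ gH_in) (g_actr _ _ _ gZ_in).
by rewrite !scalerDr !scalerA (mulrC 2) -!scalerA addrACA.
Qed.

Definition height (a : option bool) : nat :=
  match a with None => 2 | Some false => 1 | Some true => 3 end.

Lemma height_op_gEp a (k : G) :
  height_op (g_act (gEp A a) k) =
  g_act (gEp A a) (height_op k) + (height a)%:R *: g_act (gEp A a) k.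
Proof.
have inE := gEp_in A a.
have com X (inX : inG false X) : g_act X (g_act (gEp A a) k) =
    g_act (commutator X (gEp A a)) k + g_act (gEp A a) (g_act X k).
  rewrite -(@superbracket_even _ _ _ _ _ _ _ _ _ false (isSome a)) //.
  by rewrite (g_act_bracket k inX inE) scale1r subrK.
have -> : g_act (gEp A a) (height_op k) =
    g_act (gEp A a) (g_act (gH A) k) + 2 *: g_act (gEp A a) (g_act (gZ A) k).
  by rewrite /height_op addrC (g_actr _ _ _ inE) addrC.
rewrite {1}/height_op (com _ gH_in) (com _ gZ_in) scalerDr addrACA addrC.
congr (_ + _); case: a inE {com} => [[]|] /= inE.
- rewrite gH_gE3p gZ_gE3p -[E in E + _]scale1r -scalerDl.
  by congr (_ *: _); rewrite -(natrD _ 1 2).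
- rewrite gH_gE2p gZ_gE2p -scaleN1r (g_actZl _ _ inE) -scalerDl.
  by congr (_ *: _); rewrite mulr2n addrA addNr add0r.
- by rewrite gH_gE1p gZ_gE1p (g_actZl _ _ inE) g_act0l scaler0 addr0.
Qed.

Lemma height_op_gword mu nu v w : lowest_weight_vector mu nu v ->
  height_op (gword w v) = (mu + 2 * nu + (sumn (map height w))%:R) *: gword w v.
Proof.
case=> _ vH vZ; elim: w => [|a w IHw] /=.
  by rewrite /height_op vH vZ addr0 scalerA -scalerDl.
rewrite height_op_gEp IHw (g_actZr _ _ (gEp_in A a)) -scalerDl natrD.
by rewrite -addrA (addrC (height a)%:R).
Qed.

(** All nonempty words on [v] have an eigenvalue of [H + 2Z] greater than that
    of [v]. *)
Lemma lowest_weight_notin_nplus mu nu v : lowest_weight_vector mu nu v ->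
  (forall z, gword_span v z) -> in_nplus v -> v = 0.
Proof.
move=> lwv genv vN.
have {vN} [n [a [u [uE vE]]]] : lin_span (fun z => exists b w, z = gword (b :: w) v) v.
  apply: lin_span_sub vN => _ [b [k ->]]; have := genv k.
  apply: (lin_span_map (f := g_act (gEp A b))).
    exact: g_act_linear (gEp_in A b).
  by move=> _ [w ->]; apply: lin_span_incl; exists b, w.
have uE' i : exists w : seq (option bool), [/\ 0 < sumn (map height w) & u i = gword w v]%N.
  have [b [w ->]] := uE i; exists (b :: w); split=> //=.
  by rewrite addn_gt0; case: b => [[]|].
have [w wP] := choice uE'.
apply: (@separated_eigenvectors _ G unit (fun=> linear_map height_op_linear) n
   (fun i => a i *: u i) v
   (fun i _ => mu + 2 * nu + (sumn (map height (w i)))%:R)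
   (fun _ => mu + 2 * nu)) => //= [_|i _ _|i _].
- by rewrite -[v]/(gword [::] v) (height_op_gword _ lwv) addr0.
- have [_ ->] := wP i; have := height_op_linear (a i) (gword (w i) v) 0.
  rewrite addr0 => ->; rewrite (height_op_gword _ lwv).
  have -> : height_op 0 = 0.
    by rewrite /height_op (g_act0r gH_in) (g_act0r gZ_in) scaler0 addr0.
  by rewrite addr0 !scalerA mulrC.
exists tt; have [w0 _] := wP i.
by rewrite -subr_eq0 addrAC subrr add0r pnatr_eq0 -lt0n.
Qed.

End OneModule.

Section ProductModule.

Variables G1 G2 : g_module A.

Definition prod_act (X : A) (v : (G1 * G2)%type) : (G1 * G2)%type :=
  (g_act X v.1, g_act X v.2).

Definition prod_module : g_module A.
Proof.
apply: (@GModule _ _ _ _ _ _ _ _ _ (G1 * G2)%type prod_act).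
- by move=> p X a u v inX; congr pair; apply: g_actr inX.
- by move=> p X Y a v inX inY; congr pair; apply: g_actl inX inY.
- by move=> p q X Y v inX inY; congr pair; apply: g_act_bracket.
Defined.

Lemma gword_prod w (v1 : G1) (v2 : G2) :
  gword w ((v1, v2) : prod_module) = (gword w v1, gword w v2).
Proof. by elim: w => //= a w ->. Qed.

Lemma prod_lowest mu nu (v1 : G1) (v2 : G2) :
  lowest_weight_vector mu nu v1 -> lowest_weight_vector mu nu v2 ->
  lowest_weight_vector mu nu ((v1, v2) : prod_module).
Proof.
move=> [[v11 v12 v13] v1H v1Z] [[v21 v22 v23] v2H v2Z]; rewrite /prod_module.
split; first by split; congr pair.
  by rewrite -[RHS]/(mu *: v1, mu *: v2) -v1H -v2H.
by rewrite -[RHS]/(nu *: v1, nu *: v2) -v1Z -v2Z.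
Qed.

Lemma in_nplus_prod (z : prod_module) : in_nplus z -> in_nplus z.1 /\ in_nplus z.2.
Proof.
have [N10 N1] := lin_span_linear (fun z : G1 => exists a k, z = g_act (gEp A a) k).
have [N20 N2] := lin_span_linear (fun z : G2 => exists a k, z = g_act (gEp A a) k).
apply: (lin_span_min (S := fun z : (G1 * G2)%type => in_nplus z.1 /\ in_nplus z.2)).
  by split=> // a u v [u1 u2] [v1 v2]; split; [apply: N1 | apply: N2].
by move=> _ [a [k ->]]; split; apply: in_nplus_act.
Qed.

End ProductModule.

(** Here [G] is a module with a positive definite form for which the raising
    operators are adjoint to operators [gEm a] of g that kill lowest weight
    vectors. *)
Section Uniqueness.

Variables (L G : g_module A) (b : G -> G -> C) (gEm : option bool -> A).
Hypotheses (herm_b : hermitian_form b)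
  (pos_b : positive_definite_on (fun _ => True) b)
  (gEm_in : forall a, inG (isSome a) (gEm a))
  (adj : forall a k k', b (g_act (gEp A a) k) k' = b k (g_act (gEm a) k'))
  (killed : forall (u : G) mu nu, lowest_weight_vector mu nu u ->
     forall a, g_act (gEm a) u = 0).

Lemma nplus_orthogonal mu nu u z :
  lowest_weight_vector mu nu u -> in_nplus z -> b z u = 0.
Proof.
move=> lwu; apply: (lin_span_min (S := fun z => b z u = 0)).
  split=> [|a k k' ku k'u]; first exact: herm0l.
  by rewrite (hermDl herm_b) (hermZl herm_b) ku k'u mulr0 addr0.
by move=> _ [a [k ->]]; rewrite adj (killed lwu) (herm0r herm_b).
Qed.

(** The combination [k] of words on [u] lies in [N], the intersection of [0 x G]
    with the submodule of [L x G] generated by [(v, u)]. Since [N] is stable under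
    the [gEm a], it is orthogonal to all words on [u] once it is orthogonal to
    [u]. *)
Lemma word_relations mu nu (v : L) (u : G) n (a : 'I_n -> C) (w : 'I_n -> seq (option bool)) :
  lowest_weight_vector mu nu v -> v != 0 -> (forall z : L, gword_span v z) ->
  lowest_weight_vector mu nu u ->
  \sum_i a i *: gword (w i) v = 0 -> \sum_i a i *: gword (w i) u = 0.
Proof.
move=> lwv v0 genv lwu rel; set k := (X in X = 0).
pose LG := prod_module L G; pose vu : LG := (v, u).
have [_ stab] := gword_span_submodule (prod_lowest lwv lwu : lowest_weight_vector mu nu vu).
pose N (k : G) := gword_span vu (0, k).
have Nk : N k.
  rewrite /N; have <- : \sum_i a i *: gword (w i) vu = (0, k) :> LG.
    rewrite -rel /k; elim/big_rec3: _ => //= i x y z _ ->.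
    by rewrite gword_prod.
  apply: subspace_sum => [|i _]; first exact: lin_span_linear.
  apply: subspaceZ; first exact: lin_span_linear.
  by apply: lin_span_incl; exists (w i).
have Nstab a' k' : N k' -> N (g_act (gEm a') k').
  by move/(stab _ _ _ (gEm_in a')); rewrite /= /prod_act /= (g_act0r L (gEm_in a')).
have Northo w' : forall k', N k' -> b k' (gword w' u) = 0.
  elim: w' => [|a' w' IHw'] k' Nk' /=.
    (* Modulo the image of the raising operators, an element of the submodule is
       a multiple [e] of [(v, u)]; the component 0 in [L] forces [e = 0]. *)
    have [e [[l' z'] [/in_nplus_prod[/= nL nG] [E1 ->]]]] := gword_span_head Nk'.
    have e0 : e = 0.
      apply/eqP; apply: contraT => e0; case/eqP: v0.
      apply: (lowest_weight_notin_nplus lwv genv).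
      have linN := lin_span_linear (fun z : L => exists a k, z = g_act (gEp A a) k).
      have -> : v = (- e^-1) *: l'.
        have/eqP := E1; rewrite eq_sym addrC addr_eq0 => /eqP ->.
        by rewrite /= scalerN scaleNr opprK scalerA mulVf // scale1r.
      exact: subspaceZ.
    by rewrite e0 scale0r add0r; apply: (nplus_orthogonal lwu nG).
  apply: (herm_eq0_sym herm_b); rewrite adj; apply: (herm_eq0_sym herm_b).
  by apply: IHw'; apply: Nstab.
apply: (herm_definite pos_b); rewrite {2}/k (herm_sumr herm_b) big1 // => i _.
by rewrite (hermZr herm_b) Northo // mulr0.
Qed.

(** Across the form, raising operators on the words of [u] become lowering operators
    on the submodule generated by [u']. *)
Lemma gword_orthogonal (u u' : G) mu nu mu' nu' :
  lowest_weight_vector mu nu u -> lowest_weight_vector mu' nu' u' -> b u u' = 0 ->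
  forall w z, gword_span u' z -> b (gword w u) z = 0.
Proof.
move=> lwu lwu' uu'; have [_ stab] := gword_span_submodule lwu'.
elim=> [|a w IHw] z u'z /=.
  have [e [z' [nz' ->]]] := gword_span_head u'z.
  rewrite (hermDr herm_b) (hermZr herm_b) uu' mulr0 add0r.
  by apply: (herm_eq0_sym herm_b); apply: (nplus_orthogonal lwu nz').
by rewrite adj; apply: IHw; apply: stab u'z.
Qed.

End Uniqueness.

End LowestWeightModules.

(** * Module actions and the exterior algebra *)

Section ModuleActions.

Variables (F : fieldType) (A : algType F) (M : lmodType F) (act : A -> M -> M).
Hypothesis actP : module_action act.

Lemma mactP h : linear (act h).
Proof. by move=> a u v; case: actP. Qed.

Lemma mact0r h : act h 0 = 0.
Proof. exact: linear_zero (mactP h). Qed.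

Lemma mactDr h u v : act h (u + v) = act h u + act h v.
Proof. by have := mactP h 1 u v; rewrite !scale1r. Qed.

Lemma mactZr h a u : act h (a *: u) = a *: act h u.
Proof. by have := mactP h a u 0; rewrite mact0r !addr0. Qed.

Lemma mactNr h u : act h (- u) = - act h u.
Proof. by rewrite -[- u]scaleN1r mactZr scaleN1r. Qed.

Lemma mact_sumr (I : Type) (s : seq I) (p : pred I) h (f : I -> M) :
  act h (\sum_(i <- s | p i) f i) = \sum_(i <- s | p i) act h (f i).
Proof. exact: (big_morph (act h) (mactDr h) (mact0r h)). Qed.

Lemma mactPl a h h' u : act (a *: h + h') u = a *: act h u + act h' u.
Proof. by case: actP. Qed.

Lemma mact0l u : act 0 u = 0.
Proof. by have := mactPl (-1) 0 0 u; rewrite scaler0 addr0 scaleN1r addNr. Qed.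

Lemma mactDl h h' u : act (h + h') u = act h u + act h' u.
Proof. by have := mactPl 1 h h' u; rewrite !scale1r. Qed.

Lemma mactZl a h u : act (a *: h) u = a *: act h u.
Proof. by have := mactPl a h 0 u; rewrite mact0l !addr0. Qed.

Lemma mactNl h u : act (- h) u = - act h u.
Proof. by rewrite -[- h]scaleN1r mactZl scaleN1r. Qed.

Lemma mactBl h h' u : act (h - h') u = act h u - act h' u.
Proof. by rewrite mactDl mactNl. Qed.

Lemma mact_suml (I : Type) (s : seq I) (p : pred I) (f : I -> A) u :
  act (\sum_(i <- s | p i) f i) u = \sum_(i <- s | p i) act (f i) u.
Proof.
exact: (big_morph (act^~ u) (fun x y => mactDl x y u) (mact0l u)).
Qed.

Lemma mact1 u : act 1 u = u. Proof. by case: actP. Qed.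

Lemma mactM h h' u : act (h * h') u = act h (act h' u). Proof. by case: actP. Qed.

Lemma mact_commutator h h' u :
  act h (act h' u) = act h' (act h u) + act (commutator h h') u.
Proof. by rewrite /commutator mactBl !mactM addrC subrK. Qed.

Lemma mact_anticommutator h h' u :
  act h (act h' u) = - act h' (act h u) + act (anticommutator h h') u.
Proof. by rewrite /anticommutator mactDl !mactM addrC addrK. Qed.

End ModuleActions.

Lemma span_grouped (F : fieldType) (V : lmodType F) (J : eqType)
    (T : J -> V -> Prop) z :
  (forall j, linear_subspace (T j)) ->
  lin_span (fun u => exists j, T j u) z ->
  exists (s : seq J) (f : J -> V),
    [/\ uniq s, forall j, T j (f j) & z = \sum_(j <- s) f j].
Proof.
move=> linT; have T0 j : T j 0 by case: (linT j).
apply: (lin_span_min (S := fun z => exists (s : seq J) (f : J -> V),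
    [/\ uniq s, forall j, T j (f j) & z = \sum_(j <- s) f j])).
  split=> [|a u v [s [f [us Tf ->]]] [s' [g [us' Tg ->]]]].
    by exists [::], (fun=> 0); split=> //; rewrite big_nil.
  pose h (b : V -> V) (t : seq J) (k : J -> V) j := if j \in t then b (k j) else 0.
  exists (undup (s ++ s')), (fun j => h ( *:%R a) s f j + h id s' g j); split.
  - exact: undup_uniq.
  - move=> j; apply: (subspaceD (linT j)); rewrite /h; case: ifP => // _.
    exact: subspaceZ.
  have ext (b : V -> V) (t : seq J) (k : J -> V) : uniq t -> {subset t <= s ++ s'} ->
      \sum_(j <- undup (s ++ s')) h b t k j = \sum_(j <- t) b (k j).
    move=> ut ts; rewrite /h -big_mkcond -big_filter; apply: perm_big.
    apply: uniq_perm => // [|j]; first by rewrite filter_uniq ?undup_uniq.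
    by rewrite mem_filter mem_undup andb_idr // => /ts.
  rewrite big_split /= !ext // ?scaler_sumr // => j; rewrite mem_cat => ->; rewrite ?orbT //.
move=> u [j Tu]; exists [:: j], (fun i => if i == j then u else 0); split=> // [i|].
  by case: eqP => [->|].
by rewrite big_seq1 eqxx.
Qed.

Section ExteriorModule.

Variables (F : fieldType) (r : nat) (M : lmodType F).
Local Notation K := {ffun {set 'I_r} -> M}.
Implicit Types (S : {set 'I_r}) (z : M) (k : K).

Definition single S z : K := [ffun S' => if S' == S then z else 0].

Lemma single_linear S : linear (single S).
Proof.
move=> a u v; apply/ffunP => S'; rewrite !ffunE.
by case: eqP; rewrite // scaler0 addr0.
Qed.

Lemma single0 S : single S 0 = 0.
Proof. by apply/ffunP => S'; rewrite !ffunE; case: eqP. Qed.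

Lemma sum_single k : k = \sum_S single S (k S).
Proof.
apply/ffunP => S; rewrite sum_ffunE (bigD1 S) //= ffunE eqxx big1 ?addr0 // => S' nS.
by rewrite ffunE eq_sym (negbTE nS).
Qed.

Lemma ext_sign_sqr (i : 'I_r) S : ext_sign F i S * ext_sign F i S = 1.
Proof. by rewrite -expr2 sqrr_sign. Qed.

Lemma ext_signD1 (i : 'I_r) S : ext_sign F i (S :\ i) = ext_sign F i S.
Proof.
congr (_ ^+ _); apply: eq_card => j; rewrite !inE.
by case: eqP => // ->; rewrite ltnn !andbF.
Qed.

Lemma wedge_contract (i : 'I_r) k :
  wedge i (contract i k) = [ffun S : {set 'I_r} => if i \in S then k S else 0].
Proof.
apply/ffunP => S; rewrite !ffunE; case: ifP => // iS.
by rewrite finset.setD11 finset.setD1K // ext_signD1 scalerA ext_sign_sqr scale1r.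
Qed.

Lemma wedge_single (i : 'I_r) S z : i \in S ->
  wedge i (single (S :\ i) z) = ext_sign F i S *: single S z.
Proof.
move=> iS; apply/ffunP => S'; rewrite !ffunE; have [->|nS] := eqVneq S' S.
  by rewrite iS eqxx.
rewrite scaler0; case: ifP => // iS'; case: eqP => [E|]; last by rewrite scaler0.
by case/eqP: nS; rewrite -(finset.setD1K iS') E finset.setD1K.
Qed.

Definition parity_op k : K := [ffun S : {set 'I_r} => (-1) ^+ #|S| *: k S].

Lemma parity_op_linear : linear parity_op.
Proof.
move=> a u v; apply/ffunP => S; rewrite !ffunE.
by rewrite scalerDr !scalerA mulrC.
Qed.

Lemma parity_opK : involutive parity_op.
Proof.
move=> k; apply/ffunP => S; rewrite !ffunE scalerA -expr2 sqrr_sign.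
by rewrite scale1r.
Qed.

Lemma parity_op_wedge (i : 'I_r) k : parity_op (wedge i k) = - wedge i (parity_op k).
Proof.
apply/ffunP => S; rewrite !ffunE; case: ifP => iS; last by rewrite scaler0 oppr0.
rewrite (cardsD1 i S) iS exprS mulN1r scaleNr; congr (- _).
by rewrite !scalerA mulrC.
Qed.

Lemma parity_op_contract (i : 'I_r) k :
  parity_op (contract i k) = - contract i (parity_op k).
Proof.
apply/ffunP => S; rewrite !ffunE; case: ifP => iS; first by rewrite scaler0 oppr0.
rewrite cardsU1 iS exprS mulN1r scaleNr scalerN opprK.
by rewrite !scalerA mulrC.
Qed.

End ExteriorModule.

(** * Reflections in the Clifford algebra *)

Section CliffordReflection.

Variables (F : fieldType) (two_neq0 : 2 != 0 :> F) (r : nat) (Cl : clifford F r).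
Variables (a a' : 'cV[F]_r).
Hypothesis aa' : pairing a a' = 2.

Local Notation tau := (1 - cl_x Cl a * cl_y Cl a').

Lemma cl_x_sqr u : cl_x Cl u * cl_x Cl u = 0.
Proof.
apply/eqP; have /eqP := cl_xx Cl u u; rewrite -addr_eq0 -mulr2n -scaler_nat.
by rewrite scaler_eq0 (negbTE two_neq0).
Qed.

Lemma cl_y_sqr u : cl_y Cl u * cl_y Cl u = 0.
Proof.
apply/eqP; have /eqP := cl_yy Cl u u; rewrite -addr_eq0 -mulr2n -scaler_nat.
by rewrite scaler_eq0 (negbTE two_neq0).
Qed.

Lemma clifford_reflection_x u :
  tau * cl_x Cl u = cl_x Cl (u - pairing u a' *: a) * tau.
Proof.
have E1 : cl_x Cl a * cl_y Cl a' * cl_x Cl u =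
    pairing u a' *: cl_x Cl a + cl_x Cl u * cl_x Cl a * cl_y Cl a'.
  by rewrite -mulrA cl_yx mulrBr mulr_algr mulrA (cl_xx Cl u a) mulNr opprK.
have E2 : cl_x Cl (u - pairing u a' *: a) * (cl_x Cl a * cl_y Cl a') =
    cl_x Cl u * cl_x Cl a * cl_y Cl a'.
  rewrite linearB linearZ /= mulrBl -scalerAl !mulrA cl_x_sqr mul0r.
  by rewrite scaler0 subr0.
by rewrite mulrBl mul1r E1 mulrBr mulr1 E2 linearB linearZ /= opprD addrA.
Qed.

Lemma clifford_reflection_y v :
  tau * cl_y Cl v = cl_y Cl (v - pairing a v *: a') * tau.
Proof.
have E1 : cl_x Cl a * cl_y Cl a' * cl_y Cl v =
    cl_y Cl v * cl_x Cl a * cl_y Cl a' - pairing a v *: cl_y Cl a'.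
  rewrite -mulrA (cl_yy Cl v a') mulrN mulrA.
  have -> : cl_x Cl a * cl_y Cl v = (pairing a v)%:A - cl_y Cl v * cl_x Cl a.
    by rewrite cl_yx subKr.
  by rewrite mulrBl mulr_algl opprB.
have E2 : cl_y Cl a' * (cl_x Cl a * cl_y Cl a') = 2 *: cl_y Cl a'.
  rewrite mulrA cl_yx aa' mulrBl mulr_algl -mulrA cl_y_sqr mulr0.
  by rewrite subr0.
have E3 : cl_y Cl (v - pairing a v *: a') = cl_y Cl v - pairing a v *: cl_y Cl a'.
  by rewrite linearB linearZ.
rewrite E3 mulrBr mulr1 [in RHS]mulrBl -[in RHS]scalerAl E2 mulrBl mul1r E1.
move: (cl_y Cl v) (cl_y Cl a') => y1 y2; rewrite mulrA opprB opprB.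
have -> : pairing a v *: (2 *: y2) = pairing a v *: y2 + pairing a v *: y2.
  by rewrite -scalerDr scaler_nat mulr2n.
by rewrite -[RHS]addrA -(addrA (pairing a v *: y2) _ (- _)) addKr.
Qed.

End CliffordReflection.

(** * Degrees in the standard module *)

Section StandardModuleDegrees.

Variables (R : realType) (r : nat) (Phi : root_system R r).
Variables (gT : finGroupType) (W : reflection_group Phi gT).
Variables (c : 'rV[R]_(nroots Phi)) (H : cherednik W c).
Variables (d : nat) (tau : mx_representation R[i] W d) (M : standard_module H tau).

Local Notation C := R[i].
Local Notation x i := (ch_x H (basis_vec C i)).
Local Notation y i := (ch_y H (basis_vec C i)).
Local Notation deg := (@degree_part R r Phi gT W c H d tau M).
Local Notation smP := (sm_actP M).

Lemma degree_part_linear m : linear_subspace (deg m).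
Proof. exact: lin_span_linear. Qed.

Lemma degree_part0 v : deg 0 (sm_in M v).
Proof.
apply: lin_span_incl; exists (fun i : 'I_0 => match i with Ordinal _ p => match notF p with end end), v.
by rewrite big_ord0 (mact1 smP).
Qed.

Lemma degree_partS m j z : deg m z -> deg m.+1 (sm_act (x j) z).
Proof.
apply: lin_span_map; first exact: mactP smP _.
move=> _ [i [v ->]]; apply: lin_span_incl.
exists (fun k => if unlift ord0 k is Some k' then i k' else j), v.
rewrite big_ord_recl unlift_none (mactM smP); congr (sm_act _ (sm_act _ _)).
by apply: eq_bigr => k _; rewrite liftK.
Qed.

Lemma degree_part_x m u z : deg m z -> deg m.+1 (sm_act (ch_x H u) z).
Proof.
move=> degz; rewrite (linear_basis (ch_x H)) (mact_suml smP).
apply: (subspace_sum _ (degree_part_linear _)) => j _; rewrite (mactZl smP).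
by apply: (subspaceZ _ (degree_part_linear _)); apply: degree_partS.
Qed.

Lemma degree_part0E z : deg 0 z -> exists v, z = sm_in M v.
Proof.
apply: (lin_span_min (S := fun z => exists v, z = sm_in M v)).
  split=> [|a u v [u' ->] [v' ->]]; first by exists 0; rewrite linear0.
  by exists (a *: u' + v'); rewrite linearP.
by move=> _ [i [v ->]]; exists v; rewrite big_ord0 (mact1 smP).
Qed.

Lemma degree_partSE m z : deg m.+1 z ->
  lin_span (fun z => exists j z', deg m z' /\ z = sm_act (x j) z') z.
Proof.
apply: lin_span_sub => _ [i [v ->]]; apply: lin_span_incl.
exists (i ord0), (sm_act (\prod_(k < m) x (i (lift ord0 k))) (sm_in M v)).
split; last by rewrite big_ord_recl (mactM smP).
by apply: lin_span_incl; exists (fun k => i (lift ord0 k)), v.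
Qed.

Lemma degree_part_w m g z : g \in W -> deg m z -> deg m (sm_act (ch_w H g) z).
Proof.
move=> Wg; elim: m z => [|m IHm] z.
  by move=> /degree_part0E[v ->]; rewrite sm_inW //; apply: degree_part0.
move=> /degree_partSE; apply: (lin_span_min (S := fun z => deg m.+1 (sm_act (ch_w H g) z))).
  split=> [|a u v du dv]; first by rewrite (mact0r smP); case: (degree_part_linear m.+1).
  by rewrite (mactP smP); case: (degree_part_linear m.+1) => _; apply.
move=> _ [j [z' [dz' ->]]]; rewrite -(mactM smP) (cr_wx (ch_rel H)) // (mactM smP).
by apply: degree_part_x; apply: IHm.
Qed.

Lemma degree_part_yx m v u z : deg m z ->
  deg m (sm_act (ch_y H v * ch_x H u - ch_x H u * ch_y H v) z).
Proof.
move=> dz; rewrite (cr_yx (ch_rel H)) (mactBl smP) (mactZl smP) (mact1 smP) (mact_suml smP).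
have lin := degree_part_linear m; apply: (subspaceD lin); first exact: subspaceZ.
apply: (subspaceN lin); apply: (subspace_sum _ lin) => k _.
rewrite (mactZl smP); apply: (subspaceZ _ lin).
by apply: degree_part_w => //; apply: rg_s_in.
Qed.

Lemma degree_part_y m v z : deg m z ->
  if m is m'.+1 then deg m' (sm_act (ch_y H v) z) else sm_act (ch_y H v) z = 0.
Proof.
elim: m z => [|m IHm] z; first by move=> /degree_part0E[u ->]; apply: sm_iny.
move=> /degree_partSE; have lin := degree_part_linear m.
apply: (lin_span_min (S := fun z => deg m (sm_act (ch_y H v) z))).
  split=> [|a u u' du du']; first by rewrite (mact0r smP); case: lin.
  by rewrite (mactP smP); case: lin => _; apply.
move=> _ [j [z' [dz' ->]]].
have -> : sm_act (ch_y H v) (sm_act (x j) z') = sm_act (x j) (sm_act (ch_y H v) z')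
    + sm_act (ch_y H v * x j - x j * ch_y H v) z'.
  by rewrite (mactBl smP) !(mactM smP) addrC subrK.
apply: (subspaceD lin); last exact: degree_part_yx.
case: m IHm lin dz' => [|m] IHm lin dz'; last by apply: degree_partS; apply: IHm.
by rewrite (IHm _ dz') (mact0r smP); case: lin.
Qed.

(** The sum of all degrees is a submodule. *)
Lemma degree_part_span : irreducible_module (@sm_act _ _ _ _ _ _ _ _ _ M) ->
  (exists v, sm_in M v != 0) ->
  forall z, lin_span (fun z => exists m, deg m z) z.
Proof.
move=> [_ irr] [v0 v0n]; set S := lin_span _.
have linS : linear_subspace S by apply: lin_span_linear.
have Sdeg m z : deg m z -> S z by move=> dz; apply: lin_span_incl; exists m.
have Sact h : (forall m z, deg m z -> S (sm_act h z)) -> forall z, S z -> S (sm_act h z).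
  move=> Sh z; apply: lin_span_map; first exact: (mactP smP).
  by move=> u [m /Sh].
apply: irr => //; last by exists (sm_in M v0) => //; apply: Sdeg (degree_part0 _).
apply: cherednik_ind => [z|a u u' Su Su' z Sz|u u' Su Su' z Sz|u|v|g Wg].
- by rewrite (mact1 smP).
- by rewrite (mactPl smP); case: linS => _; apply; [apply: Su | apply: Su'].
- by rewrite (mactM smP); apply/Su/Su'.
- by apply: Sact => m z dz; apply: Sdeg (degree_part_x _ dz).
- apply: Sact => -[|m] z /(degree_part_y v) dz; last exact: Sdeg dz.
  by rewrite dz; case: linS.
- by apply: Sact => m z dz; apply: Sdeg (degree_part_w Wg dz).
Qed.

End StandardModuleDegrees.

(** * Bidegrees and the diagonal action *)

Section KModule.

Variables (R : realType) (r : nat) (Phi : root_system R r).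
Variables (gT : finGroupType) (W : reflection_group Phi gT).
Variables (c : 'rV[R]_(nroots Phi)) (H : cherednik W c) (Cl : clifford R[i] r).
Variable A : tensor_algebra H Cl.
Variables (d : nat) (tau : mx_representation R[i] W d) (M : standard_module H tau).

Local Notation C := R[i].
Local Notation K := {ffun {set 'I_r} -> M}.
Variable act : A -> K -> K.
Hypothesis actK : K_action act.

Local Notation deg := (@degree_part R r Phi gT W c H d tau M).
Local Notation bideg := (@bidegree_part R r Phi gT W c H d tau M).
Local Notation aP := (ka_mod actK).
Local Notation smP := (sm_actP M).
Local Notation X i := (tx A (basis_vec C i)).
Local Notation Y i := (ty A (basis_vec C i)).
Local Notation xi i := (txi A (basis_vec C i)).
Local Notation eta i := (teta A (basis_vec C i)).

Lemma act_inl (h : H) (k : K) (S : {set 'I_r}) : act (ta_inl A h) k S = sm_act h (k S).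
Proof. by rewrite -(ka_H actK) /tens ta_inr1 mulr1. Qed.

Lemma act_xi i k : act (xi i) k = wedge i k.
Proof. by rewrite -(ka_x actK) /tens ta_inl1 mul1r. Qed.

Lemma act_eta i k : act (eta i) k = contract i k.
Proof. by rewrite -(ka_y actK) /tens ta_inl1 mul1r. Qed.

Lemma act_inl_single (h : H) (S : {set 'I_r}) z :
  act (ta_inl A h) (single S z) = single S (sm_act h z).
Proof.
by apply/ffunP => S'; rewrite act_inl !ffunE; case: eqP; rewrite // (mact0r smP).
Qed.

Lemma bidegree_linear m l : linear_subspace (bideg m l).
Proof.
have lin := degree_part_linear M m; split=> [S|a u v du dv S].
  by rewrite ffunE; case: eqP => //; case: lin.
have := du S; have := dv S; rewrite !ffunE; case: eqP => [_ v' u'|_ -> ->].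
  by case: lin => _; apply.
by rewrite scaler0 addr0.
Qed.

Lemma bidegree_single m (S : {set 'I_r}) z : deg m z -> bideg m #|S| (single S z).
Proof.
move=> dz S'; rewrite ffunE; have [->|nS] := eqVneq S' S; first by rewrite eqxx.
by case: eqP => // _; case: (degree_part_linear M m).
Qed.

Lemma bidegree_inl m m' l h k : (forall z, deg m z -> deg m' (sm_act h z)) ->
  bideg m l k -> bideg m' l (act (ta_inl A h) k).
Proof.
move=> dh dk S; rewrite act_inl; have := dk S; case: eqP => [_ /dh|_ ->] //.
by rewrite (mact0r smP).
Qed.

Lemma bidegree_x m l u k : bideg m l k -> bideg m.+1 l (act (tx A u) k).
Proof. by apply: bidegree_inl => z; apply: degree_part_x. Qed.

Lemma bidegree_y m l u k : bideg m.+1 l k -> bideg m l (act (ty A u) k).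
Proof. by apply: bidegree_inl => z; apply: (@degree_part_y _ _ _ _ _ _ _ _ _ _ m.+1). Qed.

Lemma bidegree_y0 l u k : bideg 0 l k -> act (ty A u) k = 0.
Proof.
move=> dk; apply/ffunP => S; rewrite act_inl ffunE; have := dk S.
by case: eqP => [_ /(degree_part_y u)|_ ->] //; rewrite (mact0r smP).
Qed.

Lemma bidegree_xi m l i k : bideg m l k -> bideg m l.+1 (act (xi i) k).
Proof.
move=> dk S; rewrite act_xi ffunE; have lin := degree_part_linear M m.
have [iS|iS] := boolP (i \in S); last by case: ifP => // _; case: lin.
have := dk (S :\ i)%SET; rewrite (cardsD1 i S) iS add1n eqSS.
by case: ifP => [_ dk'|_ ->]; [apply: (subspaceZ _ lin) | rewrite scaler0].
Qed.

Lemma bidegree_eta m l i k : bideg m l.+1 k -> bideg m l (act (eta i) k).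
Proof.
move=> dk S; rewrite act_eta ffunE; have lin := degree_part_linear M m.
have [iS|iS] := boolP (i \in S); first by case: ifP => // _; case: lin.
have := dk (i |: S)%SET; rewrite cardsU1 iS add1n eqSS.
by case: ifP => [_ dk'|_ ->]; [apply: (subspaceZ _ lin) | rewrite scaler0].
Qed.

Lemma bidegree_eta0 m i k : bideg m 0 k -> act (eta i) k = 0.
Proof.
move=> dk; apply/ffunP => S; rewrite act_eta !ffunE; have [//|iS] := boolP (i \in S).
by have := dk (i |: S)%SET; rewrite cardsU1 iS add1n => ->; rewrite scaler0.
Qed.

Lemma bidegree_top m l k : (r < l)%N -> bideg m l k -> k = 0.
Proof.
move=> rl dk; apply/ffunP => S; rewrite ffunE; have := dk S.
case: eqP => // Sl _; have := max_card (mem S); rewrite card_ord Sl.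
by rewrite leqNgt rl.
Qed.

Lemma bidegree_wedge_top m i k : bideg m r k -> act (xi i) k = 0.
Proof. by move=> /(bidegree_xi i); apply: bidegree_top. Qed.

Lemma K_span : irreducible_module (@sm_act _ _ _ _ _ _ _ _ _ M) ->
  (exists v, sm_in M v != 0) ->
  forall k, lin_span (fun k => exists j : nat * nat, bideg j.1 j.2 k) k.
Proof.
move=> irr nz k; rewrite [k]sum_single; apply: subspace_sum => [|S _].
  exact: lin_span_linear.
have := degree_part_span irr nz (k S); apply: lin_span_map.
  exact: single_linear.
by move=> z [m dz]; apply: lin_span_incl; exists (m, #|S|); apply: bidegree_single.
Qed.

Lemma act_gE2p k : act (gE2p A) k = \sum_i act (Y i) (act (xi i) k).
Proof. by rewrite (mact_suml aP); apply: eq_bigr => i _; apply: (mactM aP). Qed.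

Lemma act_gE2m k : act (gE2m A) k = \sum_i act (X i) (act (eta i) k).
Proof. by rewrite (mact_suml aP); apply: eq_bigr => i _; apply: (mactM aP). Qed.

Lemma act_gE3p k : act (gE3p A) k = - \sum_i act (X i) (act (xi i) k).
Proof.
by rewrite (mactNl aP) (mact_suml aP); congr (- _); apply: eq_bigr => i _; apply: (mactM aP).
Qed.

Lemma act_gE3m k : act (gE3m A) k = - \sum_i act (Y i) (act (eta i) k).
Proof.
by rewrite (mactNl aP) (mact_suml aP); congr (- _); apply: eq_bigr => i _; apply: (mactM aP).
Qed.

Lemma exterior_degreeE m l k : bideg m l k -> act (exterior_degree A) k = l%:R *: k.
Proof.
move=> dk; rewrite (mact_suml aP); apply/ffunP => S; rewrite sum_ffunE ffunE.
have E i : act (xi i * eta i) k S = if i \in S then k S else 0.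
  by rewrite (mactM aP) act_xi act_eta wedge_contract ffunE.
under eq_bigr => i _ do rewrite E.
rewrite -big_mkcond sumr_const; have := dk S.
by case: eqP => [->|_ ->]; rewrite scaler_nat ?mul0rn.
Qed.

Lemma act_gH Nt m l k : is_N_scalar c tau Nt -> bideg m l k ->
  act (gH A) k = (m%:R + r%:R / 2 - Nt) *: k.
Proof.
move=> NtE dk; have {dk} dk S : deg m (k S).
  by have := dk S; case: eqP => // _ ->; case: (degree_part_linear M m).
rewrite [k]sum_single (mact_sumr aP) scaler_sumr; apply: eq_bigr => S _.
move: (k S) (dk S) => {k dk}; elim: m => [|m IHm] z.
  move=> /degree_part0E[v ->].
  have lin : linear (fun v => single S (sm_in M v)).
    by move=> a u u'; rewrite linearP single_linear.
  pose f := linear_map lin; rewrite -[single S _]/(f v).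
  rewrite gH_euler (mactBl aP) (mactDl aP) (mactZl aP) (mact1 aP).
  rewrite (mact_suml aP) big1 => [|i _]; last first.
    rewrite (mactM aP) [act (Y i) _]act_inl_single sm_iny.
    by rewrite single0 (mact0r aP).
  rewrite !add0r scalerBl; congr (_ - _).
  transitivity (f (Nt%:M *m v)); last by rewrite mul_scalar_mx linearZ.
  rewrite -NtE (mact_suml aP) mulmx_suml linear_sum; apply: eq_bigr => k _.
  rewrite (mactZl aP) act_inl_single sm_inW ?rg_s_in //.
  by rewrite -scalemxAl linearZ.
move=> /degree_partSE; apply: (lin_span_min (S := fun z => act (gH A) (single S z) =
  (m.+1%:R + r%:R / 2 - Nt) *: single S z)).
  split=> [|a u v Eu Ev].
    by rewrite single0 scaler0 (mact0r aP).
  by rewrite single_linear (mactP aP) Eu Ev scalerDr !scalerA mulrC.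
move=> _ [j [z' [dz' ->]]]; rewrite -act_inl_single -/(X j).
rewrite (mact_commutator aP) gH_X IHm // (mactZr aP) -[E in _ + E]scale1r -scalerDl.
by congr (_ *: _); rewrite -[m.+1%:R]natr1 [LHS]addrAC; congr (_ - _); rewrite addrAC.
Qed.

Lemma tau_root_txi k u : ta_inr A (tau_root Cl k) * txi A u =
  txi A (hact W (rg_s W k) u) * ta_inr A (tau_root Cl k).
Proof.
rewrite hact_reflection_root /txi /= -!ta_inrM.
by rewrite -(clifford_reflection_x (two_neq0 R)).
Qed.

Lemma tau_root_teta k u : ta_inr A (tau_root Cl k) * teta A u =
  teta A (hact W (rg_s W k) u) * ta_inr A (tau_root Cl k).
Proof.
rewrite hact_reflection /teta /= -!ta_inrM.
by rewrite -(clifford_reflection_y (two_neq0 R)) // pairing_root_coroot.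
Qed.

(** Commutation with the generators [s_a (x) tau_a] of the diagonal action. *)
Definition W_commuting (Q : A) : Prop :=
  forall k, s_diag A k * Q = Q * s_diag A k.

Lemma s_diag_tx k u : s_diag A k * tx A u = tx A (hact W (rg_s W k) u) * s_diag A k.
Proof.
rewrite /s_diag /tens -mulrA -ta_comm !mulrA -/(tw A _) -/(tx A u).
by rewrite twx ?rg_s_in.
Qed.

Lemma s_diag_ty k u : s_diag A k * ty A u = ty A (hact W (rg_s W k) u) * s_diag A k.
Proof.
rewrite /s_diag /tens -mulrA -ta_comm !mulrA -/(tw A _) -/(ty A u).
by rewrite twy ?rg_s_in.
Qed.

Lemma s_diag_txi k u : s_diag A k * txi A u = txi A (hact W (rg_s W k) u) * s_diag A k.
Proof.
by rewrite /s_diag /tens -mulrA tau_root_txi !mulrA; congr (_ * _); rewrite ta_comm.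
Qed.

Lemma s_diag_teta k u :
  s_diag A k * teta A u = teta A (hact W (rg_s W k) u) * s_diag A k.
Proof.
by rewrite /s_diag /tens -mulrA tau_root_teta !mulrA; congr (_ * _); rewrite ta_comm.
Qed.

Lemma W_commutingN Q : W_commuting Q -> W_commuting (- Q).
Proof. by move=> cQ k; rewrite mulrN mulNr cQ. Qed.

Lemma W_commutingZ e Q : W_commuting Q -> W_commuting (e *: Q).
Proof. by move=> cQ k; rewrite -scalerAl -scalerAr cQ. Qed.

Lemma W_commuting_gE1p : W_commuting (gE1p A).
Proof.
rewrite gE1pE /raise1 -scaler_sumr; apply/W_commutingN/W_commutingZ => k.
by apply: (reflection_commutes_casimir (p := tx A) (q := tx A)); apply: s_diag_tx.
Qed.

Lemma W_commuting_gE1m : W_commuting (gE1m A).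
Proof.
rewrite gE1mE /lower1 -scaler_sumr; apply/W_commutingZ => k.
by apply: (reflection_commutes_casimir (p := ty A) (q := ty A)); apply: s_diag_ty.
Qed.

Lemma W_commuting_gE2p : W_commuting (gE2p A).
Proof.
by move=> k; apply: (reflection_commutes_casimir (p := ty A) (q := txi A));
  [apply: s_diag_ty | apply: s_diag_txi].
Qed.

Lemma W_commuting_gE2m : W_commuting (gE2m A).
Proof.
by move=> k; apply: (reflection_commutes_casimir (p := tx A) (q := teta A));
  [apply: s_diag_tx | apply: s_diag_teta].
Qed.

Lemma W_commuting_gE3p : W_commuting (gE3p A).
Proof.
apply: W_commutingN => k.
by apply: (reflection_commutes_casimir (p := tx A) (q := txi A));
  [apply: s_diag_tx | apply: s_diag_txi].
Qed.

Lemma W_commuting_gE3m : W_commuting (gE3m A).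
Proof.
apply: W_commutingN => k.
by apply: (reflection_commutes_casimir (p := ty A) (q := teta A));
  [apply: s_diag_ty | apply: s_diag_teta].
Qed.

Lemma W_commuting_gEp a : W_commuting (gEp A a).
Proof.
by case: a => [[]|]; [apply: W_commuting_gE3p | apply: W_commuting_gE2p
  | apply: W_commuting_gE1p].
Qed.

(** [T] implements [g] on the exterior algebra; fixing the vacuum pins down the
    sign that conjugation alone leaves free. *)
Record implements (g : gT) (T : Cl) : Prop := Implements {
  im_xi : forall u, ta_inr A T * txi A u = txi A (hact W g u) * ta_inr A T;
  im_vacuum : forall z, act (ta_inr A T) (single finset.set0 z) = single finset.set0 z;
  im_commute : forall Q, W_commuting Q ->
    (tw A g * ta_inr A T) * Q = Q * (tw A g * ta_inr A T);
  im_bideg : forall m l k, bideg m l k -> bideg m l (act (ta_inr A T) k)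
}.

Lemma act_txi u k : act (txi A u) k = \sum_i u i 0 *: wedge i k.
Proof.
rewrite (linear_basis (txi A)) (mact_suml aP); apply: eq_bigr => i _.
by rewrite (mactZl aP) act_xi.
Qed.

Lemma act_teta u k : act (teta A u) k = \sum_i u i 0 *: contract i k.
Proof.
rewrite (linear_basis (teta A)) (mact_suml aP); apply: eq_bigr => i _.
by rewrite (mactZl aP) act_eta.
Qed.

Lemma act_tau_root (k : 'I_(nroots Phi)) z : act (ta_inr A (tau_root Cl k)) z =
  z - act (txi A (croot k)) (act (teta A (ccoroot k)) z).
Proof. by rewrite /tau_root ta_inrB ta_inr1 ta_inrM (mactBl aP) (mact1 aP) (mactM aP). Qed.

Lemma bidegree_tau_root (k : 'I_(nroots Phi)) m l z : bideg m l z ->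
  bideg m l (act (ta_inr A (tau_root Cl k)) z).
Proof.
move=> dz; rewrite act_tau_root; have lin := bidegree_linear m l.
apply: (subspaceD lin) => //; apply: (subspaceN lin).
rewrite act_teta (mact_sumr aP); apply: (subspace_sum _ lin) => i _.
rewrite (mactZr aP); apply: (subspaceZ _ lin); rewrite act_txi.
apply: (subspace_sum _ lin) => j _; apply: (subspaceZ _ lin).
rewrite -act_xi -act_eta; case: l lin dz => [|l] lin dz.
  by rewrite (bidegree_eta0 _ dz) (mact0r aP); case: lin.
by apply: bidegree_xi; apply: bidegree_eta.
Qed.

Lemma tau_root_vacuum (k : 'I_(nroots Phi)) z :
  act (ta_inr A (tau_root Cl k)) (single finset.set0 z) = single finset.set0 z.
Proof.
rewrite act_tau_root act_teta big1 ?(mact0r aP) ?subr0 // => i _.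
have -> : contract i (single finset.set0 z) = 0; last exact: scaler0.
apply/ffunP => S; rewrite !ffunE; case: ifP => // iS.
case: eqP => [E|_]; last exact: scaler0.
by have := setU11 i S; rewrite E inE.
Qed.

Lemma implements_exists g : g \in W -> exists T, implements g T.
Proof.
move: g; apply: reflection_group_ind => [|k g Wg [T [T1 T2 T3 T4]]].
  exists 1; rewrite /tw; split=> [u|z|Q _|m l k dk].
  - by rewrite ta_inr1 hact1 mul1r mulr1.
  - by rewrite ta_inr1 (mact1 aP).
  - by rewrite ta_inr1 mulr1 -/(tw A 1%g) tw1 mul1r mulr1.
  - by rewrite ta_inr1 (mact1 aP).
exists (tau_root Cl k * T); split=> [u|z|Q cQ|m l z dz].
- by rewrite ta_inrM -mulrA T1 mulrA tau_root_txi hactM ?rg_s_in // mulrA.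
- by rewrite ta_inrM (mactM aP) T2 tau_root_vacuum.
- have -> : tw A (rg_s W k * g)%g * ta_inr A (tau_root Cl k * T) =
      s_diag A k * (tw A g * ta_inr A T).
    rewrite twM ?rg_s_in // ta_inrM /s_diag /tens !mulrA; congr (_ * _).
    by rewrite -!mulrA ta_comm.
  by rewrite -[LHS]mulrA T3 // [LHS]mulrA cQ // !mulrA.
by rewrite ta_inrM (mactM aP); apply: bidegree_tau_root; apply: T4.
Qed.

(** The vacuum generates the exterior algebra under the [xi i]. *)
Lemma implements_unique g T T' : implements g T -> implements g T' ->
  forall k, act (ta_inr A T) k = act (ta_inr A T') k.
Proof.
move=> iT iT' k; rewrite [k]sum_single !(mact_sumr aP); apply: eq_bigr => S _.
move: (k S) => {k} z; have [n] := ubnP #|S|; elim: n S => // n IHn S Sn.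
have [->|/finset.set0Pn[i iS]] := eqVneq S finset.set0.
  by rewrite (im_vacuum iT) (im_vacuum iT').
have -> : single S z = ext_sign C i S *: act (txi A (basis_vec C i)) (single (S :\ i)%SET z).
  by rewrite act_xi wedge_single // scalerA ext_sign_sqr scale1r.
rewrite !(mactZr aP) -!(mactM aP) (im_xi iT) (im_xi iT') !(mactM aP) IHn //.
by have := Sn; rewrite (cardsD1 i) iS add1n ltnS.
Qed.

(** The [tau_a] extend from reflections to [W] because the implementer of [g] is
    unique on [K]: the implementers of [g] and [g'] compose to that of [g g']. *)
Lemma diagonal_action : exists D : gT -> K -> K,
  [/\ forall g, g \in W -> linear (D g),
      forall k, D 1%g k = k,
      forall g g' k, g \in W -> g' \in W -> D (g * g')%g k = D g (D g' k),
      forall i k, D (rg_s W i) k = act (s_diag A i) k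
    & forall g Q k, g \in W -> W_commuting Q -> D g (act Q k) = act Q (D g k)] /\
  forall g m l k, g \in W -> bideg m l k -> bideg m l (D g k).
Proof.
have ex g : exists T, g \in W -> implements g T.
  have [Wg|nWg] := boolP (g \in W); last by exists 0.
  by have [T iT] := implements_exists Wg; exists T.
have [T TP] := choice ex.
exists (fun g k => act (tw A g * ta_inr A (T g)) k); split; first split.
- by move=> g _; apply: mactP aP _.
- move=> k; rewrite (mactM aP) tw1 (mact1 aP).
  rewrite (@implements_unique 1%g _ 1 (TP _ (group1 _))) ?ta_inr1 ?(mact1 aP) //.
  split=> [u|z|Q _|m l z]; rewrite ?ta_inr1 ?(mact1 aP) //.
    by rewrite hact1 mul1r mulr1.
  by rewrite tw1 !mul1r mulr1.
- move=> g g' k Wg Wg'; rewrite -(mactM aP) twM //.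
  have -> : tw A g * ta_inr A (T g) * (tw A g' * ta_inr A (T g')) =
      tw A g * tw A g' * ta_inr A (T g * T g').
    by rewrite ta_inrM !mulrA; congr (_ * _); rewrite -!mulrA ta_comm.
  rewrite !(mactM aP (tw A g * _)); congr (act _ _).
  apply: (implements_unique (TP _ (groupM Wg Wg'))).
  have [T1 T2 T3 T4] := TP _ Wg; have [T1' T2' T3' T4'] := TP _ Wg'.
  split=> [u|z|Q cQ|m l z dz].
  + by rewrite ta_inrM -mulrA T1' mulrA T1 hactM // mulrA.
  + by rewrite ta_inrM (mactM aP) T2' T2.
  + have -> : tw A (g * g')%g * ta_inr A (T g * T g') =
        tw A g * ta_inr A (T g) * (tw A g' * ta_inr A (T g')).
      rewrite twM // ta_inrM !mulrA; congr (_ * _).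
      by rewrite -!mulrA ta_comm.
    by rewrite -[LHS]mulrA T3' // [LHS]mulrA T3 // !mulrA.
  + by rewrite ta_inrM (mactM aP); apply/T4/T4'.
- move=> i k; rewrite /s_diag /tens !(mactM aP); congr (act _ _).
  apply: (implements_unique (TP _ (rg_s_in W i))).
  split=> [u|z|Q cQ|m l z].
  + exact: tau_root_txi.
  + exact: tau_root_vacuum.
  + exact: cQ.
  + exact: bidegree_tau_root.
- by move=> g Q k Wg cQ; rewrite -!(mactM aP) (im_commute (TP _ Wg)).
move=> g m l k Wg dk; rewrite (mactM aP); apply: bidegree_inl.
  by move=> z; apply: degree_part_w.
exact: (im_bideg (TP _ Wg)).
Qed.

End KModule.

(** * Isotypic projections *)

Section IsotypicProjections.

Variables (F : closedFieldType) (gT : finGroupType) (G : {group gT}).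
Hypothesis pchar0 : [pchar F] =i pred0.
Variable sG : irrType F G.

Lemma pchar'G : ([pchar F]^'.-group G)%g.
Proof. by apply/pgroupP => p _ _; rewrite inE /= pchar0. Qed.

Lemma intertwiner_irr_eq0 (i j : sG) (B : 'M[F]_(irr_degree i, irr_degree j)) :
  i != j -> (forall g, g \in G -> irr_repr i g *m B = B *m irr_repr j g) -> B = 0.
Proof.
move=> ij homB; apply/eqP; apply: contraNT ij => B0; apply/socle_rsimP.
have /mx_irrP[ni irri] := socle_irr i; have /mx_irrP[nj irrj] := socle_irr j.
have freeB : row_free B.
  rewrite -kermx_eq0; apply: contraNT B0 => ker0.
  have /irri/(_ ker0) : mxmodule (irr_repr i) (kermx B).
    by apply/mxmoduleP => g Gg; apply/sub_kermxP; rewrite -mulmxA homB // mulmxA mulmx_ker mul0mx.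
  move/row_fullP => [D DK]; apply/eqP.
  by rewrite -[B]mul1mx -DK -mulmxA mulmx_ker mulmx0.
have fullB : row_full B.
  rewrite /row_full -genmxE; apply: irrj; last by rewrite -mxrank_eq0 genmxE mxrank_eq0.
  rewrite (eqmx_module _ (genmxE _)); apply/mxmoduleP => g Gg.
  by rewrite -homB // submxMl.
apply: (@MxReprSim _ _ _ _ _ _ _ B) => //.
by rewrite -(eqP fullB); symmetry; apply/eqP.
Qed.

Lemma average_intertwines n1 n2 (r1 : mx_representation F G n1)
    (r2 : mx_representation F G n2) (B : 'M[F]_(n1, n2)) h : h \in G ->
  r1 h *m (\sum_(g in G) r1 g^-1%g *m B *m r2 g) =
  (\sum_(g in G) r1 g^-1%g *m B *m r2 g) *m r2 h.
Proof.
move=> Gh; rewrite mulmx_sumr mulmx_suml.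
rewrite (reindex_inj (mulIg h)) /=; apply: eq_big => [g|g Gg]; first by rewrite groupMr.
rewrite groupMr // in Gg; rewrite invMg (repr_mxM _ Gg Gh) !mulmxA.
by rewrite -repr_mxM ?groupM ?groupV // mulKVg.
Qed.

Lemma mul_delta_mulE n1 n2 (P : 'M[F]_n1) (Q : 'M[F]_n2) a k b l :
  (P *m delta_mx a k *m Q) b l = P b a * Q k l.
Proof.
rewrite mxE (bigD1 k) //= big1 => [|k' /negbTE kk'].
  rewrite addr0 mxE (bigD1 a) //= big1 => [|a' /negbTE aa'].
    by rewrite addr0 mxE !eqxx mulr1.
  by rewrite mxE aa' mulr0.
by rewrite mxE big1 ?mul0r // => a' _; rewrite mxE kk' andbF mulr0.
Qed.

(** Schur orthogonality of characters against matrix coefficients. *)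
Lemma character_average_eq0 (i j : sG) : i != j ->
  \sum_(g in G) \tr (irr_repr i g^-1%g) *: irr_repr j g = 0.
Proof.
move=> ij; pose P (B : 'M[F]_(irr_degree i, irr_degree j)) :=
  \sum_(g in G) irr_repr i g^-1%g *m B *m irr_repr j g.
have P0 B : P B = 0.
  by apply: (intertwiner_irr_eq0 ij) => h Gh; apply: average_intertwines.
apply/matrixP => k l; rewrite summxE mxE.
transitivity (\sum_a P (delta_mx a k) a l); last first.
  by rewrite big1 // => a _; rewrite P0 mxE.
under [RHS]eq_bigr => a _ do rewrite summxE.
rewrite exchange_big; apply: eq_bigr => g _ /=.
under [RHS]eq_bigr => a _ do rewrite mul_delta_mulE.
by rewrite -mulr_suml [LHS]mxE.
Qed.

Lemma regular_trace g : g \in G -> \tr (regular_repr F G g) = #|G|%:R * (g == 1%g)%:R.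
Proof.
move=> Gg; rewrite /mxtrace.
transitivity (\sum_(i < #|G|) (g == 1%g)%:R : F); last first.
  by rewrite sumr_const card_ord mulr_natl.
apply: eq_bigr => i _; rewrite mxE !mxE eqxx /=; congr (_%:R).
have Gi := enum_valP i; congr nat_of_bool; apply/idP/idP => /eqP E; last first.
  by rewrite E mulg1 gring_valK.
have : enum_val i = (enum_val i * g)%g by rewrite {1}E gring_indexK // groupM.
by rewrite -{1}[enum_val i]mulg1 => /mulgI <-.
Qed.

Lemma sum_character g : g \in G ->
  \sum_(i : sG) (irr_degree i)%:R * \tr (irr_repr i g) = #|G|%:R * (g == 1%g)%:R :> F.
Proof.
move=> Gg; rewrite -regular_trace // (mxtrace_regular_pchar sG pchar'G) //.
  by apply: eq_bigr => i _; rewrite mulr_natl.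
exact: group_closure_closed_field.
Qed.

Variables (V : lmodType F) (D : gT -> V -> V).
Hypotheses (Dlin : forall g, g \in G -> linear (D g)) (D1 : forall v, D 1%g v = v)
  (DM : forall g h v, g \in G -> h \in G -> D (g * h)%g v = D g (D h v)).

Definition isotypic_proj (i : sG) (v : V) : V :=
  \sum_(g in G) ((irr_degree i)%:R / #|G|%:R * \tr (irr_repr i g^-1%g)) *: D g v.

Lemma isotypic_proj_linear i : linear (isotypic_proj i).
Proof.
move=> a u v; rewrite /isotypic_proj scaler_sumr -big_split; apply: eq_bigr => g Gg /=.
by rewrite Dlin // scalerDr !scalerA mulrC.
Qed.

Lemma card_group_neq0 : #|G|%:R != 0 :> F.
Proof. by rewrite (pcharf0P F).1 // -lt0n cardG_gt0. Qed.

(** The characters, weighted by the degrees, add up to the regular character. *)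
Lemma sum_isotypic_proj v : \sum_i isotypic_proj i v = v.
Proof.
rewrite exchange_big /=.
transitivity (\sum_(g in G) (g == 1%g)%:R *: D g v).
  apply: eq_bigr => g Gg; rewrite -scaler_suml; congr (_ *: _).
  transitivity (#|G|%:R^-1 * \sum_(i : sG) (irr_degree i)%:R * \tr (irr_repr i g^-1%g)).
    by rewrite mulr_sumr; apply: eq_bigr => i _; rewrite mulrA [_ / _]mulrC.
  by rewrite sum_character ?groupV // mulKf ?card_group_neq0 // eq_invg1.
rewrite (bigD1 1%g) ?group1 //= eqxx scale1r D1 big1 ?addr0 // => g /andP[_ /negbTE ->].
by rewrite scale0r.
Qed.

(** The span of these vectors is the isotypic component of [i]. *)
Definition in_equivariant_image (i : sG) (v : V) : Prop :=
  exists (f : {linear 'cV[F]_(irr_degree i) -> V}) (u : 'cV[F]_(irr_degree i)),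
    v = f u /\ forall g u', g \in G -> f (irr_repr i g *m u') = D g (f u').

Lemma isotypic_proj_other i j v : i != j -> in_equivariant_image j v ->
  isotypic_proj i v = 0.
Proof.
move=> ij [f [u [-> fD]]].
transitivity (f (((irr_degree i)%:R / #|G|%:R) *:
    (\sum_(g in G) \tr (irr_repr i g^-1%g) *: irr_repr j g) *m u)).
  rewrite scaler_sumr mulmx_suml linear_sum; apply: eq_bigr => g Gg.
  by rewrite scalerA -scalemxAl linearZ fD.
by rewrite character_average_eq0 // scaler0 mul0mx linear0.
Qed.

(** Writing the trace as a sum of diagonal coefficients [a] splits the projection
    into the values at the basis vectors of maps [f0 a], which are equivariant. *)
Lemma isotypic_proj_image i v : lin_span (in_equivariant_image i) (isotypic_proj i v).
Proof.
pose f0 (a : 'I_(irr_degree i)) (u : 'cV[F]_(irr_degree i)) : V :=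
  \sum_(g in G) (irr_repr i g^-1%g *m u) a 0 *: D g v.
have f0lin a : linear (f0 a).
  move=> e u u'; rewrite /f0 scaler_sumr -big_split; apply: eq_bigr => g _ /=.
  by rewrite mulmxDr -scalemxAr !mxE scalerDl scalerA.
have f0D a h u : h \in G -> f0 a (irr_repr i h *m u) = D h (f0 a u).
  move=> Gh; have linD := linear_map (Dlin Gh).
  rewrite /f0 (reindex_inj (mulgI h)) /=.
  have -> : D h (\sum_(g in G) (irr_repr i g^-1%g *m u) a 0 *: D g v) =
      \sum_(g in G) (irr_repr i g^-1%g *m u) a 0 *: D h (D g v).
    rewrite -[D h]/(linear_map (Dlin Gh) : V -> V) linear_sum.
    by apply: eq_bigr => g _; rewrite linearZ.
  apply: eq_big => [g|g]; first by rewrite groupMl.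
  rewrite groupMl // => Gg; rewrite DM // mulmxA -repr_mxM ?groupV ?groupM //.
  by rewrite invMg mulgKV.
have -> : isotypic_proj i v = \sum_a ((irr_degree i)%:R / #|G|%:R) *: f0 a (delta_mx a 0).
  rewrite -scaler_sumr exchange_big scaler_sumr; apply: eq_bigr => g Gg /=.
  rewrite -scaler_suml scalerA; congr ((_ * _) *: _).
  by apply: eq_bigr => a _; rewrite -colE [RHS]mxE.
apply: subspace_sum => // a _.
apply: subspaceZ => //.
apply: lin_span_incl; exists (linear_map (f0lin a)), (delta_mx a 0); split=> // g u' Gg.
exact: f0D.
Qed.

End IsotypicProjections.

(** * The anti-involution *)

Section Star.

Variables (R : realType) (r : nat) (Phi : root_system R r).
Variables (gT : finGroupType) (W : reflection_group Phi gT).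
Variables (c : 'rV[R]_(nroots Phi)) (H : cherednik W c) (Cl : clifford R[i] r).
Variables (A : tensor_algebra H Cl) (star : A -> A).
Hypothesis starP : antilinear_involution star.

Local Notation C := R[i].
Local Notation X i := (tx A (basis_vec C i)).
Local Notation Y i := (ty A (basis_vec C i)).
Local Notation xi i := (txi A (basis_vec C i)).
Local Notation eta i := (teta A (basis_vec C i)).

Lemma star0 : star 0 = 0.
Proof.
have := st_lin starP (-1) 0 0.
by rewrite scaler0 addr0 rmorphN1 scaleN1r addNr.
Qed.

Lemma starD u v : star (u + v) = star u + star v.
Proof. by have := st_lin starP 1 u v; rewrite rmorph1 !scale1r. Qed.

Lemma starZ a u : star (a *: u) = a^*%R *: star u.
Proof. by have := st_lin starP a u 0; rewrite star0 !addr0. Qed.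

Lemma starN u : star (- u) = - star u.
Proof. by rewrite -[- u]scaleN1r starZ rmorphN1 scaleN1r. Qed.

Lemma star_sum (I : Type) (s : seq I) (p : pred I) (f : I -> A) :
  star (\sum_(i <- s | p i) f i) = \sum_(i <- s | p i) star (f i).
Proof. exact: (big_morph star starD star0). Qed.

Lemma starM u v : star (u * v) = star v * star u. Proof. exact: st_anti. Qed.
Lemma starK : involutive star. Proof. exact: st_inv starP. Qed.

Lemma star1 : star 1 = 1.
Proof. by have := starM (star 1) 1; rewrite mulr1 starK mulr1. Qed.

Lemma star_X i : star (X i) = Y i.
Proof. by have := st_x starP i; rewrite /tens ta_inr1 !mulr1. Qed.

Lemma star_Y i : star (Y i) = X i.
Proof. by have := st_y starP i; rewrite /tens ta_inr1 !mulr1. Qed.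

Lemma star_xi i : star (xi i) = eta i.
Proof. by have := st_xc starP i; rewrite /tens ta_inl1 !mul1r. Qed.

Lemma star_eta i : star (eta i) = xi i.
Proof. by have := st_yc starP i; rewrite /tens ta_inl1 !mul1r. Qed.

Lemma star_tw k : star (tw A (rg_s W k)) = tw A (rg_s W k).
Proof. by have := st_s starP k; rewrite /tens ta_inr1 !mulr1. Qed.

Lemma conj_half : ((2^-1 : C)^*%R = 2^-1)%R.
Proof. by rewrite fmorphV rmorph_nat. Qed.

Lemma star_gE1p : star (gE1p A) = - gE1m A.
Proof.
rewrite /gE1p /gE1m starN star_sum; congr (- _); apply: eq_bigr => i _.
rewrite /tens ta_inr1 !mulr1 !ta_inlZ !expr2 !ta_inlM -/(X i) -/(Y i).
by rewrite starZ starM star_X conj_half.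
Qed.

Lemma star_gE1m : star (gE1m A) = - gE1p A.
Proof. by rewrite -[LHS]opprK -starN -star_gE1p starK. Qed.

Lemma star_gE2p : star (gE2p A) = gE2m A.
Proof.
rewrite star_sum; apply: eq_bigr => i _; rewrite /tens -/(X i) -/(Y i) -/(xi i) -/(eta i).
by rewrite starM star_Y star_xi teta_tx.
Qed.

Lemma star_gE2m : star (gE2m A) = gE2p A.
Proof. by rewrite -star_gE2p starK. Qed.

Lemma star_gE3p : star (gE3p A) = gE3m A.
Proof.
rewrite starN star_sum; congr (- _); apply: eq_bigr => i _.
by rewrite /tens -/(X i) -/(Y i) -/(xi i) -/(eta i) starM star_X star_xi teta_ty.
Qed.

Lemma star_gE3m : star (gE3m A) = gE3p A.
Proof. by rewrite -star_gE3p starK. Qed.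

Lemma star_anticommutator u v :
  star (anticommutator u v) = anticommutator (star v) (star u).
Proof. by rewrite /anticommutator starD !starM. Qed.

Lemma star_commutator u v : star (commutator u v) = commutator (star v) (star u).
Proof. by rewrite /commutator starD starN !starM. Qed.

Lemma star_gH : star (gH A) = gH A.
Proof.
have E : gH A = - commutator (gE1m A) (gE1p A) by rewrite gE1m_gE1p opprK.
by rewrite E starN star_commutator star_gE1p star_gE1m commutatorNl commutatorNr opprK.
Qed.

Lemma star_gZ : star (gZ A) = gZ A.
Proof.
have E : gZ A = anticommutator (gE2m A) (gE2p A) - gH A.
  by rewrite gE2m_gE2p addrC addKr.
by rewrite E starD starN star_gH star_anticommutator star_gE2p star_gE2m.
Qed.

Lemma star_exterior_degree : star (exterior_degree A) = exterior_degree A.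
Proof.
by rewrite star_sum; apply: eq_bigr => i _; rewrite starM star_xi star_eta.
Qed.

Lemma star_in_g p u : in_g p u -> in_g p (star u).
Proof.
have lin := in_g_linear A p.
apply: (lin_span_min (S := fun u => in_g p (star u))).
  split=> [|a v w gv gw]; first by rewrite star0; case: lin.
  by rewrite (st_lin starP); case: lin => _; apply.
move=> v; case: p lin => lin; rewrite !inE => /or4P[] /eqP ->;
  rewrite ?(star_gE2p, star_gE2m, star_gE3p, star_gE3m)
    ?(star_gH, star_gZ, star_gE1p, star_gE1m);
  first [ by apply: lin_span_incl; rewrite !inE eqxx ?orbT
        | by apply: (subspaceN lin); apply: lin_span_incl; rewrite !inE eqxx ?orbT ].
Qed.

(** The anti-involution is given on all of [A]; it restricts to [H (x) 1] since it
    exchanges generators of [H], and this makes it preserve parity. *)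
Lemma star_inl a : exists a', star (ta_inl A a) = ta_inl A a'.
Proof.
have basis (p : {linear 'cV[C]_r -> H}) : (forall i, exists a',
    star (ta_inl A (p (basis_vec C i))) = ta_inl A a') ->
    forall u, exists a', star (ta_inl A (p u)) = ta_inl A a'.
  move=> pP u; have [q qE] := choice pP.
  exists (\sum_i (u i 0)^*%R *: q i); rewrite linear_basis !ta_inl_sum star_sum.
  by apply: eq_bigr => i _; rewrite !ta_inlZ starZ qE.
elim/(@cherednik_ind _ _ _ _ _ _ H): a => [|e u v [u' Eu] [v' Ev]|u v [u' Eu] [v' Ev]|||g].
- by exists 1; rewrite ta_inl1 star1.
- exists (e^*%R *: u' + v'); rewrite !ta_inlD !ta_inlZ starD starZ.
  by rewrite Eu Ev.
- by exists (v' * u'); rewrite !ta_inlM starM Eu Ev.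
- by apply: basis => i; exists (ch_y H (basis_vec C i)); apply: star_X.
- by apply: basis => i; exists (ch_x H (basis_vec C i)); apply: star_Y.
move: g; apply: reflection_group_ind => [|k g Wg [a Ea]].
  by exists 1; rewrite -/(tw A 1%g) tw1 star1 ta_inl1.
exists (a * ch_w H (rg_s W k)); rewrite -/(tw A _) twM ?rg_s_in //.
by rewrite starM star_tw [star (tw A g)]Ea ta_inlM.
Qed.

(** * The contravariant form on K *)

Section Form.

Variables (d : nat) (tau : mx_representation C W d) (M : standard_module H tau).
Local Notation K := {ffun {set 'I_r} -> M}.
Variables (act : A -> K -> K) (b0 : 'cV[C]_d -> 'cV[C]_d -> C) (beta : M -> M -> C).
Hypotheses (actK : K_action act) (contra : contravariant_form b0 beta)
  (pos_beta : positive_definite_on (fun _ => True) beta).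

Local Notation aP := (ka_mod actK).
Local Notation smP := (sm_actP M).
Local Notation herm_beta := (cf_herm contra).
Local Notation form := (@K_form R r Phi gT W c H d tau M beta).
Local Notation bideg := (@bidegree_part R r Phi gT W c H d tau M).
Local Notation deg := (@degree_part R r Phi gT W c H d tau M).
Local Notation inG p := (@in_g R r Phi gT W c H Cl A p).
Local Notation word := (seq (option bool)).

Lemma form_hermitian : hermitian_form form.
Proof.
split=> [a u u' v|u v].
  rewrite /K_form mulr_sumr -big_split; apply: eq_bigr => S _ /=.
  by rewrite !ffunE (hermDl herm_beta) (hermZl herm_beta).
rewrite /K_form rmorph_sum; apply: eq_bigr => S _.
by case: herm_beta.
Qed.

Lemma form_positive : positive_definite_on (fun _ => True) form.
Proof.
have ge0 z : 0 <= beta z z.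
  have [->|z0] := eqVneq z 0; first by rewrite (herm0l herm_beta).
  exact: ltW (pos_beta _ z0).
move=> k _ k0; rewrite lt_neqAle sumr_ge0 // andbT eq_sym.
apply: contraNN k0 => /eqP sum0; apply/eqP/ffunP => S; rewrite ffunE.
apply: (herm_definite pos_beta).
by apply: (psumr_eq0P (F := fun S => beta (k S) (k S)) _ sum0).
Qed.

Definition adjointable (u : A) : Prop :=
  forall k k', form (act u k) k' = form k (act (star u) k').

Lemma adjointable_linear : linear_subspace adjointable.
Proof.
split=> [k k'|a u v Au Av k k'].
  by rewrite star0 !(mact0l aP) (herm0l form_hermitian) (herm0r form_hermitian).
rewrite (st_lin starP) !(mactPl aP) (hermDl form_hermitian) (hermDr form_hermitian).
by rewrite (hermZl form_hermitian) (hermZr form_hermitian) conjCK Au Av.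
Qed.

Lemma adjointableM u v : adjointable u -> adjointable v -> adjointable (u * v).
Proof. by move=> Au Av k k'; rewrite starM !(mactM aP) Au Av. Qed.

Lemma adjointable1 : adjointable 1.
Proof. by move=> k k'; rewrite star1 !(mact1 aP). Qed.

Lemma adjointable_star u : adjointable u -> adjointable (star u).
Proof.
move=> Au k k'; rewrite starK; have [_ sym] := form_hermitian.
by rewrite (sym k' (act (star u) k)) -Au -sym.
Qed.

Lemma adjointable_Y i : adjointable (Y i).
Proof.
move=> k k'; rewrite star_Y; apply: eq_bigr => S _.
rewrite !(act_inl actK) (cf_y contra); congr (beta _ (sm_act (ch_x H _) _)).
by apply/colP => j; rewrite !mxE rmorph_nat.
Qed.

Lemma adjointable_X i : adjointable (X i).
Proof. by rewrite -star_Y; apply/adjointable_star/adjointable_Y. Qed.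

Lemma adjointable_xi i : adjointable (xi i).
Proof.
move=> k k'; rewrite star_xi (act_xi actK) (act_eta actK) /K_form.
rewrite (bigID (fun S : {set 'I_r} => i \in S)) /= [E in _ + E]big1 ?addr0; last first.
  by move=> S /negbTE iS; rewrite ffunE iS (herm0l herm_beta).
rewrite [RHS](bigID (fun S : {set 'I_r} => i \in S)) /= [E in E + _]big1 ?add0r; last first.
  by move=> S iS; rewrite ffunE iS (herm0r herm_beta).
rewrite (reindex_onto (fun S : {set 'I_r} => i |: S)%SET (fun S => S :\ i)%SET) /=; last first.
  by move=> S iS; rewrite finset.setD1K.
apply: eq_big => [S|S /andP[_ /eqP E]].
  rewrite setU11 /=; apply/eqP/idP => [<-|iS]; first by rewrite finset.setD11.
  by rewrite setU1K.
have iS : i \notin S by rewrite -E finset.setD11.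
rewrite !ffunE setU11 (negbTE iS) E (hermZl herm_beta) (hermZr herm_beta).
by rewrite -(ext_signD1 _ i (i |: S)%SET) E rmorph_sign.
Qed.

Lemma adjointable_eta i : adjointable (eta i).
Proof. by rewrite -star_xi; apply/adjointable_star/adjointable_xi. Qed.

Lemma adjointable_tw k : adjointable (tw A (rg_s W k)).
Proof.
move=> u v; rewrite star_tw; apply: eq_bigr => S _; rewrite !(act_inl actK).
rewrite -[LHS](cf_W contra _ _ (rg_s_in W k)) -(mactM smP).
rewrite -(cr_wM (ch_rel H)) ?rg_s_in // reflection_involutive (cr_w1 (ch_rel H)).
by rewrite (mact1 smP).
Qed.

Lemma adjointable_inl a : adjointable (ta_inl A a).
Proof.
have basis (p : {linear 'cV[C]_r -> H}) : (forall i,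
    adjointable (ta_inl A (p (basis_vec C i)))) ->
    forall u, adjointable (ta_inl A (p u)).
  move=> pP u; rewrite linear_basis ta_inl_sum.
  apply: (subspace_sum _ adjointable_linear) => i _.
  by rewrite ta_inlZ; apply: (subspaceZ _ adjointable_linear).
elim/(@cherednik_ind _ _ _ _ _ _ H): a => [|e u v Au Av|u v Au Av|||g].
- by rewrite ta_inl1; apply: adjointable1.
- by rewrite ta_inlD ta_inlZ; case: adjointable_linear => _; apply.
- by rewrite ta_inlM; apply: adjointableM.
- exact: basis adjointable_X.
- exact: basis adjointable_Y.
move: g; apply: reflection_group_ind => [|k g Wg Ag].
  by rewrite -/(tw A 1%g) tw1; apply: adjointable1.
by rewrite -/(tw A _) twM ?rg_s_in //; apply: adjointableM => //; apply: adjointable_tw.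
Qed.

Lemma adjointable_clifford v : adjointable (ta_inr A (cl_in Cl v)).
Proof.
have lin := adjointable_linear; rewrite cl_in_split ta_inrD.
apply: (subspaceD lin).
  have -> : ta_inr A (cl_y Cl v.1) = teta A v.1 by [].
  rewrite (linear_basis (teta A)); apply: (subspace_sum _ lin) => i _.
  by apply: (subspaceZ _ lin); apply: adjointable_eta.
have -> : ta_inr A (cl_x Cl v.2) = txi A v.2 by [].
rewrite (linear_basis (txi A)); apply: (subspace_sum _ lin) => i _.
by apply: (subspaceZ _ lin); apply: adjointable_xi.
Qed.

Lemma adjointable_gEp a : adjointable (gEp A a).
Proof.
have lin := adjointable_linear.
case: a => [[]|] /=.
- apply: (subspaceN lin); apply: (subspace_sum _ lin) => i _.
  by apply: adjointableM; [apply: adjointable_X | apply: adjointable_xi].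
- apply: (subspace_sum _ lin) => i _.
  by apply: adjointableM; [apply: adjointable_Y | apply: adjointable_xi].
rewrite gE1pE; apply: (subspaceN lin); apply: (subspace_sum _ lin) => i _.
apply: (subspaceZ _ lin); rewrite expr2.
by apply: adjointableM; apply: adjointable_X.
Qed.

Lemma adjointable_gH : adjointable (gH A).
Proof.
have lin := adjointable_linear; rewrite gHE; apply: (subspace_sum _ lin) => i _.
apply: (subspaceZ _ lin); apply: (subspaceD lin); apply: adjointableM;
  by [apply: adjointable_X | apply: adjointable_Y].
Qed.

Lemma adjointable_exterior_degree : adjointable (exterior_degree A).
Proof.
apply: (subspace_sum _ adjointable_linear) => i _.
by apply: adjointableM; [apply: adjointable_xi | apply: adjointable_eta].
Qed.

(** Eigenvalues of a self-adjoint operator are real. *)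
Lemma selfadjoint_orthogonal u (a b : C) k k' : adjointable u -> star u = u ->
  a != b -> act u k = a *: k -> act u k' = b *: k' -> form k k' = 0.
Proof.
move=> Au su ab uk uk'.
have real e z : z != 0 -> act u z = e *: z -> e^*%R = e.
  move=> z0 uz; have := Au z z; rewrite su uz (hermZl form_hermitian) (hermZr form_hermitian).
  have fz : form z z != 0 by apply: contraNneq z0 => /(herm_definite form_positive)/eqP.
  by move/(mulIf fz).
have [->|k0] := eqVneq k 0; first exact: herm0l form_hermitian _.
have [->|k'0] := eqVneq k' 0; first exact: herm0r form_hermitian _.
have := Au k k'; rewrite su uk uk' (hermZl form_hermitian) (hermZr form_hermitian).
rewrite (real b k') // => /eqP; rewrite -subr_eq0 -mulrBl mulf_eq0 subr_eq0 (negbTE ab).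
by move/eqP.
Qed.

Definition gEm (a : option bool) : A :=
  match a with None => - gE1m A | Some false => gE2m A | Some true => gE3m A end.

Lemma star_gEp a : star (gEp A a) = gEm a.
Proof.
by case: a => [[]|] /=; [apply: star_gE3p | apply: star_gE2p | apply: star_gE1p].
Qed.

Lemma gEm_in a : in_g (isSome a) (gEm a).
Proof.
case: a => [[]|] /=; try by apply: lin_span_incl; rewrite !inE eqxx ?orbT.
apply: (subspaceN (in_g_linear A false)); apply: lin_span_incl.
by rewrite !inE eqxx ?orbT.
Qed.

Lemma gEp_gEm_adjoint a k k' : form (act (gEp A a) k) k' = form k (act (gEm a) k').
Proof. by rewrite adjointable_gEp star_gEp. Qed.

Lemma killedP k : killed_by_nminus act k <-> forall a, act (gEm a) k = 0.
Proof.
split=> [[k1 k2 k3] [[]|] //|kE]; first by rewrite /= (mactNl aP) k1 oppr0.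
split; last by [apply: (kE (Some true)) | apply: (kE (Some false))].
  by have /= := kE None; rewrite (mactNl aP) => /eqP; rewrite oppr_eq0 => /eqP.
exact: (kE (Some false)).
Qed.

(** The effect of [E_a^-] on bidegrees. Where [lowerable] fails, [E_a^-] acts by 0,
    although truncated subtraction gives [lowered] a value. *)
Definition lowerable (a : option bool) (j : nat * nat) : bool :=
  match a with
  | None => (2 <= j.1)%N | Some false => (1 <= j.2)%N
  | Some true => (1 <= j.1)%N && (1 <= j.2)%N
  end.

Definition lowered (a : option bool) (j : nat * nat) : nat * nat :=
  match a with
  | None => (j.1 - 2, j.2)%N | Some false => (j.1.+1, j.2.-1)
  | Some true => (j.1.-1, j.2.-1)
  end.

Lemma lowered_inj a j j' : lowerable a j -> lowerable a j' ->
  lowered a j = lowered a j' -> j = j'.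
Proof.
case: a j j' => [[]|] [m l] [m' l'] /=.
- by case: m m' l l' => [|m] [|m'] [|l] [|l'] //= _ _ [-> ->].
- by case: l l' => [|l] [|l'] //= _ _ [-> ->].
- by case: m m' => [|[|m]] [|[|m']] //=; rewrite !subSS !subn0 => _ _ [-> ->].
Qed.

Lemma bidegree_lowered a j k : bideg j.1 j.2 k ->
  if lowerable a j then bideg (lowered a j).1 (lowered a j).2 (act (gEm a) k)
  else act (gEm a) k = 0.
Proof.
case: j => m l /= dk; case: a => [[]|] /=.
- rewrite (act_gE3m actK); case: l dk => [|l] dk; last case: m dk => [|m] dk /=.
  + rewrite andbF big1 ?oppr0 // => i _.
    by rewrite (bidegree_eta0 actK _ dk) (mact0r aP).
  + rewrite big1 ?oppr0 // => i _.
    by apply: (bidegree_y0 actK (l := l)); apply: (bidegree_eta actK).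
  + have lin := bidegree_linear M m l.
    apply: (subspaceN lin); apply: (subspace_sum _ lin) => i _.
    by apply: (bidegree_y actK); apply: (bidegree_eta actK).
- rewrite (act_gE2m actK); case: l dk => [|l] dk /=.
    by rewrite big1 // => i _; rewrite (bidegree_eta0 actK _ dk) (mact0r aP).
  apply: (subspace_sum _ (bidegree_linear M m.+1 l)) => i _.
  by apply: (bidegree_x actK); apply: (bidegree_eta actK).
rewrite gE1mE (mactNl aP) (mact_suml aP).
have E i : act (2^-1 *: ty A (basis_vec C i) ^+ 2) k =
    2^-1 *: act (ty A (basis_vec C i)) (act (ty A (basis_vec C i)) k).
  by rewrite (mactZl aP) expr2 (mactM aP).
under eq_bigr => i _ do rewrite E.
case: m dk => [|[|m]] dk /=; rewrite ?subn0.
- rewrite big1 ?oppr0 // => i _.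
  by rewrite (bidegree_y0 actK _ dk) (mact0r aP) scaler0.
- rewrite big1 ?oppr0 // => i _.
  by rewrite (bidegree_y0 actK (l := l)) ?scaler0 //; apply: (bidegree_y actK).
rewrite !subSS subn0; have lin := bidegree_linear M m l.
apply: (subspaceN lin); apply: (subspace_sum _ lin) => i _.
by apply: (subspaceZ _ lin); do 2!apply: (bidegree_y actK).
Qed.

Lemma bidegree_raised a m l k : lowerable a (m, l) ->
  bideg (lowered a (m, l)).1 (lowered a (m, l)).2 k -> bideg m l (act (gEp A a) k).
Proof.
have lin := bidegree_linear M m l; case: a => [[]|] /=.
- case: m l lin => [|m] [|l] //= lin _ dk; rewrite (act_gE3p actK).
  apply: (subspaceN lin); apply: (subspace_sum _ lin) => i _.
  by apply: (bidegree_x actK); apply: (bidegree_xi actK).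
- case: l lin => [|l] //= lin _ dk; rewrite (act_gE2p actK).
  apply: (subspace_sum _ lin) => i _.
  by apply: (bidegree_y actK); apply: (bidegree_xi actK).
case: m lin => [|[|m]] //= lin _; rewrite !subSS subn0 => dk.
rewrite gE1pE (mactNl aP) (mact_suml aP).
apply: (subspaceN lin); apply: (subspace_sum _ lin) => i _.
rewrite (mactZl aP) expr2 (mactM aP); apply: (subspaceZ _ lin).
by do 2!apply: (bidegree_x actK).
Qed.

Lemma bidegree_finite m l : exists s : seq K,
  (forall u, u \in s -> bideg m l u) /\
  forall k, bideg m l k -> lin_span (fun u => u \in s) k.
Proof.
pose mon (p : {ffun 'I_m -> 'I_r} * 'I_d) : M :=
  sm_act (\prod_(k < m) ch_x H (basis_vec C (p.1 k))) (sm_in M (basis_vec C p.2)).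
have degmon p : deg m (mon p).
  by apply: lin_span_incl; exists p.1, (basis_vec C p.2).
have monspan z : deg m z -> lin_span (fun u => exists p, u = mon p) z.
  apply: lin_span_sub => _ [i [v ->]].
  rewrite (linear_basis (sm_in M)) (mact_sumr smP).
  apply: subspace_sum => // j _.
  rewrite (mactZr smP); apply: subspaceZ => //.
  apply: lin_span_incl; exists ([ffun k => i k], j); congr sm_act.
  by apply: eq_bigr => k _; rewrite ffunE.
exists [seq single B (mon p) | B <- enum [pred B : {set 'I_r} | #|B| == l],
          p <- enum {: {ffun 'I_m -> 'I_r} * 'I_d}]; split=> [u|k dk].
  case/allpairsP => -[S p] /= [Sl _ ->]; rewrite mem_enum inE in Sl.
  by rewrite -(eqP Sl); apply: bidegree_single.
rewrite [k]sum_single; apply: subspace_sum => // S _.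
have := dk S; case: eqP => [Sl /monspan|_ ->]; last first.
  by rewrite single0; apply: lin_span0.
apply: (lin_span_map (f := single S)); first exact: single_linear.
move=> _ [p ->]; apply: lin_span_incl; apply/allpairsP; exists (S, p).
by rewrite /= !mem_enum inE Sl eqxx.
Qed.

Lemma finite_dimensional_seq (P : K -> Prop) (s : seq K) :
  (forall k, P k -> lin_span (fun u => u \in s) k) -> finite_dimensional P.
Proof.
move=> Ps; apply: (@finite_dimensional_span _ _ _ 'I_(size s) (fun i => s`_i)).
move=> z /Ps; apply: lin_span_sub => u us; apply: lin_span_incl.
have si : (index u s < size s)%N by rewrite index_mem.
by exists (Ordinal si); rewrite /= nth_index.
Qed.

Lemma orthogonal_projection_seq (s : seq K) (k : K) :
  exists2 p, lin_span (fun u => u \in s) p & forall u, u \in s -> form (k - p) u = 0.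
Proof.
have [p pS pP] := orthogonal_projection form_hermitian form_positive
   (fun i : 'I_(size s) => s`_i) k.
exists p => [|u us].
  by apply: lin_span_sub pS => u [i ->]; apply: lin_span_incl; apply: mem_nth.
have si : (index u s < size s)%N by rewrite index_mem.
by have := pP (Ordinal si); rewrite /= nth_index.
Qed.

(** Every bidegree is the sum of what is raised from lower ones and of the
    orthogonal complement thereof, on which contravariance makes the lowering
    operators vanish; hence raising the lowest weight vectors yields all of [K]. *)
Lemma raising_span (S : K -> Prop) : linear_subspace S ->
  (forall a k, S k -> S (act (gEp A a) k)) ->
  (forall m l u, bideg m l u -> killed_by_nminus act u -> S u) ->
  forall m l k, bideg m l k -> S k.
Proof.
move=> linS Sraise Slow m l; have [n] := ubnP (m + 2 * l).
elim: n m l => // n IHn m l mln k dk.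
have low a : exists s : seq K, if lowerable a (m, l) then
    (forall u, u \in s -> bideg (lowered a (m, l)).1 (lowered a (m, l)).2 u) /\
    (forall k, bideg (lowered a (m, l)).1 (lowered a (m, l)).2 k ->
       lin_span (fun u => u \in s) k) else s = [::].
  by case: (lowerable _ _); [apply: bidegree_finite | exists [::]].
have [s sP] := choice low.
pose as_ := [:: None; Some false; Some true].
pose t := [seq act (gEp A a) u | a <- as_, u <- s a].
have as_all a : a \in as_ by case: a => [[]|].
have tbideg u : u \in t -> bideg m l u.
  case/allpairsPdep => a [v [_ vs ->]]; have := sP a.
  by case: ifP vs => [la vs [sb _]|_ vs s0]; [apply/bidegree_raised/sb | rewrite s0 in vs].
have tS u : u \in t -> S u.
  case/allpairsPdep => a [v [_ vs ->]]; apply: Sraise; have := sP a.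
  case: ifP vs => [la vs [sb _]|_ vs s0]; last by rewrite s0 in vs.
  apply: IHn (sb _ vs); move: la mln; rewrite !ltnS.
  case: a {vs sb} => [[]|] /=.
  - case: m l {dk low sP s t tbideg} => [|m] [|l] //= _.
    by apply: leq_trans; rewrite addSn ltnS leq_add2l leq_mul2l leqnSn orbT.
  - case: l {dk low sP s t tbideg} => [|l] //= _.
    by apply: leq_trans; rewrite mulnS addSn addnA addn2 ltnS leqnn.
  - case: m {dk low sP s t tbideg} => [|[|m]] //= _.
    by apply: leq_trans; rewrite !subSS subn0 !addSn ltnS leqnSn.
have [p pspan pP] := orthogonal_projection_seq t k.
have dp : bideg m l p by apply: lin_span_min pspan => //; apply: bidegree_linear.
have dq : bideg m l (k - p).
  apply: (subspaceD (bidegree_linear M m l)) => //.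
  exact: (subspaceN (bidegree_linear M m l)).
rewrite -(subrK p k); apply: (subspaceD linS); last exact: lin_span_min pspan.
apply: (Slow m l) => //; apply/killedP => a; have := bidegree_lowered (j := (m, l)) a dq.
case: ifP => // la dE; apply: (herm_definite form_positive).
rewrite -gEp_gEm_adjoint; have := sP a; rewrite la => -[_ sspan].
apply: (herm_eq0_sym form_hermitian).
pose P z := form (k - p) (act (gEp A a) z) = 0.
apply: (lin_span_min (S := P)) (sspan _ dE) => [|u us]; last first.
  by apply: pP; apply/allpairsPdep; exists a, u.
split=> [|e u v]; first by rewrite /P (mact0r aP) (herm0r form_hermitian).
by rewrite /P (mactP aP) (hermDr form_hermitian) (hermZr form_hermitian) => -> ->; rewrite mulr0 addr0.
Qed.

(** * Parity and the supercentraliser *)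

Definition has_parity (p : bool) (u : A) : Prop :=
  forall k : K, parity_op (act u k) = (-1) ^+ p *: act u (parity_op k).

Lemma has_parity_linear p : linear_subspace (has_parity p).
Proof.
have lin := @parity_op_linear C r M.
split=> [k|a u v pu pv k].
  by rewrite !(mact0l aP) scaler0 (linear_zero lin).
by rewrite !(mactPl aP) lin pu pv scalerDr !scalerA mulrC.
Qed.

Lemma has_parityM p q u v : has_parity p u -> has_parity q v ->
  has_parity (p (+) q) (u * v).
Proof.
by move=> pu pv k; rewrite !(mactM aP) pu pv (mactZr aP) scalerA signr_addb.
Qed.

Lemma has_parity_inl a : has_parity false (ta_inl A a).
Proof.
move=> k; rewrite scale1r; apply/ffunP => S.
by rewrite ffunE !(act_inl actK) ffunE (mactZr smP).
Qed.

Lemma has_parity_txi u : has_parity true (txi A u).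
Proof.
rewrite (linear_basis (txi A)); apply: (subspace_sum _ (has_parity_linear _)) => i _.
apply: (subspaceZ _ (has_parity_linear _)) => k.
by rewrite !(act_xi actK) parity_op_wedge scaleN1r.
Qed.

Lemma has_parity_teta u : has_parity true (teta A u).
Proof.
rewrite (linear_basis (teta A)); apply: (subspace_sum _ (has_parity_linear _)) => i _.
apply: (subspaceZ _ (has_parity_linear _)) => k.
by rewrite !(act_eta actK) parity_op_contract scaleN1r.
Qed.

Lemma has_parity_mixed p (I : Type) (s : seq I) (a : I -> H) (b : I -> A) :
  (forall i, has_parity p (b i)) -> has_parity p (\sum_(i <- s) ta_inl A (a i) * b i).
Proof.
move=> pb; apply: (subspace_sum _ (has_parity_linear _)) => i _.
exact: (has_parityM (has_parity_inl _) (pb i)).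
Qed.

Lemma has_parity_gH : has_parity false (gH A).
Proof. by apply: has_parity_mixed => i k; rewrite ta_inr1 !(mact1 aP) scale1r. Qed.

Lemma has_parity_gE2p : has_parity true (gE2p A).
Proof. by apply: has_parity_mixed => i; apply: has_parity_txi. Qed.

Lemma has_parity_gE2m : has_parity true (gE2m A).
Proof. by apply: has_parity_mixed => i; apply: has_parity_teta. Qed.

Lemma has_parity_in_g p X : inG p X -> has_parity p X.
Proof.
have lin := has_parity_linear p; apply: lin_span_min => // {}X.
have p1 : has_parity false (ta_inr A 1).
  by move=> k; rewrite ta_inr1 !(mact1 aP) scale1r.
case: p lin => lin; rewrite !inE => /or4P[] /eqP ->.
- exact: has_parity_gE2p.
- exact: has_parity_gE2m.
- apply: (subspaceN lin); apply: has_parity_mixed => i; exact: has_parity_txi.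
- apply: (subspaceN lin); apply: has_parity_mixed => i; exact: has_parity_teta.
- exact: has_parity_gH.
- have -> : gZ A = anticommutator (gE2m A) (gE2p A) - gH A.
    by rewrite gE2m_gE2p addrC addKr.
  apply: (subspaceD lin); last exact: subspaceN lin has_parity_gH.
  by apply: (subspaceD lin); apply: (@has_parityM true true);
    by [apply: has_parity_gE2m | apply: has_parity_gE2p].
- by apply: (subspaceN lin); apply: has_parity_mixed.
- exact: has_parity_mixed.
Qed.

Lemma has_parity_clifford v : has_parity true (ta_inr A (cl_in Cl v)).
Proof.
rewrite cl_in_split ta_inrD; apply: (subspaceD (has_parity_linear _)).
  exact: has_parity_teta.
exact: has_parity_txi.
Qed.

Lemma parity_part_parity p u : parity_part p u -> has_parity p u.
Proof.
apply: lin_span_min; first exact: has_parity_linear.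
move=> _ [a [n [v [<- ->]]]].
apply: (has_parityM (has_parity_inl a)) => {a}.
elim: n v => [|n IHn] v k; first by rewrite big_ord0 ta_inr1 !(mact1 aP) scale1r.
rewrite big_ord_recl ta_inrM /= -addTb.
exact: (has_parityM (has_parity_clifford _) (IHn _)).
Qed.

Lemma superbracket_eq0 p q u X k : superbracket q p u X = 0 ->
  act u (act X k) = (-1) ^+ (q && p) *: act X (act u k).
Proof.
move/eqP; rewrite subr_eq0 => /eqP E.
by rewrite -(mactM aP) E (mactZl aP) (mactM aP).
Qed.

Lemma gE1m_in : inG false (gE1m A).
Proof. by apply: lin_span_incl; rewrite !inE eqxx !orbT. Qed.

Lemma weight_space_linear mu nu : linear_subspace (weight_space act mu nu).
Proof.
split=> [|a u v [uH uZ [u1 u2 u3]] [vH vZ [v1 v2 v3]]].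
  by split; rewrite ?(mact0r aP) ?scaler0 //; split; rewrite (mact0r aP).
split; first by rewrite (mactP aP) uH vH scalerDr !scalerA mulrC.
  by rewrite (mactP aP) uZ vZ scalerDr !scalerA mulrC.
by split; rewrite (mactP aP) ?u1 ?u2 ?u3 ?v1 ?v2 ?v3 scaler0 addr0.
Qed.

Lemma weight_space_parity mu nu k :
  weight_space act mu nu k -> weight_space act mu nu (parity_op k).
Proof.
have com p X z : inG p X -> act X (parity_op z) = (-1) ^+ p *: parity_op (act X z).
  by move=> inX; rewrite (has_parity_in_g inX) scalerA -expr2 sqrr_sign scale1r.
have pZ a z : parity_op (a *: z) = a *: parity_op z :> K.
  apply/ffunP => S; rewrite !ffunE !scalerA; by rewrite mulrC.
have p0 : parity_op 0 = 0 :> K by apply/ffunP => S; rewrite !ffunE scaler0.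
move=> [kH kZ [k1 k2 k3]]; split.
- by rewrite (com _ _ _ (gH_in A)) kH pZ scale1r.
- by rewrite (com _ _ _ (gZ_in A)) kZ pZ scale1r.
- split; [rewrite (com _ _ _ gE1m_in) k1 | rewrite (com _ _ _ (gEm_in (Some false))) k2
         | rewrite (com _ _ _ (gEm_in (Some true))) k3]; by rewrite p0 scaler0.
Qed.

Lemma weight_space_homogeneous mu nu q u k :
  (forall p X, inG p X -> superbracket q p u X = 0) ->
  weight_space act mu nu k -> weight_space act mu nu (act u k).
Proof.
move=> cu [kH kZ [k1 k2 k3]].
have com p X z : inG p X -> act X (act u z) = (-1) ^+ (q && p) *: act u (act X z).
  move=> inX; rewrite (superbracket_eq0 z (cu _ _ inX)).
  by rewrite scalerA -expr2 sqrr_sign scale1r.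
split.
- by rewrite (com _ _ _ (gH_in A)) kH (mactZr aP) andbF scale1r.
- by rewrite (com _ _ _ (gZ_in A)) kZ (mactZr aP) andbF scale1r.
- split; [rewrite (com _ _ _ gE1m_in) k1 | rewrite (com _ _ _ (gEm_in (Some false))) k2
         | rewrite (com _ _ _ (gEm_in (Some true))) k3]; by rewrite (mact0r aP) scaler0.
Qed.

Lemma weight_space_supercentraliser mu nu rho k : supercentraliser rho ->
  weight_space act mu nu k -> weight_space act mu nu (act rho k).
Proof.
case=> rho_ -> rhoP wk; rewrite (mactDl aP).
apply: (subspaceD (weight_space_linear mu nu)).
  by have [_ cu] := rhoP false; apply: weight_space_homogeneous cu wk.
by have [_ cu] := rhoP true; apply: weight_space_homogeneous cu wk.
Qed.

Lemma star_clifford v : exists v', star (ta_inr A (cl_in Cl v)) = ta_inr A (cl_in Cl v').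
Proof.
pose cj (u : 'cV[C]_r) := \sum_i (u i 0)^*%R *: basis_vec C i.
have cjx u : star (txi A u) = teta A (cj u).
  rewrite (linear_basis (txi A)) star_sum linear_sum; apply: eq_bigr => i _.
  by rewrite starZ star_xi linearZ.
have cjy u : star (teta A u) = txi A (cj u).
  rewrite (linear_basis (teta A)) star_sum linear_sum; apply: eq_bigr => i _.
  by rewrite starZ star_eta linearZ.
exists (cj v.2, cj v.1); rewrite !cl_in_split !ta_inrD starD addrC.
by rewrite [star (ta_inr A (cl_x Cl v.2))]cjx [star (ta_inr A (cl_y Cl v.1))]cjy.
Qed.

Lemma star_clifford_prod n (v : 'I_n -> 'cV[C]_r * 'cV[C]_r) : exists v',
  star (ta_inr A (\prod_(k < n) cl_in Cl (v k))) =
  ta_inr A (\prod_(k < n) cl_in Cl (v' k)).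
Proof.
elim: n v => [|n IHn] v.
  by exists v; rewrite !big_ord0 ta_inr1 star1.
have [v' E] := IHn (fun k => v (lift ord0 k)); have [u Eu] := star_clifford (v ord0).
exists (fun k => if unlift ord_max k is Some k' then v' k' else u).
rewrite big_ord_recl big_ord_recr /= unlift_none !ta_inrM starM E Eu.
congr (ta_inr A _ * _); apply: eq_bigr => k _.
have -> : widen_ord (leqnSn n) k = lift ord_max k.
  by apply: val_inj; rewrite /= /bump leqNgt ltn_ord.
by rewrite liftK.
Qed.

Lemma star_parity_part q u : parity_part q u -> parity_part q (star u).
Proof.
have lin : linear_subspace (@parity_part R r Phi gT W c H Cl A q).
  exact: lin_span_linear.
apply: (lin_span_min (S := fun u => parity_part q (star u))).
  split=> [|a v w pv pw]; first by rewrite star0; case: lin.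
  by rewrite (st_lin starP); case: lin => _; apply.
move=> _ [a [n [v [nq ->]]]]; rewrite /tens starM.
have [a' ->] := star_inl a; have [v' ->] := star_clifford_prod v.
by apply: lin_span_incl; exists a', n, v'; rewrite -ta_comm.
Qed.

Lemma star_supercentraliser rho : supercentraliser rho -> supercentraliser (star rho).
Proof.
case=> rho_ -> rhoP; exists (fun q => star (rho_ q)); first exact: starD.
move=> q; have [pq cq] := rhoP q; split; first exact: star_parity_part.
move=> p X inX; have := cq p _ (star_in_g inX).
move/eqP; rewrite subr_eq0 => /eqP/(congr1 star).
rewrite starM starZ starM starK rmorph_sign => E.
by rewrite /superbracket E scalerA -expr2 sqrr_sign scale1r subrr.
Qed.

Lemma adjointable_supercentraliser rho : supercentraliser rho ->
  adjointable rho.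
Proof.
have lin := adjointable_linear.
case=> rho_ -> rhoP; suff adj q : adjointable (rho_ q).
  exact: (subspaceD lin).
have [pq _] := rhoP q; apply: lin_span_min pq => // _ [a [n [v [_ ->]]]].
apply: adjointableM.
  exact: adjointable_inl.
elim: n v => [|n IHn] v.
  rewrite big_ord0 ta_inr1; exact: adjointable1.
rewrite big_ord_recl ta_inrM; apply: adjointableM => //.
exact: adjointable_clifford.
Qed.

Lemma weight_space_unitary mu nu :
  unitary_Rc_module act beta star (weight_space act mu nu).
Proof.
split.
- exact: weight_space_linear.
- by move=> rho k; apply: weight_space_supercentraliser.
- by move=> k _; apply: form_positive.
- move=> rho rhoP; split; first exact: star_supercentraliser.
  by move=> k k' _ _; apply: adjointable_supercentraliser.
Qed.

(** * Homomorphisms from a lowest weight module *)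

Definition K_module : g_module A.
Proof.
apply: (@GModule _ _ _ _ _ _ _ _ _ K act).
- by move=> p X a u v _; rewrite (mactP aP).
- by move=> p X Y a v _ _; rewrite (mactPl aP).
- move=> p q X Y v _ _.
  by rewrite /superbracket (mactBl aP) (mactZl aP) !(mactM aP).
Defined.

Local Notation KG := K_module.

Definition word_sum (G : g_module A) (l : seq (C * word)) (v : G) : G :=
  \sum_(p <- l) p.1 *: gword p.2 v.

Lemma gword_span_seq (G : g_module A) (v z : G) :
  gword_span v z -> exists l, word_sum l v = z.
Proof.
case=> n [a [u [uE ->]]]; have [w wE] := choice uE.
exists [seq (a i, w i) | i <- enum 'I_n].
rewrite /word_sum big_map big_enum /=; apply: eq_bigr => i _.
by rewrite -wE.
Qed.

Lemma word_sum_span (G : g_module A) (v : G) l : gword_span v (word_sum l v).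
Proof.
apply: subspace_sum => [|p _]; first exact: lin_span_linear.
apply: subspaceZ; first exact: lin_span_linear.
by apply: lin_span_incl; exists p.2.
Qed.

Lemma weight_space_lowest mu nu (u : K) : weight_space act mu nu u ->
  lowest_weight_vector mu nu (u : KG).
Proof. by case. Qed.

Lemma lowest_killed (u : KG) mu nu : lowest_weight_vector mu nu u ->
  forall a, g_act (gEm a) u = 0.
Proof. by case=> uk _ _; apply/killedP. Qed.

Lemma weight_space_orthogonal mu nu mu' nu' (u u' : K) :
  weight_space act mu nu u -> weight_space act mu' nu' u' -> form u u' = 0 ->
  forall z z' : KG, gword_span (u : KG) z -> gword_span (u' : KG) z' -> form z z' = 0.
Proof.
move=> wu wu' uu' z z' uz u'z'.
apply: (lin_span_min (S := fun z => form z z' = 0)) uz.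
  split=> [|a k k' Ek Ek']; first exact: herm0l form_hermitian _.
  by rewrite (hermDl form_hermitian) (hermZl form_hermitian) Ek Ek' mulr0 addr0.
move=> _ [w ->]; apply: (gword_orthogonal (G := KG) (gEm := gEm) form_hermitian) u'z' => //.
- exact: gEm_in.
- exact: gEp_gEm_adjoint.
- exact: lowest_killed.
- exact: weight_space_lowest wu.
- exact: weight_space_lowest wu'.
Qed.

Definition word_parity (w : word) : bool := odd (count isSome w).

Definition twist (b : bool) (k : K) : K := if b then parity_op k else k.

Lemma twistP b : linear (twist b).
Proof. by case: b => a u v //=; apply: parity_op_linear. Qed.

Lemma act_gword_commute (u : A) q w k :
  (forall p X, inG p X -> superbracket q p u X = 0) ->
  act u (gword w (k : KG)) = (-1) ^+ (q && word_parity w) *: gword w (act u k : KG).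
Proof.
move=> cu; elim: w => [|a w IHw] /=; first by rewrite andbF scale1r.
rewrite (superbracket_eq0 _ (cu _ _ (gEp_in A a))) IHw (mactZr aP) scalerA.
congr (_ *: _); rewrite -signr_addb; congr (_ ^+ _).
by rewrite /word_parity /= oddD oddb andb_addr.
Qed.

Lemma parity_gword w k : parity_op (gword w (k : KG)) =
  (-1) ^+ word_parity w *: gword w (parity_op k : KG).
Proof.
elim: w => [|a w IHw] /=; first by rewrite scale1r.
rewrite (has_parity_in_g (gEp_in A a)) IHw (mactZr aP) scalerA.
congr (_ *: _); rewrite -signr_addb; congr (_ ^+ _).
by rewrite /word_parity /= oddD oddb.
Qed.

Lemma gword_linear (G : g_module A) w : linear (@gword R r Phi gT W c H Cl A G w).
Proof.
elim: w => [|a w IHw] e u v //=.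
by rewrite IHw (g_actr _ _ _ (gEp_in A a)).
Qed.

Lemma gwordZ (G : g_module A) w a (v : G) : gword w (a *: v) = a *: gword w v.
Proof. by rewrite -[LHS]/(linear_map (@gword_linear G w) (a *: v)) linearZ. Qed.

Variables (mu nu : C) (L : g_module A) (v0 : L).
Hypotheses (v0_lowest : lowest_weight_vector mu nu v0) (v0_neq0 : v0 != 0)
  (v0_span : forall z : L, gword_span v0 z).

Definition coefficients (v : L) : seq (C * word) := sval (cid (gword_span_seq (v0_span v))).

Lemma coefficientsP v : word_sum (coefficients v) v0 = v.
Proof. exact: svalP (cid (gword_span_seq (v0_span v))). Qed.

Lemma word_sum_unique l l' u : weight_space act mu nu u ->
  word_sum l v0 = word_sum l' v0 -> word_sum l (u : KG) = word_sum l' (u : KG).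
Proof.
move=> wu E; apply/eqP; rewrite -subr_eq0; apply/eqP.
pose l2 := l ++ [seq (- p.1, p.2) | p <- l'].
have l2E (G : g_module A) (v : G) : word_sum l v - word_sum l' v = word_sum l2 v.
  rewrite /word_sum big_cat big_map -sumrN; congr (_ + _).
  by apply: eq_bigr => p _; rewrite scaleNr.
have rel : word_sum l2 v0 = 0 by rewrite -l2E E subrr.
rewrite l2E; move: rel; rewrite /word_sum !(big_nth (0, [::])) !big_mkord => rel.
apply: (@word_relations _ _ _ _ _ _ _ _ A L KG form gEm _ _ _ _ _ mu nu v0 u
  (size l2) (fun i => (nth (0, [::]) l2 i).1) (fun i => (nth (0, [::]) l2 i).2)) => //.
- exact: form_hermitian.
- exact: form_positive.
- exact: gEm_in.
- exact: gEp_gEm_adjoint.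
- exact: lowest_killed.
- exact: weight_space_lowest wu.
Qed.

(** [L] being generated by [v0], a homomorphism sending [v0] to [u] must replace
    [v0] by [u] in any expression of [v] through words; by [word_relations] the
    expression chosen does not matter. *)
Definition extension (u : K) (v : L) : K := word_sum (coefficients v) (u : KG).

Lemma extension_word_sum u l : weight_space act mu nu u ->
  extension u (word_sum l v0) = word_sum l (u : KG).
Proof. by move=> wu; apply: word_sum_unique => //; rewrite coefficientsP. Qed.

(** Linearity and equivariance of [extension u] are read off from its graph, the
    submodule generated by [(v0, u)]. *)
Lemma extension_graph u v k : weight_space act mu nu u ->
  gword_span ((v0, u) : prod_module L KG) (v, k) -> extension u v = k.
Proof.
move=> wu /gword_span_seq[l].
have E : word_sum l ((v0, u) : prod_module L KG) = (word_sum l v0, word_sum l (u : KG)).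
  rewrite /word_sum; elim/big_rec3: _ => // p x y z _ ->.
  by rewrite gword_prod.
by rewrite E => -[<- <-]; apply: extension_word_sum.
Qed.

Lemma graph_extension u v : weight_space act mu nu u ->
  gword_span ((v0, u) : prod_module L KG) (v, extension u v).
Proof.
move=> wu; rewrite -{1}(coefficientsP v).
have <- : word_sum (coefficients v) ((v0, u) : prod_module L KG)
   = (word_sum (coefficients v) v0, extension u v).
  rewrite /extension /word_sum; elim/big_rec3: _ => // p x y z _ ->.
  by rewrite gword_prod.
exact: word_sum_span.
Qed.

Lemma extension_act p X u v : inG p X -> weight_space act mu nu u ->
  extension u (g_act X v) = act X (extension u v).
Proof.
move=> inX wu; apply: extension_graph => //.
have [_ stab] := gword_span_submodule
  (prod_lowest (G2 := KG) v0_lowest (weight_space_lowest wu)).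
exact: stab inX (graph_extension v wu).
Qed.

Lemma extension_linear u : weight_space act mu nu u -> linear (extension u).
Proof.
move=> wu a v v'; apply: extension_graph => //.
have [_ lin] := lin_span_linear (fun z => exists w, z = gword w ((v0, u) : prod_module L KG)).
exact: lin (graph_extension v wu) (graph_extension v' wu).
Qed.

Lemma extension_lowest u : weight_space act mu nu u -> extension u v0 = u.
Proof.
move=> wu; apply: extension_graph => //.
by apply: lin_span_incl; exists [::].
Qed.

(** A word of odd parity anticommutes with the odd part of the supercentraliser,
    and so does the parity operator; applying the word to [parity_op u] makes the
    two signs cancel. *)
Definition tensor_map (u : K) (v : L) : K :=
  \sum_(p <- coefficients v) p.1 *: gword p.2 (twist (word_parity p.2) u : KG).

Lemma tensor_mapDl a u u' v :
  tensor_map (a *: u + u') v = a *: tensor_map u v + tensor_map u' v.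
Proof.
rewrite /tensor_map scaler_sumr -big_split; apply: eq_bigr => p _ /=.
by rewrite twistP gword_linear scalerDr !scalerA mulrC.
Qed.

Definition sign_twist (l : bool) (k : K) : K := if l then - parity_op k else k.

Lemma sign_twist_linear l : linear (sign_twist l).
Proof.
case: l => a u v //=; rewrite (@parity_op_linear _ _ M a u v) opprD.
by rewrite scalerN.
Qed.

Lemma act_sign_twist l p X k : inG p X ->
  act X (sign_twist l k) = (-1) ^+ (p && l) *: sign_twist l (act X k).
Proof.
move=> inX; case: l; last by rewrite andbF scale1r.
rewrite andbT /= (mactNr aP) (has_parity_in_g inX) scalerN scalerA.
by rewrite -expr2 sqrr_sign scale1r.
Qed.

Definition homogeneous (l : bool) (u : K) : Prop := parity_op u = (-1) ^+ l *: u.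

(** So the map differs from the homomorphism [extension u] by an operator that
    commutes with g up to the Koszul sign. *)
Lemma tensor_map_homogeneous l u v : homogeneous l u ->
  tensor_map u v = sign_twist l (extension u v).
Proof.
move=> hu; pose f := linear_map (sign_twist_linear l).
rewrite /extension /word_sum -[RHS]/(f _) linear_sum; apply: eq_bigr => p _.
rewrite linearZ; congr (_ *: _); rewrite /f /=; case: l hu {f} => hu /=.
  rewrite parity_gword /twist; case: (word_parity p.2).
    by rewrite expr1 scaleN1r opprK.
  by rewrite expr0 scale1r hu gwordZ expr1 scaleN1r opprK.
by rewrite /twist; case: ifP => // _; rewrite hu scale1r.
Qed.

Lemma tensor_map_act l p X u v : inG p X -> weight_space act mu nu u ->
  homogeneous l u ->
  act X (tensor_map u v) = (-1) ^+ (p && l) *: tensor_map u (g_act X v).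
Proof.
move=> inX wu hu; rewrite !(tensor_map_homogeneous _ hu) (act_sign_twist _ _ inX).
by rewrite (extension_act _ inX wu).
Qed.

Lemma tensor_map_lowest l u : weight_space act mu nu u -> homogeneous l u ->
  tensor_map u v0 = u.
Proof.
move=> wu hu; rewrite (tensor_map_homogeneous _ hu) extension_lowest //.
by case: l hu => //= ->; rewrite scaleN1r opprK.
Qed.

Lemma tensor_map_linear_homogeneous l u : weight_space act mu nu u ->
  homogeneous l u -> linear (tensor_map u).
Proof.
move=> wu hu a v v'; rewrite !(tensor_map_homogeneous _ hu).
by rewrite extension_linear // sign_twist_linear.
Qed.

Lemma tensor_map_bilinear : bilinear_on (weight_space act mu nu) tensor_map.
Proof.
split=> [a u u' v _ _|a u v v' wu]; first exact: tensor_mapDl.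
(* Equivariance and additivity in [v] hold for homogeneous vectors, so split [u]
   into its even and odd parts, which are again lowest weight vectors. *)
pose u_ (l : bool) := 2^-1 *: ((-1) ^+ l *: parity_op u + u).
have wpu := weight_space_parity wu.
have wu_ l : weight_space act mu nu (u_ l).
  have lin := weight_space_linear mu nu.
  by apply: (subspaceZ _ lin); case: lin => _; apply.
have hu_ l : homogeneous l (u_ l).
  rewrite /homogeneous /u_ -[parity_op _]/(linear_map (@parity_op_linear _ _ M) _).
  rewrite linearZ linearD linearZ /= parity_opK scalerA mulrC -scalerA; congr (_ *: _).
  by rewrite scalerDr scalerA -expr2 sqrr_sign scale1r addrC.
have uE : u = u_ false + u_ true.
  rewrite /u_ -scalerDr /= expr0 expr1 scale1r scaleN1r addrACA subrr add0r.
  by rewrite (half_sum (two_neq0 R)).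
have E x : tensor_map u x = tensor_map (u_ false) x + tensor_map (u_ true) x.
  by rewrite {1}uE -[u_ false in LHS]scale1r tensor_mapDl scale1r.
rewrite !E (tensor_map_linear_homogeneous (wu_ false) (hu_ false)).
rewrite (tensor_map_linear_homogeneous (wu_ true) (hu_ true)).
by rewrite scalerDr addrACA.
Qed.

Lemma tensor_map_supercentraliser rho u v : supercentraliser rho ->
  act rho (tensor_map u v) = tensor_map (act rho u) v.
Proof.
have hom q rho' : parity_part q rho' ->
    (forall p X, inG p X -> superbracket q p rho' X = 0) ->
    act rho' (tensor_map u v) = tensor_map (act rho' u) v.
  move=> pq cq; rewrite /tensor_map (mact_sumr aP); apply: eq_bigr => p _.
  rewrite (mactZr aP) (act_gword_commute _ _ cq); congr (_ *: _).
  rewrite /twist; case: ifP => _; last by rewrite andbF scale1r.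
  by rewrite andbT (parity_part_parity pq) gwordZ.
case=> rho_ -> rhoP; rewrite !(mactDl aP).
have [pf cf] := rhoP false; have [pt ct] := rhoP true.
rewrite (hom _ _ pf cf) (hom _ _ pt ct).
by rewrite -[act (rho_ false) u in RHS]scale1r tensor_mapDl scale1r.
Qed.

Lemma tensor_map_span l u v : weight_space act mu nu u -> homogeneous l u ->
  gword_span (u : KG) (tensor_map u v).
Proof.
move=> wu hu; apply: subspace_sum => [|p _]; first exact: lin_span_linear.
apply: subspaceZ; first exact: lin_span_linear.
rewrite /twist; case: ifP => _; last by apply: lin_span_incl; exists p.2.
rewrite hu gwordZ; apply: subspaceZ; first exact: lin_span_linear.
by apply: lin_span_incl; exists p.2.
Qed.

Lemma tensor_map_nplus l u z : weight_space act mu nu u -> homogeneous l u ->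
  in_nplus z -> in_nplus (tensor_map u z : KG).
Proof.
move=> wu hu; apply: (lin_span_map (f := tensor_map u)).
  exact: tensor_map_linear_homogeneous wu hu.
move=> _ [a [k ->]].
have E := tensor_map_act k (gEp_in A a) wu hu.
have -> : tensor_map u (g_act (gEp A a) k) =
    (-1) ^+ (isSome a && l) *: act (gEp A a) (tensor_map u k).
  by rewrite E scalerA -expr2 sqrr_sign scale1r.
by apply: subspaceZ; [exact: lin_span_linear | exact: (@in_nplus_act _ _ _ _ _ _ _ _ _ KG)].
Qed.

Hypothesis irrL : forall P : L -> Prop, g_submodule P ->
  (exists2 v, v != 0 & P v) -> forall v, P v.

(** If some coefficient is nonzero, the possible values of that coefficient in a
    relation fill [L]; a relation whose coefficient is the generator projects,
    modulo the image of the raising operators, to a linear relation between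
    lowest weight vectors. *)
Lemma tensor_map_injective l (P : K -> Prop) :
  (forall u, P u -> weight_space act mu nu u /\ homogeneous l u) ->
  tensor_injective P tensor_map.
Proof.
move=> Pw n u v Pu indep rel k; apply/eqP; apply: contraT => vk.
have wu i : weight_space act mu nu (u i) by have [] := Pw _ (Pu i).
have hu i : homogeneous l (u i) by have [] := Pw _ (Pu i).
have lin i := tensor_map_linear_homogeneous (wu i) (hu i).
pose S (x : L) := exists v' : 'I_n -> L,
  v' k = x /\ \sum_i tensor_map (u i) (v' i) = 0.
have t0 i : tensor_map (u i) 0 = 0.
  exact: linear_zero (lin i).
have subS : g_submodule S.
  split; first split.
  - by exists (fun=> 0); split=> //; rewrite big1 // => i _; apply: t0.
  - move=> a _ _ [v1 [<- r1]] [v2 [<- r2]]; exists (fun i => a *: v1 i + v2 i).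
    split=> //; under eq_bigr => i _ do rewrite lin.
    by rewrite big_split -scaler_sumr /= r1 r2 scaler0 addr0.
  move=> p Q _ inQ [v1 [<- r1]]; exists (fun i => g_act Q (v1 i)); split=> //.
  have := congr1 (act Q) r1; rewrite (mact0r aP) (mact_sumr aP).
  under eq_bigr => i _ do rewrite (tensor_map_act _ inQ (wu i) (hu i)).
  by rewrite -scaler_sumr => /eqP; rewrite scaler_eq0 signr_eq0 => /eqP.
have [v' [v'k r']] : S v0 by apply: irrL => //; exists (v k) => //; exists v.
have dec i : exists a, exists z, in_nplus z /\ v' i = a *: v0 + z.
  exact: gword_span_head (v0_span _).
have [a aP'] := choice dec; have [z zP] := choice aP'.
have tE i : tensor_map (u i) (v' i) = a i *: u i + tensor_map (u i) (z i).
  have [_ ->] := zP i; rewrite lin; congr (_ *: _ + _).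
  exact: tensor_map_lowest (wu i) (hu i).
pose y := \sum_i a i *: u i.
have wy : weight_space act mu nu y.
  apply: (subspace_sum _ (weight_space_linear mu nu)) => i _.
  exact: (subspaceZ _ (weight_space_linear mu nu)).
have yN : in_nplus (y : KG).
  have -> : y = \sum_i - tensor_map (u i) (z i).
    apply/eqP; rewrite sumrN -addr_eq0 /y -big_split /=; apply/eqP.
    by rewrite -[RHS]r'; apply: eq_bigr => i _; rewrite tE.
  apply: subspace_sum => [|i _]; first exact: lin_span_linear.
  apply: subspaceN; first exact: lin_span_linear.
  by have [nz _] := zP i; apply: tensor_map_nplus (wu i) (hu i) nz.
have y0 : y = 0.
  apply: (herm_definite form_positive).
  apply: (@nplus_orthogonal _ _ _ _ _ _ _ _ A KG form gEm form_hermitian _ _ mu nu) => //.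
  - exact: gEp_gEm_adjoint.
  - exact: lowest_killed.
  - exact: weight_space_lowest wy.
have ak : a k = 0 by apply: indep.
case/eqP: v0_neq0; apply: (lowest_weight_notin_nplus v0_lowest v0_span).
by rewrite -v'k; have [nz ->] := zP k; rewrite ak scale0r add0r.
Qed.

End Form.

End Star.

(** * Components of K *)

Section Decomposition.

Variables (R : realType) (r : nat) (Phi : root_system R r).
Variables (gT : finGroupType) (W : reflection_group Phi gT).
Variables (What : irrType R[i] W) (tau : What).
Variables (c : 'rV[R]_(nroots Phi)) (H : cherednik W c) (Cl : clifford R[i] r).
Variables (A : tensor_algebra H Cl) (star : A -> A).
Variable M : standard_module H (irr_repr tau).

Local Notation C := R[i].
Local Notation K := {ffun {set 'I_r} -> M}.
Variables (act : A -> K -> K) (beta : M -> M -> C) (N : What -> C).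
Variable b0 : 'cV[C]_(irr_degree tau) -> 'cV[C]_(irr_degree tau) -> C.
Hypotheses (starP : antilinear_involution star) (actK : K_action act)
  (contra : contravariant_form b0 beta)
  (pos_beta : positive_definite_on (fun _ => True) beta)
  (b0P : invariant_form (irr_repr tau) b0)
  (irrM : irreducible_module (@sm_act _ _ _ _ _ _ _ _ _ M))
  (NP : forall sigma, is_N_scalar c (irr_repr sigma) (N sigma))
  (Nsep : forall sigma, sigma != tau -> forall k : nat, N tau - N sigma != k%:R).

Local Notation deg := (@degree_part R r Phi gT W c H _ (irr_repr tau) M).
Local Notation bideg := (@bidegree_part R r Phi gT W c H _ (irr_repr tau) M).
Local Notation aP := (ka_mod actK).
Local Notation smP := (sm_actP M).
Local Notation form := (@K_form R r Phi gT W c H _ (irr_repr tau) M beta).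
Local Notation herm_form := (form_hermitian contra).
Local Notation pos_form := (form_positive contra pos_beta).
Local Notation index := (What * (nat * nat))%type.

Definition muN (j : index) : C := j.2.1%:R + r%:R / 2 - N tau.
Definition nuN (j : index) : C := j.2.2%:R - r%:R / 2 + N j.1.
Local Notation Mc j := (lowest_weight_vectors act (irr_repr j.1) j.2.1 j.2.2).

Lemma sm_in_neq0 : exists v, sm_in M v != 0.
Proof.
have d0 := irr_degree_gt0 tau; exists (delta_mx (Ordinal d0) 0).
apply/negP => /eqP v0; have [herm0 pos0 _] := b0P.
set v := delta_mx _ _ in v0.
have vn : v != 0.
  apply/negP => /eqP/matrixP/(_ (Ordinal d0) 0)/eqP.
  by rewrite !mxE !eqxx oner_eq0.
have := pos0 v I vn; rewrite -(cf_deg0 contra) v0.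
by rewrite (herm0l (cf_herm contra)) ltxx.
Qed.

(** By contravariance such a vector is orthogonal to all [x z], which span the degree
    [m + 1]. *)
Lemma killed_degree0 m z : (forall i, sm_act (ch_y H (basis_vec C i)) z = 0) ->
  deg m.+1 z -> z = 0.
Proof.
move=> yz dz; apply: (herm_definite pos_beta).
apply: (lin_span_min (S := fun u => beta u z = 0) _ _ (degree_partSE dz)).
  split=> [|a u v Eu Ev]; first exact: herm0l (cf_herm contra) _.
  by rewrite (hermDl (cf_herm contra)) (hermZl (cf_herm contra)) Eu Ev mulr0 addr0.
move=> _ [j [z' [_ ->]]]; apply: (herm_eq0_sym (cf_herm contra)).
have -> : basis_vec C j = map_mx Num.conj (basis_vec C j).
  by apply/colP => i; rewrite !mxE rmorph_nat.
by rewrite -(cf_y contra) yz (herm0l (cf_herm contra)).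
Qed.

Section WithDiagonalAction.

Variable D : gT -> K -> K.
Hypotheses (Dlin : forall g, g \in W -> linear (D g)) (D1 : forall k, D 1%g k = k)
  (DM : forall g g' k, g \in W -> g' \in W -> D (g * g')%g k = D g (D g' k))
  (Ds : forall i k, D (rg_s W i) k = act (s_diag A i) k)
  (DQ : forall g Q k, g \in W -> W_commuting Q -> D g (act Q k) = act Q (D g k))
  (Dbideg : forall g m l k, g \in W -> bideg m l k -> bideg m l (D g k)).

Local Notation pi := (isotypic_proj D).

Lemma pcharC : [pchar C] =i pred0. Proof. exact: pchar_num. Qed.

Lemma isotypic_equivariant (sigma : What) k : isotypic act (irr_repr sigma) k ->
  lin_span (in_equivariant_image D sigma) k.
Proof.
apply: lin_span_sub => _ [f [v [-> fs]]]; apply: lin_span_incl; exists f, v.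
split=> // g u Wg; move: g Wg u.
apply: (reflection_group_ind (W := W)) => [u|i g Wg IHg u].
  by rewrite repr_mx1 mul1mx D1.
by rewrite repr_mxM ?rg_s_in // -mulmxA fs IHg DM ?rg_s_in // Ds.
Qed.

Lemma equivariant_isotypic (sigma : What) k : lin_span (in_equivariant_image D sigma) k ->
  isotypic act (irr_repr sigma) k.
Proof.
apply: lin_span_sub => k' [f [v [-> fD]]]; apply: lin_span_incl; exists f, v.
by split=> // i u; rewrite fD ?rg_s_in // Ds.
Qed.

Lemma pi_linear (sigma : What) : linear (pi sigma).
Proof. exact: isotypic_proj_linear. Qed.

Lemma pi_isotypic (sigma : What) k : isotypic act (irr_repr sigma) (pi sigma k).
Proof. by apply: equivariant_isotypic; apply: isotypic_proj_image. Qed.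

Lemma pi_other (sigma sigma' : What) k : sigma != sigma' ->
  isotypic act (irr_repr sigma') k -> pi sigma k = 0.
Proof.
move=> ss /isotypic_equivariant.
apply: (lin_span_min (S := fun k => pi sigma k = 0)).
  split=> [|a u v Eu Ev]; first exact: linear_zero (pi_linear sigma).
  by rewrite (pi_linear sigma) Eu Ev scaler0 addr0.
by move=> u; apply: isotypic_proj_other.
Qed.

Lemma sum_pi k : \sum_(sigma : What) pi sigma k = k.
Proof. by apply: sum_isotypic_proj => //; apply: pcharC. Qed.

Lemma pi_id (sigma : What) k : isotypic act (irr_repr sigma) k -> pi sigma k = k.
Proof.
move=> ks; rewrite -[RHS]sum_pi (bigD1 sigma) //= big1 ?addr0 // => s' ns.
exact: pi_other ks.
Qed.

Lemma pi_commute (sigma : What) Q k : W_commuting Q -> pi sigma (act Q k) = act Q (pi sigma k).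
Proof.
move=> cQ; rewrite (mact_sumr aP); apply: eq_bigr => g Wg.
by rewrite (mactZr aP) DQ.
Qed.

Lemma pi_bidegree (sigma : What) m l k : bideg m l k -> bideg m l (pi sigma k).
Proof.
move=> dk; apply: (subspace_sum _ (bidegree_linear M m l)) => g Wg.
by apply: (subspaceZ _ (bidegree_linear M m l)); apply: Dbideg.
Qed.

Definition component (j : index) (k : K) : Prop :=
  bideg j.2.1 j.2.2 k /\ isotypic act (irr_repr j.1) k.

Lemma component_linear j : linear_subspace (component j).
Proof.
have [b1 b2] := bidegree_linear M j.2.1 j.2.2.
have [i1 i2] : linear_subspace (isotypic act (irr_repr j.1)) by apply: lin_span_linear.
by split=> // a u v [du su] [dv sv]; split; [apply: b2 | apply: i2].
Qed.

Lemma component_span k : lin_span (fun k => exists j, component j k) k.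
Proof.
have := K_span irrM sm_in_neq0 k; apply: lin_span_sub => u [[m l] du].
rewrite -(sum_pi u); apply: subspace_sum => // sigma _.
apply: lin_span_incl; exists (sigma, (m, l)); split; first exact: pi_bidegree.
exact: pi_isotypic.
Qed.

Definition separating_op (o : bool + What) : {linear K -> K} :=
  match o with
  | inl true => linear_map (mactP aP (gH A))
  | inl false => linear_map (mactP aP (exterior_degree A))
  | inr sigma => linear_map (pi_linear sigma)
  end.

Definition separating_ev (j : index) (o : bool + What) : C :=
  match o with
  | inl true => muN j
  | inl false => j.2.2%:R
  | inr sigma => (sigma == j.1)%:R
  end.

Lemma component_eigen j k o : component j k ->
  separating_op o k = separating_ev j o *: k.
Proof.
case=> dk sk; case: o => [[]|sigma] /=.
- exact: (act_gH actK (NP tau) dk).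
- exact: (exterior_degreeE actK dk).
have [->|ns] := eqVneq sigma j.1; first by rewrite pi_id // scale1r.
by rewrite (pi_other ns sk) scale0r.
Qed.

Lemma separating_evP j j' : j != j' -> exists o, separating_ev j o != separating_ev j' o.
Proof.
case: j j' => [s [m l]] [s' [m' l']] nj.
have [E|ns] := eqVneq s s'; last first.
  by exists (inr s); rewrite /= eqxx (negbTE ns) oner_eq0.
have [E1|nm] := eqVneq m m'; last first.
  by exists (inl true); rewrite /= (inj_eq (addIr _)) (inj_eq (addIr _)) eqr_nat.
exists (inl false); rewrite /= eqr_nat; apply: contraNneq nj => ->.
by rewrite E E1.
Qed.

(** A linear map [Q] that sends distinct components into distinct components kills a
    sum only if it kills every term, since [H], the exterior degree and the isotypic
    projections separate components. *)
Lemma components_eq0 (s : seq index) (f : index -> K) (Q : K -> K) (sh : index -> index) :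
  linear Q -> uniq s ->
  (forall j, j \in s -> Q (f j) != 0 -> component (sh j) (Q (f j))) ->
  (forall j j', j \in s -> j' \in s -> Q (f j) != 0 -> Q (f j') != 0 ->
     sh j = sh j' -> j = j') ->
  Q (\sum_(j <- s) f j) = 0 -> forall j, j \in s -> Q (f j) = 0.
Proof.
move=> linQ us compQ injsh Q0 j js; apply/eqP; apply: contraT => Qj.
pose LQ := linear_map linQ.
have Q0' : \sum_(i <- s) Q (f i) = 0 by rewrite -[LHS](linear_sum LQ).
case/eqP: Qj; set z0 := Q (f j).
have [z00|z0n] := eqVneq z0 0; first by [].
pose t := rem j s; pose z (i : 'I_(size t)) := - Q (f (nth j t i)).
have ts (i : 'I_(size t)) : nth j t i \in s by apply: mem_rem; apply: mem_nth.
have tj (i : 'I_(size t)) : nth j t i != j.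
  by have := mem_nth j (ltn_ord i); rewrite /t mem_rem_uniq // inE => /andP[].
apply: (@separated_eigenvectors _ K _ separating_op _ z z0
   (fun i => separating_ev (sh (nth j t i))) (separating_ev (sh j))).
- by move=> o; apply: component_eigen; apply: compQ.
- move=> i; rewrite oppr_eq0 => zi o.
  by rewrite linearN /= scalerN (component_eigen o (compQ _ (ts i) zi)).
- move=> i; rewrite oppr_eq0 => zi; apply: separating_evP.
  by apply: contra_neq (tj i); apply: injsh.
have := Q0'; rewrite (big_rem j) //= -/t -/z0 => /eqP; rewrite addr_eq0 => /eqP ->.
by rewrite (big_nth j) big_mkord -sumrN.
Qed.

Lemma act_Omega (sigma : What) k : isotypic act (irr_repr sigma) k ->
  act (Omega A) k = N sigma *: k.
Proof.
apply: (lin_span_min (S := fun k => act (Omega A) k = N sigma *: k)).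
  split=> [|a u v Eu Ev]; first by rewrite (mact0r aP) scaler0.
  by rewrite (mactP aP) Eu Ev scalerDr !scalerA mulrC.
move=> _ [f [v [-> fs]]]; rewrite (mact_suml aP).
transitivity (f ((N sigma)%:M *m v)); last by rewrite mul_scalar_mx linearZ.
rewrite -NP mulmx_suml linear_sum; apply: eq_bigr => k' _.
by rewrite (mactZl aP) -fs -scalemxAl linearZ.
Qed.

Lemma component_gZ j k : component j k -> act (gZ A) k = nuN j *: k.
Proof.
case=> dk sk; rewrite gZ_exterior_degree (mactDl aP) (mactBl aP) (mactZl aP).
rewrite (mact1 aP) (exterior_degreeE actK dk) (act_Omega sk).
by rewrite -scalerBl -scalerDl.
Qed.

Lemma component_gH j k : component j k -> act (gH A) k = muN j *: k.
Proof. by move=> cjk; apply: (component_eigen (inl true) cjk). Qed.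

Lemma isotypic_act (sigma : What) Q k : W_commuting Q ->
  isotypic act (irr_repr sigma) k -> isotypic act (irr_repr sigma) (act Q k).
Proof. by move=> cQ sk; rewrite -(pi_id sk) -pi_commute //; apply: pi_isotypic. Qed.

Lemma W_commuting_gEm a : W_commuting (gEm A a).
Proof.
case: a => [[]|]; [apply: W_commuting_gE3m | apply: W_commuting_gE2m |].
by apply: W_commutingN; apply: W_commuting_gE1m.
Qed.

Lemma Mc_component (j : index) k : Mc j k -> component j k.
Proof. by case. Qed.

Lemma Mc_linear (j : index) : linear_subspace (fun k => Mc j k).
Proof.
have [c0 clin] := component_linear j; split=> [|a u v Mu Mv].
  case: c0 => b0' i0; split=> //; apply/(killedP actK) => a.
  by rewrite (mact0r aP).
have [b1 i1] : component j (a *: u + v) by apply: clin; apply: Mc_component.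
split=> //; case: Mu Mv => _ _ /(killedP actK) ku [_ _ /(killedP actK) kv].
by apply/(killedP actK) => e; rewrite (mactP aP) ku kv scaler0 addr0.
Qed.

Lemma Mc_weight (j : index) k : Mc j k -> weight_space act (muN j) (nuN j) k.
Proof.
move=> Mk; have cjk := Mc_component Mk.
by split; [apply: component_gH | apply: component_gZ | case: Mk].
Qed.

Lemma weight_sum_eq0 m l (sigma : What) :
  muN (sigma, (m, l)) + nuN (sigma, (m, l)) = 0 -> m = 0%N /\ l = 0%N.
Proof.
rewrite /muN /nuN /= => E.
have {}E : N tau - N sigma = (m + l)%:R.
  apply/eqP; rewrite -subr_eq0 -oppr_eq0 -E natrD; apply/eqP; ring.
have [Es|ns] := eqVneq sigma tau; last first.
  by have := Nsep ns (m + l); rewrite E eqxx.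
move/eqP: E; rewrite Es subrr eq_sym pnatr_eq0 addn_eq0.
by case/andP => /eqP -> /eqP ->.
Qed.

Lemma gE2m_gE2p_lowest (j : index) k : Mc j k ->
  act (gE2m A) (act (gE2p A) k) = (muN j + nuN j) *: k.
Proof.
move=> Mk; have [kH kZ [_ k2 _]] := Mc_weight Mk.
rewrite (mact_anticommutator aP) k2 (mact0r aP) oppr0 add0r gE2m_gE2p.
by rewrite (mactDl aP) kH kZ -scalerDl.
Qed.

(** By [weight_sum_eq0], [E_2^+] can kill [u] only when [m = l = 0]. It does kill
    bidegrees [(0, l)] and [(m, r)] for lack of room. For bidegree [(m, r - 1)] the
    vector [E_2^+ u] of top exterior degree is killed by [E_3^-], so its coefficient
    is killed by all [y], which forces its degree [m - 1] to be 0. *)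
Lemma lowest_weight_bidegree (j : index) u : Mc j u -> u != 0 -> Bset r j.2.
Proof.
case: j => sigma [m l] Mu u0; have cu := Mc_component Mu; have [du su] := cu.
have E := gE2m_gE2p_lowest Mu; rewrite /= in du su.
rewrite /Bset /=.
have [lr|rl] := leqP l r; last by case/eqP: u0; apply: (bidegree_top rl du).
have contr0 : act (gE2p A) u = 0 -> m = 0%N /\ l = 0%N.
  move=> E0; apply: (@weight_sum_eq0 m l sigma); move: E; rewrite E0 (mact0r aP).
  by move/esym/eqP; rewrite scaler_eq0 (negbTE u0) orbF => /eqP.
have [m0|m0] := posnP m.
  have [_ ->] : m = 0%N /\ l = 0%N; last by rewrite m0.
  apply: contr0; rewrite (act_gE2p actK) big1 // => i _.
  by apply: (bidegree_y0 actK (l := l.+1)); apply: (bidegree_xi actK); rewrite -m0.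
have [lr2|] := leqP l.+2 r; first by rewrite orbT.
rewrite ltnS leq_eqVlt => /predU1P[rl1|]; last first.
  rewrite ltnS => rl; have Elr : l = r by apply/eqP; rewrite eqn_leq lr.
  have [E1 _] : m = 0%N /\ l = 0%N; last by rewrite E1 in m0.
  apply: contr0; rewrite (act_gE2p actK) big1 // => i _.
  have dur : bideg m r u by rewrite Elr in du.
  by rewrite (bidegree_wedge_top actK i dur) (mact0r aP).
case: m m0 Mu cu du E contr0 => [//|[|m]] _ Mu cu du E contr0; first by rewrite rl1 !eqxx.
set w := act (gE2p A) u in E contr0.
have dw : bideg m.+1 r w.
  apply: (bidegree_raised actK (a := Some false)) => /=; first by rewrite rl1.
  by have -> : r.-1 = l by rewrite rl1.
have [_ _ [k1 k2 k3]] := Mc_weight Mu.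
have w3 : act (gE3m A) w = 0.
  rewrite (mact_anticommutator aP) k3 (mact0r aP) oppr0 add0r gE3m_gE2p.
  by rewrite (mactNl aP) (mactZl aP) k1 scaler0 oppr0.
pose f := w [set: 'I_r]%SET.
have df : deg m.+1 f by have := dw [set: 'I_r]%SET; rewrite cardsT card_ord eqxx.
suff f0 : f = 0.
  have [] : m.+2 = 0%N /\ l = 0%N; last by [].
  apply: contr0; apply/ffunP => S; rewrite ffunE; have := dw S.
  case: eqP => // Sr _; have -> : S = [set: 'I_r]%SET.
    by apply/eqP; rewrite eqEcard finset.subsetT cardsT card_ord Sr leqnn.
  exact: f0.
apply: (killed_degree0 (m := m)) => // i.
have := congr1 (fun k : K => k (~: [set i])%SET) w3.
rewrite (act_gE3m actK) !ffunE sum_ffunE (bigD1 i) //= big1 => [|j ji].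
  rewrite addr0 (act_inl actK) (act_eta actK) ffunE !inE eqxx /=.
  rewrite finset.setUCr (mactZr smP) => /eqP; rewrite oppr_eq0 scaler_eq0 signr_eq0 /=.
  by move/eqP.
by rewrite (act_inl actK) (act_eta actK) ffunE !inE ji (mact0r smP).
Qed.

(** The components of a lowest weight vector are lowest weight vectors, because the
    lowering operators map distinct components into distinct components. *)
Lemma weight_space_span mu nu k : weight_space act mu nu k ->
  lin_span (fun u => exists2 j : index, [&& Bset r j.2, muN j == mu & nuN j == nu] & Mc j u) k.
Proof.
case=> kH kZ /(killedP actK) kE.
have [s [f [us cf kf]]] := span_grouped component_linear (component_span k).
have eigen Q ev e : (forall j u, component j u -> act Q u = ev j *: u) ->
    act Q k = e *: k -> forall j, j \in s -> f j != 0 -> ev j = e.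
  move=> evP kQ; pose Q' k' := act Q k' - e *: k'.
  have linQ : linear Q'.
    move=> a u v; rewrite /Q' (mactP aP) scalerBr scalerDr !scalerA (mulrC e).
    by rewrite opprD addrACA.
  have Qf j : Q' (f j) = (ev j - e) *: f j by rewrite /Q' (evP _ _ (cf j)) scalerBl.
  move=> j js fj; apply/eqP; rewrite -subr_eq0.
  have : Q' (f j) = 0.
    apply: (components_eq0 (sh := id) linQ us) => // [j' _ _|].
      by rewrite Qf; apply: (subspaceZ _ (component_linear _)).
    by rewrite -kf /Q' kQ subrr.
  by move/eqP; rewrite Qf scaler_eq0 (negbTE fj) orbF.
have fE a j : j \in s -> act (gEm A a) (f j) = 0.
  apply: (components_eq0 (sh := fun j => (j.1, lowered a j.2)) (mactP aP _) us).
  - move=> j' _ nz; have [dj sj] := cf j'.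
    have := bidegree_lowered actK a dj; case: ifP => [_ dE|_ z]; last by rewrite z eqxx in nz.
    split=> //; by apply: isotypic_act => //; apply: W_commuting_gEm.
  - move=> j1 j2 _ _ nz1 nz2 [E1 E2].
    have low j' : act (gEm A a) (f j') != 0 -> lowerable a j'.2.
      apply: contra_neqT => nl; have [dj _] := cf j'.
      by have := bidegree_lowered actK a dj; rewrite (negbTE nl).
    have := lowered_inj (low _ nz1) (low _ nz2) E2.
    by case: j1 j2 E1 {nz1 nz2 E2} => [? ?] [? ?] /= -> ->.
  - by rewrite -kf.
rewrite kf big_seq; apply: subspace_sum => // j js.
have [->|fj] := eqVneq (f j) 0; first exact: lin_span0.
have Mfj : Mc j (f j).
  by have [dj sj] := cf j; split=> //; apply/(killedP actK) => a; apply: fE.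
apply: lin_span_incl; exists j => //.
rewrite (lowest_weight_bidegree Mfj fj) (eigen _ _ _ component_gH kH _ js fj) eqxx.
by rewrite (eigen _ _ _ component_gZ kZ _ js fj) eqxx.
Qed.

Lemma Mc_independent (s : seq index) (z : index -> K) : uniq s ->
  (forall j, j \in s -> Mc j (z j)) -> \sum_(j <- s) z j = 0 ->
  forall j, j \in s -> z j = 0.
Proof.
move=> us Mz; apply: (components_eq0 (Q := idfun) (sh := id)) => // j js _.
by apply: Mc_component; apply: Mz.
Qed.

Lemma Mc_finite (j : index) : finite_dimensional (fun k => Mc j k).
Proof.
have [s [_ sP]] := bidegree_finite M j.2.1 j.2.2.
by apply: (finite_dimensional_seq (s := s)) => k [dk _ _]; apply: sP.
Qed.

Lemma Mc_homogeneous (j : index) k : Mc j k -> homogeneous (odd j.2.2) k.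
Proof.
case=> dk _ _; apply/ffunP => S; rewrite !ffunE; have := dk S.
by case: eqP => [->|_ ->]; rewrite ?signr_odd ?scaler0.
Qed.

(** * The decomposition of K *)

Local Notation KG := (K_module actK).

Lemma gword_isotypic (j : index) u x : Mc j u -> gword_span (u : KG) x ->
  isotypic act (irr_repr j.1) x.
Proof.
move=> Mu; apply: lin_span_min; first exact: lin_span_linear.
move=> _ [w ->]; elim: w => [|a w IHw] /=; first by case: Mu.
by apply: isotypic_act => //; apply: W_commuting_gEp.
Qed.

Lemma Mc_orthogonal (i j : index) u u' : i.2 != j.2 -> Mc i u -> Mc j u' ->
  form u u' = 0.
Proof.
move=> ij Mu Mu'; have [du _] := Mc_component Mu; have [du' _] := Mc_component Mu'.
have [E1|n1] := eqVneq i.2.1 j.2.1; last first.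
  apply: (selfadjoint_orthogonal contra pos_beta
    (adjointable_gH starP actK contra) (star_gH starP) _
    (component_gH (Mc_component Mu)) (component_gH (Mc_component Mu'))).
  by rewrite (inj_eq (addIr _)) (inj_eq (addIr _)) eqr_nat.
apply: (selfadjoint_orthogonal contra pos_beta
    (adjointable_exterior_degree starP actK contra) (star_exterior_degree starP) _
    (exterior_degreeE actK du) (exterior_degreeE actK du')).
rewrite eqr_nat; apply: contraNneq ij => E2.
by rewrite [i.2]surjective_pairing [j.2]surjective_pairing E1 E2.
Qed.

Section TensorDecomposition.

Variable L : C -> C -> g_module A.
Hypothesis LP : forall mu nu, irreducible_lowest_weight mu nu (L mu nu).

Lemma generator_exists mu nu : exists v : L mu nu,
  [/\ lowest_weight_vector mu nu v, v != 0 & forall z, gword_span v z].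
Proof.
have [[v [v0 vk vH vZ gen]] _] := LP mu nu; exists v.
have lwv : lowest_weight_vector mu nu v by split.
split=> // z; apply: gen; first exact: gword_span_submodule lwv.
by apply: lin_span_incl; exists [::].
Qed.

Definition generator mu nu : L mu nu := sval (cid (generator_exists mu nu)).

Lemma generator_lowest mu nu : lowest_weight_vector mu nu (generator mu nu).
Proof. by have [] := svalP (cid (generator_exists mu nu)). Qed.

Lemma generator_neq0 mu nu : generator mu nu != 0.
Proof. by have [] := svalP (cid (generator_exists mu nu)). Qed.

Lemma generator_span mu nu z : gword_span (generator mu nu) z.
Proof. by have [_ _] := svalP (cid (generator_exists mu nu)); apply. Qed.

Definition weight_map mu nu : K -> L mu nu -> K :=
  tensor_map actK (@generator_span mu nu).

Local Notation t j := (weight_map (mu := muN j) (nu := nuN j)).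
Local Notation image j := (tensor_image (fun u => Mc j u) (t j)).

Lemma weight_map_act (j : index) p X u v : in_g p X -> Mc j u ->
  act X (t j u v) = (-1) ^+ (p && odd j.2.2) *: t j u (g_act X v).
Proof.
move=> inX Mu; apply: (tensor_map_act starP actK contra pos_beta (generator_lowest _ _)
  (generator_neq0 _ _) _ _ inX (Mc_weight Mu)).
exact: Mc_homogeneous.
Qed.

Lemma weight_map_generator (j : index) u : Mc j u -> t j u (generator (muN j) (nuN j)) = u.
Proof.
move=> Mu; apply: (tensor_map_lowest starP actK contra pos_beta (generator_lowest _ _)
  (generator_neq0 _ _) _ (Mc_weight Mu) (Mc_homogeneous Mu)).
Qed.

Lemma weight_map_bilinear mu nu :
  bilinear_on (weight_space act mu nu) (weight_map (mu := mu) (nu := nu)).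
Proof.
apply: (tensor_map_bilinear starP actK contra pos_beta (generator_lowest _ _)
  (generator_neq0 _ _)).
Qed.

Lemma weight_mapZr (j : index) u a v : Mc j u -> t j u (a *: v) = a *: t j u v.
Proof.
move=> Mu; have [_ lin] := weight_map_bilinear (muN j) (nuN j).
have wu := Mc_weight Mu; have t0 : t j u 0 = 0.
  by have := lin (-1) u 0 0 wu; rewrite scaler0 addr0 scaleN1r addNr.
by have := lin a u v 0 wu; rewrite !addr0 t0 addr0.
Qed.

Lemma weight_map_injective (j : index) : tensor_injective (fun u => Mc j u) (t j).
Proof.
apply: (tensor_map_injective starP contra pos_beta (generator_lowest _ _)
  (generator_neq0 _ _) _ (l := odd j.2.2)).
- by have [] := LP (muN j) (nuN j).
- by move=> u Mu; split; [apply: Mc_weight | apply: Mc_homogeneous].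
Qed.

Lemma weight_map_span (j : index) u v : Mc j u -> gword_span (u : KG) (t j u v).
Proof. by move=> Mu; apply: tensor_map_span (Mc_weight Mu) (Mc_homogeneous Mu). Qed.

Lemma image_isotypic (j : index) x : image j x -> isotypic act (irr_repr j.1) x.
Proof.
case=> n [u [v [Mu ->]]]; apply: subspace_sum => [|k _]; first exact: lin_span_linear.
exact: gword_isotypic (Mu k) (weight_map_span _ (Mu k)).
Qed.

Lemma image_orthogonal (i j : index) x y : i.2 != j.2 -> image i x -> image j y ->
  form x y = 0.
Proof.
move=> ij [n [u [v [Mu ->]]]] [n' [u' [v' [Mu' ->]]]].
rewrite (herm_suml herm_form) big1 // => k _.
rewrite (herm_sumr herm_form) big1 // => k' _.
apply: (weight_space_orthogonal starP contra (Mc_weight (Mu k))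
   (Mc_weight (Mu' k')) (Mc_orthogonal ij (Mu k) (Mu' k'))).
  exact: weight_map_span.
exact: weight_map_span.
Qed.

(** Spanning is [raising_span]. In a relation, the isotypic projections first single
    out the terms of one type [sigma], and terms of different bidegrees are
    orthogonal. *)
Lemma K_decomposition :
  direct_sum_over (fun j : index => Bset r j.2) (fun j => image j) (fun _ => True).
Proof.
split=> [//|k _|s z us _ zP z0 i0 i0s].
- set S := lin_span _; have linS : linear_subspace S by apply: lin_span_linear.
  have Sraise a k' : S k' -> S (act (gEp A a) k').
    apply: lin_span_map; first exact: mactP aP _.
    move=> _ [j Bj [n [u [v [Mu ->]]]]]; apply: lin_span_incl; exists j => //.
    exists n, u, (fun k => (-1) ^+ (isSome a && odd j.2.2) *: g_act (gEp A a) (v k)).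
    split=> //; rewrite (mact_sumr aP); apply: eq_bigr => k'' _.
    by rewrite (weight_map_act _ (gEp_in A a) (Mu _)) weight_mapZr.
  have Slow m l u : bideg m l u -> killed_by_nminus act u -> S u.
    move=> du /(killedP actK) uk; rewrite -(sum_pi u).
    apply: (subspace_sum _ linS) => sigma _; pose j : index := (sigma, (m, l)).
    have [->|p0] := eqVneq (pi sigma u) 0; first by case: linS.
    have Mu : Mc j (pi sigma u).
      split; [exact: pi_bidegree | exact: pi_isotypic | apply/(killedP actK) => a].
      rewrite -pi_commute ?uk; last exact: W_commuting_gEm.
      exact: linear_zero (pi_linear sigma).
    apply: lin_span_incl; exists j; first exact: lowest_weight_bidegree Mu p0.
    exists 1, (fun=> pi sigma u), (fun=> generator _ _); split=> //.
    by rewrite big_ord1 weight_map_generator.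
  apply: lin_span_min (K_span irrM sm_in_neq0 k) => // u [[m l] du].
  exact: (raising_span starP actK contra pos_beta linS Sraise Slow) du.
have proj0 : \sum_(i <- s | i.1 == i0.1) z i = 0.
  have := congr1 (linear_map (pi_linear i0.1)) z0.
  rewrite linear0 linear_sum /= => E; rewrite -[RHS]E big_mkcond [LHS]big_seq [RHS]big_seq.
  apply: eq_bigr => i is_; have si := image_isotypic (zP _ is_).
  case: eqP => [<-|ns]; first by rewrite pi_id.
  by rewrite (pi_other _ si) //; apply/eqP => E0; case: ns.
apply: (herm_definite pos_form); have := congr1 (fun k => form k (z i0)) proj0.
rewrite (herm0l herm_form) (herm_suml herm_form) -big_filter (bigD1_seq i0) /=.
- rewrite big1_seq ?addr0 // => i /andP[ni]; rewrite mem_filter => /andP[/eqP si is_].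
  apply: (image_orthogonal _ (zP _ is_) (zP _ i0s)); apply: contraNneq ni => E.
  by rewrite (surjective_pairing i) (surjective_pairing i0) si E.
- by rewrite mem_filter eqxx.
- exact: filter_uniq.
Qed.

End TensorDecomposition.

End WithDiagonalAction.

End Decomposition.

Theorem theorem4 (R : realType) (r : nat) (Phi : root_system R r)
    (gT : finGroupType) (W : reflection_group Phi gT)
    (What : irrType R[i] W) (tau : What)
    (b0 : 'cV[R[i]]_(irr_degree tau) -> 'cV[R[i]]_(irr_degree tau) -> R[i])
    (U : set 'rV[R]_(nroots Phi)) (c : 'rV[R]_(nroots Phi))
    (Hc : cherednik W c) (Cl : clifford R[i] r) (A : tensor_algebra Hc Cl)
    (star : A -> A)
    (M : standard_module Hc (irr_repr tau)) (beta : M -> M -> R[i])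
    (act : A -> {ffun {set 'I_r} -> M} -> {ffun {set 'I_r} -> M})
    (N : What -> R[i]) (L : R[i] -> R[i] -> g_module A) :
  invariant_form (irr_repr tau) b0 ->
  unitary_neighbourhood (irr_repr tau) b0 U ->
  U c ->
  antilinear_involution star ->
  contravariant_form b0 beta ->
  K_action act ->
  (forall sigma, is_N_scalar c (irr_repr sigma) (N sigma)) ->
  (forall mu nu, irreducible_lowest_weight mu nu (L mu nu)) ->
  (forall k : nat, r%:R / 2 - N tau != - k%:R) ->
  (forall sigma, sigma != tau -> forall k : nat, N tau - N sigma != k%:R) ->
  let mu (i : What * (nat * nat)) : R[i] := i.2.1%:R + r%:R / 2 - N tau in
  let nu (i : What * (nat * nat)) : R[i] := i.2.2%:R - r%:R / 2 + N i.1 in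
  let B : pred (What * (nat * nat)) := fun i => Bset r i.2 in
  let Mc (i : What * (nat * nat)) :=
    lowest_weight_vectors act (irr_repr i.1) i.2.1 i.2.2 in
  let LW := weight_space act in
  (exists t : forall m n : R[i],
      {ffun {set 'I_r} -> M} -> L m n -> {ffun {set 'I_r} -> M},
    [/\ (forall m n, bilinear_on (LW m n) (t m n)),
        (* Koszul sign: u has parity l in M_c(tau, sigma)_m^l *)
        (forall i p X u v, B i -> in_g p X -> Mc i u ->
           act X (t (mu i) (nu i) u v) =
             (-1) ^+ (p && odd i.2.2) *: t (mu i) (nu i) u (g_act X v)),
        (forall m n rho u v, supercentraliser rho -> LW m n u ->
           act rho (t m n u v) = t m n (act rho u) v),
        (forall i, B i -> tensor_injective (Mc i) (t (mu i) (nu i)))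
      & direct_sum_over B (fun i => tensor_image (Mc i) (t (mu i) (nu i)))
          (fun _ => True)]) /\
  (forall i, B i ->
    [/\ finite_dimensional (Mc i),
        direct_sum_over
          (fun j => [&& B j, mu j == mu i & nu j == nu i]) Mc (LW (mu i) (nu i)),
        unitary_Rc_module act beta star (LW (mu i) (nu i))
      & (forall j u, B j -> mu j = mu i -> nu j = nu i -> Mc j u -> u != 0 ->
           j = i) ->
        unitary_Rc_module act beta star (Mc i)]).
Proof.
move=> b0P [_ _ Uirr] Uc starP contra actK NP LP _ Nsep mu nu B Mc LW.
have [irrM posM] := Uirr c Uc Hc M; have pos_beta := posM beta contra.
have [D [[Dlin D1 DM Ds DQ] Dbideg]] := diagonal_action actK.
have McLW i k : Mc i k -> LW (mu i) (nu i) k.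
  exact: (Mc_weight actK NP Dlin D1 DM Ds).
split.
  exists (fun m n => weight_map actK LP (mu := m) (nu := n)); split.
  - exact: (weight_map_bilinear starP actK contra pos_beta LP).
  - move=> i p X u v _.
    exact: (weight_map_act starP actK contra pos_beta NP Dlin D1 DM Ds LP).
  - by move=> m n rho u v rhoP _; apply: tensor_map_supercentraliser.
  - move=> i _.
    exact: (weight_map_injective starP contra pos_beta NP Dlin D1 DM Ds).
  - exact: (K_decomposition starP actK contra pos_beta b0P irrM NP Nsep Dlin D1 DM
              Ds DQ Dbideg LP).
have LWsum i : direct_sum_over
    (fun j => [&& B j, mu j == mu i & nu j == nu i]) Mc (LW (mu i) (nu i)).
  split=> [j z /and3P[_ /eqP <- /eqP <-]|z wz|s z us _ Mz z0].
  - exact: McLW.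
  - exact: (weight_space_span actK contra pos_beta b0P irrM NP Nsep Dlin D1 DM Ds
              DQ Dbideg wz).
  - exact: (Mc_independent actK NP Dlin D1 DM Ds us Mz z0).
have LWunitary m n : unitary_Rc_module act beta star (LW m n).
  exact: (weight_space_unitary starP actK contra pos_beta).
move=> i Bi; split=> // [|alone]; first exact: Mc_finite.
(* Then [Mc i] is the whole weight space, on which the supercentraliser acts. *)
suff -> : Mc i = LW (mu i) (nu i) by [].
apply/funext => k; apply/propext; split; first exact: McLW.
have linM : linear_subspace (Mc i) by apply: (Mc_linear actK).
have [_ span_ _] := LWsum i; move=> /span_; apply: lin_span_min => // u.
case=> j /and3P[Bj /eqP muj /eqP nuj] Mu.
have [->|u0] := eqVneq u 0; first by case: linM.
by rewrite -(alone j u).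
Qed.
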